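(* For each of the 54 families of data in Lists 1–5 of the context, let $G$, $\mathcal S$ and the compact manifold $\mathrm{Gr}^*$ be as defined there. Define $\iota:\mathcal S\to\mathrm{Gr}^*$ by $\iota(Q_1,Q_2)=Q_1$ for Lists 1, 3, 4 and by $\iota(Q_1,Q_2)=(Q_1,Q_2)$ for Lists 2, 5. Then $\iota$ is an open embedding; in particular, the image of each symmetric space $G/H\subset\mathcal S$ in $\mathrm{Gr}^*$ is open in all cases. Moreover, the image of $G/H$ is dense in $\mathrm{Gr}^*$ in all cases except the 10 series marked by $\star$.
   Context: **Forms and groups.** $\mathbb K$ is $\mathbb R$, $\mathbb C$ or $\mathbb H$; linear spaces over $\mathbb H$ are right modules, and all spaces are finite-dimensional. A map $B:V\times V\to\mathbb K$ is sesquilinear if it is biadditive and $B(v\lambda,w)=B(v,w)\lambda$, $B(v,w\lambda)=\overline\lambda B(v,w)$. It is hermitian if moreover $B(v,w)=\overline{B(w,v)}$, antihermitian if $B(v,w)=-\overline{B(w,v)}$. A *form* is a nondegenerate form of one of the types: bilinear symmetric or skew-symmetric over $\mathbb R$ or $\mathbb C$; hermitian or antihermitian over $\mathbb C$ or $\mathbb H$. $\mathcal U(B)$ is the group of invertible $\mathbb K$-linear operators preserving $B$. Notation: $\mathrm{Sp}(2n,\mathbb R),\mathrm{Sp}(2n,\mathbb C)$ (skew-symmetric bilinear forms on $\mathbb R^{2n},\mathbb C^{2n}$), $\mathrm O(n,\mathbb C)$ (symmetric bilinear form on $\mathbb C^n$), $\mathrm O(p,q),\mathrm U(p,q),\mathrm{Sp}(p,q)$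 (hermitian forms with inertia indices $(p,q)$ on $\mathbb R^{p+q},\mathbb C^{p+q},\mathbb H^{p+q}$; over $\mathbb R$ hermitian means symmetric), $\mathrm{SO}^*(2n)$ (antihermitian form on $\mathbb H^n$). A subspace is $B$-isotropic if $B$ vanishes identically on it. $B$ is *split* if there is a $B$-isotropic subspace of dimension $\frac12\dim V$. For split $B$, $\mathrm{Gr}(V,B)$ is the manifold of all maximal $B$-isotropic subspaces of $V$; $\mathrm{Gr}_k(V)$ is the manifold of all $k$-dimensional subspaces. **Semiinvolutions.** A semiinvolution is an operator $J:V\to V$, linear or (only if $\mathbb K=\mathbb C$) antilinear, with $J^2=\pm1$. $J$ is split if $V=Q\oplus JQ$ for some subspace $Q$. $J$ is consistent with $B$ if, with $\mu=\pm1$, $B(Jv,Jw)=\mu B(v,w)$ ($J$ linear) or $B(Jv,Jw)=\mu\overline{B(v,w)}$ ($J$ antilinear). In that case the *managing form* is $D(v,w)=B(v,Jw)$. The pair $(B,J)$ is *split* if $V=Q\oplus JQ$ for some $B$-isotropic subspace $Q$. **List 1.** $(B,J)$ is a split pair on $V$ of the type given in the row; in the rows with parameters $(p,q)$ it is moreover required that $D$ (symmetric over $\mathbb R$, hermitian otherwise) has inertia indices $(2p,2q)$. $G=\{g\in\mathcal U(B): gJ=Jg\}$. $\mathcal S=\mathcal S(B,J)$ is the set of ordered pairs $(Q_1,Q_2)$ of maximal $B$-isotropic subspaces with $V=Q_1\oplus Q_2$, $JQ_1=Q_2$. $\mathrm{Gr}^*=\mathrm{Gr}(V,B)$. Each row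 reads: $G/H$; $V$; type of $B$; type of $J$ (for $\mathbb K=\mathbb C$); $(J^2,\mu)$. In unstarred rows $\mathcal S=G/H$; in $\star$ rows $\mathcal S$ is the disjoint union of orbits $G/H$ over $p=0,1,\dots,n$. 1. $\mathrm O(p,q)\times\mathrm O(p,q)/\mathrm O(p,q)$; $\mathbb R^{2(p+q)}$; symmetric; $(1,1)$. 2. $\mathrm{Sp}(2n,\mathbb R)\times\mathrm{Sp}(2n,\mathbb R)/\mathrm{Sp}(2n,\mathbb R)$; $\mathbb R^{4n}$; skew-symmetric; $(1,1)$. 3$\star$. $\mathrm{GL}(n,\mathbb R)/\mathrm O(p,n-p)$; $\mathbb R^{2n}$; skew-symmetric; $(1,-1)$. 4. $\mathrm{GL}(2n,\mathbb R)/\mathrm{Sp}(2n,\mathbb R)$; $\mathbb R^{4n}$; symmetric; $(1,-1)$. 5$\star$. $\mathrm O(n,\mathbb C)/\mathrm O(p,n-p)$; $\mathbb R^{2n}$; symmetric; $(-1,-1)$. 6. $\mathrm{Sp}(2n,\mathbb C)/\mathrm{Sp}(2n,\mathbb R)$; $\mathbb R^{4n}$; skew-symmetric; $(-1,-1)$. 7. $\mathrm U(n,n)/\mathrm{Sp}(2n,\mathbb R)$; $\mathbb R^{4n}$; symmetric; $(-1,1)$. 8. $\mathrm U(p,q)/\mathrm O(p,q)$; $\mathbb R^{2(p+q)}$; skew-symmetric; $(-1,1)$. 9. $\mathrm O(n,\mathbb C)\times\mathrm O(n,\mathbb C)/\mathrm O(n,\mathbb C)$; $\mathbb C^{2n}$;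 symmetric; linear; $(1,1)$. 10. $\mathrm{Sp}(2n,\mathbb C)\times\mathrm{Sp}(2n,\mathbb C)/\mathrm{Sp}(2n,\mathbb C)$; $\mathbb C^{4n}$; skew-symmetric; linear; $(1,1)$. 11. $\mathrm U(p,q)\times\mathrm U(p,q)/\mathrm U(p,q)$; $\mathbb C^{2(p+q)}$; hermitian; linear; $(1,1)$. 12. $\mathrm{GL}(2n,\mathbb C)/\mathrm{Sp}(2n,\mathbb C)$; $\mathbb C^{4n}$; symmetric; linear; $(1,-1)$. 13. $\mathrm{GL}(n,\mathbb C)/\mathrm O(n,\mathbb C)$; $\mathbb C^{2n}$; skew-symmetric; linear; $(1,-1)$. 14$\star$. $\mathrm{GL}(n,\mathbb C)/\mathrm U(p,n-p)$; $\mathbb C^{2n}$; hermitian; linear; $(1,-1)$. 15$\star$. $\mathrm{Sp}(2n,\mathbb R)/\mathrm U(p,n-p)$; $\mathbb C^{2n}$; skew-symmetric; antilinear; $(1,1)$. 16. $\mathrm O(2p,2q)/\mathrm U(p,q)$; $\mathbb C^{2(p+q)}$; symmetric; antilinear; $(1,1)$. 17. $\mathrm O(n,n)/\mathrm O(n,\mathbb C)$; $\mathbb C^{2n}$; hermitian; antilinear; $(1,1)$. 18. $\mathrm{Sp}(4n,\mathbb R)/\mathrm{Sp}(2n,\mathbb C)$; $\mathbb C^{4n}$; hermitian; antilinear; $(1,-1)$. 19. $\mathrm{Sp}(p,q)/\mathrm U(p,q)$; $\mathbb C^{2(p+q)}$; skew-symmetric; antilinear; $(-1,1)$. 20$\star$.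 $\mathrm{SO}^*(2n)/\mathrm U(p,n-p)$; $\mathbb C^{2n}$; symmetric; antilinear; $(-1,1)$. 21. $\mathrm{Sp}(n,n)/\mathrm{Sp}(2n,\mathbb C)$; $\mathbb C^{4n}$; hermitian; antilinear; $(-1,1)$. 22. $\mathrm{SO}^*(2n)/\mathrm O(n,\mathbb C)$; $\mathbb C^{2n}$; hermitian; antilinear; $(-1,-1)$. 23. $\mathrm{Sp}(p,q)\times\mathrm{Sp}(p,q)/\mathrm{Sp}(p,q)$; $\mathbb H^{2(p+q)}$; hermitian; $(1,1)$. 24. $\mathrm{SO}^*(2n)\times\mathrm{SO}^*(2n)/\mathrm{SO}^*(2n)$; $\mathbb H^{2n}$; antihermitian; $(1,1)$. 25. $\mathrm{GL}(n,\mathbb H)/\mathrm{SO}^*(2n)$; $\mathbb H^{2n}$; hermitian; $(1,-1)$. 26$\star$. $\mathrm{GL}(n,\mathbb H)/\mathrm{Sp}(p,n-p)$; $\mathbb H^{2n}$; antihermitian; $(1,-1)$. 27. $\mathrm U(2p,2q)/\mathrm{Sp}(p,q)$; $\mathbb H^{2(p+q)}$; antihermitian; $(-1,1)$. 28. $\mathrm U(n,n)/\mathrm{SO}^*(2n)$; $\mathbb H^{2n}$; hermitian; $(-1,1)$. 29. $\mathrm O(2n,\mathbb C)/\mathrm{SO}^*(2n)$; $\mathbb H^{2n}$; antihermitian; $(-1,-1)$. 30$\star$. $\mathrm{Sp}(2n,\mathbb C)/\mathrm{Sp}(p,n-p)$; $\mathbb H^{2n}$; hermitian; $(-1,-1)$.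 **List 2.** $B$ is a split form on $V=\mathbb K^{2n}$, $G=\mathcal U(B)$, $H=\mathrm{GL}(n,\mathbb K)$. $\mathcal S=\mathcal S(B)$ is the set of ordered pairs $(Q_1,Q_2)$ of maximal $B$-isotropic subspaces with $V=Q_1\oplus Q_2$. $\mathrm{Gr}^*=\mathrm{Gr}(V,B)\times\mathrm{Gr}(V,B)$. Families: 31. $\mathrm O(n,n)/\mathrm{GL}(n,\mathbb R)$; 32. $\mathrm{Sp}(2n,\mathbb R)/\mathrm{GL}(n,\mathbb R)$; 33. $\mathrm O(2n,\mathbb C)/\mathrm{GL}(n,\mathbb C)$; 34. $\mathrm{Sp}(2n,\mathbb C)/\mathrm{GL}(n,\mathbb C)$; 35. $\mathrm U(n,n)/\mathrm{GL}(n,\mathbb C)$; 36. $\mathrm{Sp}(n,n)/\mathrm{GL}(n,\mathbb H)$; 37. $\mathrm{SO}^*(4n)/\mathrm{GL}(n,\mathbb H)$. **List 3.** $J$ is a split semiinvolution on $V$, $G$ is the centralizer of $J$ in $\mathrm{GL}(V)$. $\mathcal S=\mathcal S(J)$ is the set of ordered pairs $(Q_1,Q_2)$ of subspaces with $V=Q_1\oplus Q_2$, $JQ_1=Q_2$. $\mathrm{Gr}^*=\mathrm{Gr}_n(V)$, $\dim V=2n$. Families: 38. $\mathrm{GL}(n,\mathbb R)\times\mathrm{GL}(n,\mathbb R)/\mathrm{GL}(n,\mathbb R)$ ($V=\mathbb R^{2n}$, $J^2=1$); 39. $\mathrm{GL}(n,\mathbb C)/\mathrm{GL}(n,\mathbb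 R)$ ($\mathbb R^{2n}$, $J^2=-1$); 40. $\mathrm{GL}(n,\mathbb C)\times\mathrm{GL}(n,\mathbb C)/\mathrm{GL}(n,\mathbb C)$ ($\mathbb C^{2n}$, $J$ linear, $J^2=1$); 41. $\mathrm{GL}(2n,\mathbb R)/\mathrm{GL}(n,\mathbb C)$ ($\mathbb C^{2n}$, $J$ antilinear, $J^2=1$); 42. $\mathrm{GL}(n,\mathbb H)/\mathrm{GL}(n,\mathbb C)$ ($\mathbb C^{2n}$, $J$ antilinear, $J^2=-1$); 43. $\mathrm{GL}(n,\mathbb H)\times\mathrm{GL}(n,\mathbb H)/\mathrm{GL}(n,\mathbb H)$ ($\mathbb H^{2n}$, $J^2=1$); 44. $\mathrm{GL}(2n,\mathbb C)/\mathrm{GL}(n,\mathbb H)$ ($\mathbb H^{2n}$, $J^2=-1$). **List 4.** $D$ is a form on $V$, $G=\mathcal U(D)$. $\mathcal S=\mathcal S_m(D)$ is the set of pairs $(Q_1,Q_2)$ with $\dim Q_1=m$, $V=Q_1\oplus Q_2$, $Q_2$ the $D$-orthogonal complement of $Q_1$. $\mathrm{Gr}^*=\mathrm{Gr}_m(V)$. Families: 45$\star$. $\mathrm O(p,q)/\mathrm O(r,s)\times\mathrm O(p-r,q-s)$; 46. $\mathrm{Sp}(2(k+l),\mathbb R)/\mathrm{Sp}(2k,\mathbb R)\times\mathrm{Sp}(2l,\mathbb R)$ (with $m=2k$); 47. $\mathrm O(n+m,\mathbb C)/\mathrm O(n,\mathbb C)\times\mathrm O(m,\mathbb C)$; 48.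 $\mathrm{Sp}(2(k+l),\mathbb C)/\mathrm{Sp}(2k,\mathbb C)\times\mathrm{Sp}(2l,\mathbb C)$ (with $m=2k$); 49$\star$. $\mathrm U(p,q)/\mathrm U(r,s)\times\mathrm U(p-r,q-s)$; 50$\star$. $\mathrm{Sp}(p,q)/\mathrm{Sp}(r,s)\times\mathrm{Sp}(p-r,q-s)$; 51. $\mathrm{SO}^*(2(m+n))/\mathrm{SO}^*(2m)\times\mathrm{SO}^*(2n)$. In rows 45, 49, 50, $\mathcal S$ is the disjoint union of the orbits $G/H$ over all $(r,s)$ with $r+s=m$, $0\le r\le p$, $0\le s\le q$. **List 5.** $V=\mathbb K^{p+q}$, $G=\mathrm{GL}(p+q,\mathbb K)$. $\mathcal S=\mathcal S_p$ is the set of pairs $(Q_1,Q_2)$ of subspaces with $\dim Q_1=p$, $\dim Q_2=q$, $V=Q_1\oplus Q_2$. $\mathrm{Gr}^*=\mathrm{Gr}_p(V)\times\mathrm{Gr}_q(V)$. Families: 52, 53, 54. $\mathrm{GL}(p+q,\mathbb K)/\mathrm{GL}(p,\mathbb K)\times\mathrm{GL}(q,\mathbb K)$ for $\mathbb K=\mathbb R,\mathbb C,\mathbb H$.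
   Formalization: In families 4, 7, 12, 31, 33 G/H is not dense in Gr* for n ≥ 1 (S misses a component), so density is claimed only in the components of Gr* meeting S; in starred series non-density is claimed for n > 0, or for p, q > 0 and 0 < m < p+q. *)

(* Defs.v *)
From HB Require Import structures.
From mathcomp Require Import all_boot all_order all_algebra.
From mathcomp Require Import complex.
From mathcomp Require Import all_classical all_reals all_analysis.
From mathcomp Require Import ring.

Set Implicit Arguments.
Unset Strict Implicit.
Unset Printing Implicit Defensive.

Import Order.TTheory GRing.Theory Num.Theory.
Import numFieldNormedType.Exports.

Local Open Scope classical_set_scope.
Local Open Scope ring_scope.

HB.mixin Record isStarRing K & GRing.NzRing K := {
  sconj : K -> K;
  sconjD : {morph sconj : x y / x + y};
  sconjM : forall x y, sconj (x * y) = sconj y * sconj x;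
  sconjK : involutive sconj
}.

#[short(type="starTopRingType")]
HB.structure Definition StarTopRing :=
  { K of GRing.NzRing K & Topological K & isStarRing K }.

Lemma id_antiM (R : realType) (x y : R^o) : id (x * y) = id y * id x.
Proof. exact: mulrC. Qed.

HB.instance Definition _ (R : realType) :=
  isStarRing.Build R^o (fun _ _ => erefl) (@id_antiM R) (fun _ => erefl).

HB.instance Definition _ (R : realType) :=
  PseudoPointedMetric.copy R[i] (R[i]^o).

Lemma conjc_antiM (R : realType) (x y : R[i]) :
  conjc (x * y) = conjc y * conjc x.
Proof. by rewrite mulrC rmorphM. Qed.

HB.instance Definition _ (R : realType) :=
  isStarRing.Build R[i] (rmorphD conjc) (@conjc_antiM R) (@conjcK R).

(* (a, b, c, d) stands for a + b i + c j + d k. *)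
Definition quat (R : realType) : Type := (R * R * R * R)%type.

Section QuaternionRing.
Variable R : realType.

HB.instance Definition _ := GRing.Zmodule.copy (quat R) (R * R * R * R)%type.
HB.instance Definition _ := Topological.copy (quat R) (R * R * R * R)%type.

Definition quat_one : quat R := (1, 0, 0, 0).

Definition quat_mul (x y : quat R) : quat R :=
  let: (a, b, c, d) := x in let: (a', b', c', d') := y in
  (a * a' - b * b' - c * c' - d * d',
   a * b' + b * a' + c * d' - d * c',
   a * c' - b * d' + c * a' + d * b',
   a * d' + b * c' - c * b' + d * a').

Definition quat_conj (x : quat R) : quat R :=
  let: (a, b, c, d) := x in (a, - b, - c, - d).

Lemma quat_mulA : associative quat_mul.
Proof.
by move=> [[[a b] c] d] [[[a' b'] c'] d'] [[[e f] g] h] /=;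
  congr (_, _, _, _); ring.
Qed.

Lemma quat_mul1 : left_id quat_one quat_mul.
Proof. by move=> [[[a b] c] d] /=; congr (_, _, _, _); ring. Qed.

Lemma quat_mulr1 : right_id quat_one quat_mul.
Proof. by move=> [[[a b] c] d] /=; congr (_, _, _, _); ring. Qed.

Lemma quat_mulDl : left_distributive quat_mul +%R.
Proof.
by move=> [[[a b] c] d] [[[a' b'] c'] d'] [[[e f] g] h] /=;
  congr (_, _, _, _) => /=; ring.
Qed.

Lemma quat_mulDr : right_distributive quat_mul +%R.
Proof.
by move=> [[[a b] c] d] [[[a' b'] c'] d'] [[[e f] g] h] /=;
  congr (_, _, _, _) => /=; ring.
Qed.

Lemma quat_one_neq0 : quat_one != 0.
Proof. by apply/eqP => -[] /eqP; rewrite oner_eq0. Qed.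

HB.instance Definition _ := GRing.Zmodule_isNzRing.Build (quat R)
  quat_mulA quat_mul1 quat_mulr1 quat_mulDl quat_mulDr quat_one_neq0.

Lemma quat_conjD : {morph quat_conj : x y / x + y}.
Proof.
by move=> [[[a b] c] d] [[[a' b'] c'] d'] /=; congr (_, _, _, _) => /=; ring.
Qed.

Lemma quat_conjM (x y : quat R) :
  quat_conj (x * y) = quat_conj y * quat_conj x.
Proof.
by case: x y => [[[a b] c] d] [[[a' b'] c'] d'] /=; congr (_, _, _, _); ring.
Qed.

Lemma quat_conjK : involutive quat_conj.
Proof. by move=> [[[a b] c] d] /=; rewrite !opprK. Qed.

HB.instance Definition _ :=
  isStarRing.Build (quat R) quat_conjD quat_conjM quat_conjK.

End QuaternionRing.

Variant scalars := Reals | Complexes | Quaternions.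

Definition scal (R : realType) (k : scalars) : starTopRingType :=
  match k with
  | Reals => R^o
  | Complexes => R[i]
  | Quaternions => quat R
  end.

(* K^N is the right K-module of columns: the product of v : 'cV[K]_N by a
   scalar c on the right is v *m c%:M. *)
Record subsp (K : starTopRingType) (N : nat) := Subsp {
  subsp_set :> set 'cV[K]_N;
  subsp0 : subsp_set 0;
  subspD : forall v w, subsp_set v -> subsp_set w -> subsp_set (v + w);
  subspZ : forall v (c : K), subsp_set v -> subsp_set (v *m c%:M)
}.

HB.instance Definition _ K N := gen_eqMixin (subsp K N).
HB.instance Definition _ K N := gen_choiceMixin (subsp K N).

Section Subspaces.
Variables (K : starTopRingType) (N : nat).
Implicit Types (P Q : subsp K N) (s : subsp K N * subsp K N).

Section Image.
Variables (m : nat) (g : 'M[K]_(N, m)) (P : subsp K m).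
Let im : set 'cV[K]_N := [set g *m x | x in (P : set _)].

Let im0 : im 0.
Proof. by exists 0; [exact: subsp0 | rewrite mulmx0]. Qed.

Let imD v w : im v -> im w -> im (v + w).
Proof.
by move=> [x Px <-] [y Py <-]; exists (x + y);
  [exact: subspD | rewrite mulmxDr].
Qed.

Let imZ v (c : K) : im v -> im (v *m c%:M).
Proof.
by move=> [x Px <-]; exists (x *m c%:M); [exact: subspZ | rewrite mulmxA].
Qed.

Definition mximage : subsp K N := Subsp im0 imD imZ.
End Image.

Definition fullsp (m : nat) : subsp K m :=
  @Subsp K m setT I (fun _ _ _ _ => I) (fun _ _ _ => I).

Definition colspan (k : nat) (F : 'M[K]_(N, k)) : subsp K N :=
  mximage F (fullsp k).

Definition frames (k : nat) : set 'M[K]_(N, k) :=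
  [set F | injective (fun x : 'cV[K]_k => F *m x)].

(* Gr_k(K^N); the proposition [Gr k Q] also says that Q has dimension k. *)
Definition Gr (k : nat) : set (subsp K N) := [set colspan F | F in @frames k].

(* The set of all subspaces of K^N is topologised as the disjoint union of the
   Grassmannians Gr_k(K^N) = frames k / GL(k, K), each with the quotient
   topology. *)
Definition subsp_open : set_system (subsp K N) :=
  [set U | forall k, open (@colspan k @^-1` U : set (subspace (@frames k)))].

Lemma subsp_openT : subsp_open setT.
Proof. by move=> k; rewrite preimage_setT; exact: openT. Qed.

Lemma subsp_openI : setI_closed subsp_open.
Proof. by move=> U W oU oW k; rewrite preimage_setI; exact: openI. Qed.

Lemma subsp_open_bigU (I : Type) (f : I -> set (subsp K N)) :
  (forall i, subsp_open (f i)) -> subsp_open (\bigcup_i f i).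
Proof.
by move=> of_ k; rewrite preimage_bigcup; apply: bigcup_open => i _; exact: of_.
Qed.

HB.instance Definition _ := isOpenTopological.Build (subsp K N)
  subsp_openT subsp_openI subsp_open_bigU.

Definition direct_sum (P Q : set 'cV[K]_N) :=
  (forall v, P v -> Q v -> v = 0) /\
  (forall v, exists x y, [/\ P x, Q y & v = x + y]).

Definition GL : set 'M[K]_N :=
  [set g | exists h, g *m h = 1%:M /\ h *m g = 1%:M].

Definition act (g : 'M[K]_N) s := (mximage g s.1, mximage g s.2).

Definition orbit (G : set 'M[K]_N) s := [set act g s | g in G].

(* Pairs of subspaces, topologised as the disjoint union of the homogeneous
   spaces G/Stab(s): a set is open iff its inverse images under all orbit maps
   g |-> g s are open in G. *)
Definition hspace (G : set 'M[K]_N) : Type := (subsp K N * subsp K N)%type.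

HB.instance Definition _ G :=
  Choice.copy (hspace G) (subsp K N * subsp K N)%type.

Section HspaceTopology.
Variable G : set 'M[K]_N.

Definition hspace_open : set_system (hspace G) :=
  [set U | forall s, open (act^~ s @^-1` U : set (subspace G))].

Lemma hspace_openT : hspace_open setT.
Proof. by move=> s; rewrite preimage_setT; exact: openT. Qed.

Lemma hspace_openI : setI_closed hspace_open.
Proof. by move=> U W oU oW s; rewrite preimage_setI; exact: openI. Qed.

Lemma hspace_open_bigU (I : Type) (f : I -> set (hspace G)) :
  (forall i, hspace_open (f i)) -> hspace_open (\bigcup_i f i).
Proof.
by move=> of_ s; rewrite preimage_bigcup; apply: bigcup_open => i _; exact: of_.
Qed.

HB.instance Definition _ := isOpenTopological.Build (hspace G)
  hspace_openT hspace_openI hspace_open_bigU.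

End HspaceTopology.

End Subspaces.

Arguments GL {K} N.

Variant form_type := Symmetric | SkewSymmetric | Hermitian | Antihermitian.
Variant operator_type := Linear | Antilinear.

Section Forms.
Variables (K : starTopRingType) (N : nat).
Local Notation V := 'cV[K]_N.
Implicit Types (B D : V -> V -> K) (J : V -> V).

Definition biadditive B :=
  (forall v v' w, B (v + v') w = B v w + B v' w) /\
  (forall v w w', B v (w + w') = B v w + B v w').

Definition bilinear B := biadditive B /\
  forall v w (c : K), B (v *m c%:M) w = B v w * c /\
                      B v (w *m c%:M) = B v w * c.

Definition sesquilinear B := biadditive B /\
  forall v w (c : K), B (v *m c%:M) w = B v w * c /\
                      B v (w *m c%:M) = sconj c * B v w.

Definition nondegenerate B := forall v, (forall w, B v w = 0) -> v = 0.

Definition is_form (t : form_type) B := nondegenerate B /\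
  match t with
  | Symmetric => bilinear B /\ forall v w, B v w = B w v
  | SkewSymmetric => bilinear B /\ forall v w, B v w = - B w v
  | Hermitian => sesquilinear B /\ forall v w, B v w = sconj (B w v)
  | Antihermitian => sesquilinear B /\ forall v w, B v w = - sconj (B w v)
  end.

(* [e] is a basis (written as columns) in which D(v, v) is
   |v_0|^2 + ... + |v_{a-1}|^2 - |v_a|^2 - ... - |v_{a+b-1}|^2. *)
Definition has_inertia D (ab : nat * nat) :=
  (ab.1 + ab.2)%N = N /\
  exists2 e, GL N e & forall i j : 'I_N,
    D (col i e) (col j e) = if i == j then if (i < ab.1)%N then 1 else -1 else 0.

Definition isometries B : set 'M[K]_N :=
  [set g | GL N g /\ forall v w, B (g *m v) (g *m w) = B v w].

Definition centralizer J : set 'M[K]_N :=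
  [set g | GL N g /\ forall v, g *m J v = J (g *m v)].

Definition isotropic B (Q : set V) := forall v w, Q v -> Q w -> B v w = 0.

Definition max_isotropic B : set (subsp K N) :=
  [set Q | isotropic B Q /\
    forall P : subsp K N, isotropic B P -> Q `<=` P -> P `<=` Q].

Definition split_form B := exists n,
  N = (2 * n)%N /\ exists2 Q : subsp K N, Gr n Q & isotropic B Q.

Definition is_operator (l : operator_type) J :=
  (forall v w, J (v + w) = J v + J w) /\
  (forall v c, J (v *m c%:M) =
     J v *m (if l is Linear then c else sconj c)%:M).

Definition semiinvolution (l : operator_type) (eps : int) J :=
  is_operator l J /\ forall v, J (J v) = v *~ eps.

Definition consistent (l : operator_type) (mu : int) B J :=
  forall v w,
    B (J v) (J w) = (if l is Linear then B v w else sconj (B v w)) *~ mu.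

Definition managing B J v w := B v (J w).

Definition split_semiinvolution J :=
  exists Q : subsp K N, direct_sum Q (J @` Q).

Definition split_pair B J :=
  exists2 Q : subsp K N, isotropic B Q & direct_sum Q (J @` Q).

Definition orthogonal_complement D (Q : set V) : set V :=
  [set w | forall v, Q v -> D v w = 0].

Definition pairs_BJ B J :=
  [set s : subsp K N * subsp K N |
    [/\ max_isotropic B s.1, max_isotropic B s.2,
        direct_sum s.1 s.2 & J @` s.1 = s.2]].

Definition pairs_B B :=
  [set s : subsp K N * subsp K N |
    [/\ max_isotropic B s.1, max_isotropic B s.2 & direct_sum s.1 s.2]].

Definition pairs_J J :=
  [set s : subsp K N * subsp K N | direct_sum s.1 s.2 /\ J @` s.1 = s.2].

Definition pairs_D m D :=
  [set s : subsp K N * subsp K N |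
    [/\ Gr m s.1, direct_sum s.1 s.2 & orthogonal_complement D s.1 = s.2]].

Definition pairs_dim p q :=
  [set s : subsp K N * subsp K N |
    [/\ Gr p s.1, Gr q s.2 & direct_sum s.1 s.2]].

End Forms.

(* What is asserted on the closure of the image of G/H in Gr^*.
   [Dense]: G/H is dense in Gr^*.
   [DenseInComponents]: G/H is dense in the union of the connected components
     of Gr^* which meet the image of S.  In the families concerned B is a
     symmetric bilinear form, Gr(V, B) has two components, distinguished by
     the parity of dim(Q n Q0) for a fixed Q0, and the image of S misses at
     least one component of Gr^*, so that it is not dense in Gr^*: for
     O(1,1)/GL(1,R), Gr(V, B) is a pair of points {l1, l2} and S consists of
     (l1, l2) and (l2, l1).
   [NotDense c]: G/H is not dense, provided the condition c on the parameters
     holds; c excludes the degenerate values for which S is a single orbit. *)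
Variant density := Dense | DenseInComponents | NotDense of bool.

(* Arguments: scalars, type of B, type of J, J^2, mu, dim V, inertia indices
   of the managing form (when prescribed), density. *)
Variant list1 : scalars -> form_type -> operator_type -> int -> int -> nat ->
    option (nat * nat) -> density -> Prop :=
(* O(p,q) x O(p,q) / O(p,q) *)
| list1_1 p q : list1 Reals Symmetric Linear 1 1
    (2 * (p + q)) (Some (2 * p, 2 * q)%N) Dense
(* Sp(2n,R) x Sp(2n,R) / Sp(2n,R) *)
| list1_2 n : list1 Reals SkewSymmetric Linear 1 1 (4 * n) None Dense
(* GL(n,R) / O(p,n-p) *)
| list1_3 n : list1 Reals SkewSymmetric Linear 1 (-1)
    (2 * n) None (NotDense (0 < n)%N)
(* GL(2n,R) / Sp(2n,R) *)
| list1_4 n : list1 Reals Symmetric Linear 1 (-1)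
    (4 * n) None DenseInComponents
(* O(n,C) / O(p,n-p) *)
| list1_5 n : list1 Reals Symmetric Linear (-1) (-1)
    (2 * n) None (NotDense (0 < n)%N)
(* Sp(2n,C) / Sp(2n,R) *)
| list1_6 n : list1 Reals SkewSymmetric Linear (-1) (-1) (4 * n) None Dense
(* U(n,n) / Sp(2n,R) *)
| list1_7 n : list1 Reals Symmetric Linear (-1) 1
    (4 * n) None DenseInComponents
(* U(p,q) / O(p,q) *)
| list1_8 p q : list1 Reals SkewSymmetric Linear (-1) 1
    (2 * (p + q)) (Some (2 * p, 2 * q)%N) Dense
(* O(n,C) x O(n,C) / O(n,C) *)
| list1_9 n : list1 Complexes Symmetric Linear 1 1 (2 * n) None Dense
(* Sp(2n,C) x Sp(2n,C) / Sp(2n,C) *)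
| list1_10 n : list1 Complexes SkewSymmetric Linear 1 1 (4 * n) None Dense
(* U(p,q) x U(p,q) / U(p,q) *)
| list1_11 p q : list1 Complexes Hermitian Linear 1 1
    (2 * (p + q)) (Some (2 * p, 2 * q)%N) Dense
(* GL(2n,C) / Sp(2n,C) *)
| list1_12 n : list1 Complexes Symmetric Linear 1 (-1)
    (4 * n) None DenseInComponents
(* GL(n,C) / O(n,C) *)
| list1_13 n : list1 Complexes SkewSymmetric Linear 1 (-1) (2 * n) None Dense
(* GL(n,C) / U(p,n-p) *)
| list1_14 n : list1 Complexes Hermitian Linear 1 (-1)
    (2 * n) None (NotDense (0 < n)%N)
(* Sp(2n,R) / U(p,n-p) *)
| list1_15 n : list1 Complexes SkewSymmetric Antilinear 1 1
    (2 * n) None (NotDense (0 < n)%N)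
(* O(2p,2q) / U(p,q) *)
| list1_16 p q : list1 Complexes Symmetric Antilinear 1 1
    (2 * (p + q)) (Some (2 * p, 2 * q)%N) Dense
(* O(n,n) / O(n,C) *)
| list1_17 n : list1 Complexes Hermitian Antilinear 1 1 (2 * n) None Dense
(* Sp(4n,R) / Sp(2n,C) *)
| list1_18 n : list1 Complexes Hermitian Antilinear 1 (-1) (4 * n) None Dense
(* Sp(p,q) / U(p,q) *)
| list1_19 p q : list1 Complexes SkewSymmetric Antilinear (-1) 1
    (2 * (p + q)) (Some (2 * p, 2 * q)%N) Dense
(* SO*(2n) / U(p,n-p) *)
| list1_20 n : list1 Complexes Symmetric Antilinear (-1) 1
    (2 * n) None (NotDense (0 < n)%N)
(* Sp(n,n) / Sp(2n,C) *)
| list1_21 n : list1 Complexes Hermitian Antilinear (-1) 1 (4 * n) None Dense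
(* SO*(2n) / O(n,C) *)
| list1_22 n : list1 Complexes Hermitian Antilinear (-1) (-1)
    (2 * n) None Dense
(* Sp(p,q) x Sp(p,q) / Sp(p,q) *)
| list1_23 p q : list1 Quaternions Hermitian Linear 1 1
    (2 * (p + q)) (Some (2 * p, 2 * q)%N) Dense
(* SO*(2n) x SO*(2n) / SO*(2n) *)
| list1_24 n : list1 Quaternions Antihermitian Linear 1 1 (2 * n) None Dense
(* GL(n,H) / SO*(2n) *)
| list1_25 n : list1 Quaternions Hermitian Linear 1 (-1) (2 * n) None Dense
(* GL(n,H) / Sp(p,n-p) *)
| list1_26 n : list1 Quaternions Antihermitian Linear 1 (-1)
    (2 * n) None (NotDense (0 < n)%N)
(* U(2p,2q) / Sp(p,q) *)
| list1_27 p q : list1 Quaternions Antihermitian Linear (-1) 1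
    (2 * (p + q)) (Some (2 * p, 2 * q)%N) Dense
(* U(n,n) / SO*(2n) *)
| list1_28 n : list1 Quaternions Hermitian Linear (-1) 1 (2 * n) None Dense
(* O(2n,C) / SO*(2n) *)
| list1_29 n : list1 Quaternions Antihermitian Linear (-1) (-1)
    (2 * n) None Dense
(* Sp(2n,C) / Sp(p,n-p) *)
| list1_30 n : list1 Quaternions Hermitian Linear (-1) (-1)
    (2 * n) None (NotDense (0 < n)%N).

(* Arguments: scalars, type of B, density. *)
Variant list2 : scalars -> form_type -> density -> Prop :=
(* O(n,n) / GL(n,R) *)
| list2_31 : list2 Reals Symmetric DenseInComponents
(* Sp(2n,R) / GL(n,R) *)
| list2_32 : list2 Reals SkewSymmetric Dense
(* O(2n,C) / GL(n,C) *)
| list2_33 : list2 Complexes Symmetric DenseInComponents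
(* Sp(2n,C) / GL(n,C) *)
| list2_34 : list2 Complexes SkewSymmetric Dense
(* U(n,n) / GL(n,C) *)
| list2_35 : list2 Complexes Hermitian Dense
(* Sp(n,n) / GL(n,H) *)
| list2_36 : list2 Quaternions Hermitian Dense
(* SO*(4n) / GL(n,H) *)
| list2_37 : list2 Quaternions Antihermitian Dense.

(* Arguments: scalars, type of J, J^2. *)
Variant list3 : scalars -> operator_type -> int -> Prop :=
(* GL(n,R) x GL(n,R) / GL(n,R) *)
| list3_38 : list3 Reals Linear 1
(* GL(n,C) / GL(n,R) *)
| list3_39 : list3 Reals Linear (-1)
(* GL(n,C) x GL(n,C) / GL(n,C) *)
| list3_40 : list3 Complexes Linear 1
(* GL(2n,R) / GL(n,C) *)
| list3_41 : list3 Complexes Antilinear 1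
(* GL(n,H) / GL(n,C) *)
| list3_42 : list3 Complexes Antilinear (-1)
(* GL(n,H) x GL(n,H) / GL(n,H) *)
| list3_43 : list3 Quaternions Linear 1
(* GL(2n,C) / GL(n,H) *)
| list3_44 : list3 Quaternions Linear (-1).

(* Arguments: scalars, type of D, dim V, inertia indices of D (when
   prescribed), dim Q1, density. *)
Variant list4 : scalars -> form_type -> nat -> option (nat * nat) -> nat ->
    density -> Prop :=
(* O(p,q) / O(r,s) x O(p-r,q-s) *)
| list4_45 p q m : (m <= p + q)%N ->
    list4 Reals Symmetric (p + q) (Some (p, q)) m
      (NotDense [&& 0 < p, 0 < q, 0 < m & m < p + q]%N)
(* Sp(2(k+l),R) / Sp(2k,R) x Sp(2l,R) *)
| list4_46 k l : list4 Reals SkewSymmetric (2 * (k + l)) None (2 * k) Dense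
(* O(n+m,C) / O(n,C) x O(m,C) *)
| list4_47 n m : list4 Complexes Symmetric (n + m) None m Dense
(* Sp(2(k+l),C) / Sp(2k,C) x Sp(2l,C) *)
| list4_48 k l :
    list4 Complexes SkewSymmetric (2 * (k + l)) None (2 * k) Dense
(* U(p,q) / U(r,s) x U(p-r,q-s) *)
| list4_49 p q m : (m <= p + q)%N ->
    list4 Complexes Hermitian (p + q) (Some (p, q)) m
      (NotDense [&& 0 < p, 0 < q, 0 < m & m < p + q]%N)
(* Sp(p,q) / Sp(r,s) x Sp(p-r,q-s) *)
| list4_50 p q m : (m <= p + q)%N ->
    list4 Quaternions Hermitian (p + q) (Some (p, q)) m
      (NotDense [&& 0 < p, 0 < q, 0 < m & m < p + q]%N)
(* SO*(2(m+n)) / SO*(2m) x SO*(2n) *)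
| list4_51 m n : list4 Quaternions Antihermitian (m + n) None m Dense.

Definition open_embedding (X Y : topologicalType) (A : set X) (Z : set Y)
    (f : X -> Y) :=
  [/\ f @` A `<=` Z, set_inj A f, {within A, continuous f}
    & forall U : set X, U `<=` A -> open (U : set (subspace A)) ->
        open (f @` U : set (subspace Z))].

Definition density_claim (d : density) (T : topologicalType)
    (Grs imS imO : set T) : Prop :=
  match d with
  | Dense => Grs `<=` closure imO
  | DenseInComponents => forall x, Grs x ->
      connected_component Grs x `&` imS !=set0 -> closure imO x
  | NotDense c => c -> ~ (Grs `<=` closure imO)
  end.

(* The homogeneous spaces G/H contained in S are the orbits of G in S. *)
Definition open_realization (K : starTopRingType) (N : nat)
    (T : topologicalType) (G : set 'M[K]_N)
    (S : set (subsp K N * subsp K N)) (Grs : set T)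
    (iota : subsp K N * subsp K N -> T) (d : density) : Prop :=
  @open_embedding (hspace G) T S Grs iota /\
  forall s, S s ->
    [/\ orbit G s `<=` S,
        open (iota @` orbit G s : set (subspace Grs))
      & density_claim d Grs (iota @` S) (iota @` orbit G s)].

(* Main.v *)
(* Every symmetric space of the lists is a space of decompositions [V = Q1 + Q2],
   that is, of idempotents [P].  If [P'] is close to [P], the involutions
   [s = 2 P - 1] and [s' = 2 P' - 1] are intertwined by
   [(1 + s' s) / 2 * (1 - (s - s')^2 / 4)^(-1/2)], which lies in every group whose
   defining conditions both involutions satisfy and tends to [1] as [P'] tends to
   [P].  When only [Q1] moves, the second summand [Q2] is recovered from [J] or
   from [D], so that [G] acts locally transitively on the open subset [iota S] of
   [Gr^*]; this gives the open embedding.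

   Density of [S]: a line through a given point of [Gr^*] and a point of [iota S]
   leaves [iota S] only at finitely many parameters, because the conditions
   defining [S] are invertibility of matrices.  In the isotropic case the line
   consists of isotropic subspaces, being taken in a chart given by a common
   isotropic complement.  Such a complement exists unless [B] is symmetric; then
   either the components of [Gr^*] are treated separately, or a [J]-invariant
   reflection exchanges the two components.

   Density of a single orbit follows when [G] is transitive on [S].  The pair
   [(Q1, Q2)] is determined up to [G] by the restriction of [D] to [Q1] (to [Q1]
   and [Q2] in List 4), and that form is unique up to congruence, either by its
   type or because its signature is forced by the inertia indices of [D].  In the
   starred rows [S] contains two points with different signatures; both orbits
   are open, so that neither is dense. *)

Require Import Defs.
From HB Require Import structures.
From mathcomp Require Import all_boot all_order all_algebra.
From mathcomp Require Import complex.
From mathcomp Require Import all_classical all_reals all_analysis.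
From mathcomp Require Import ring lra zify.

Set Implicit Arguments.
Unset Strict Implicit.
Unset Printing Implicit Defensive.

Import Order.TTheory GRing.Theory Num.Theory.
Import numFieldNormedType.Exports.

Local Open Scope classical_set_scope.
Local Open Scope ring_scope.

(** One argument serves R, C and H. Booleans record conjugations and signs: a form has type (b, sg),
    a semiinvolution (c, se), their consistency a sign sm. The managing form then has type (b xor c,
    sg xor se xor sm), and transitivity in List 1 is read off from it. The inverse square root is
    the limit of an iteration instead of a power series: a condition that is closed under limits and
    preserved by one step passes to the limit. This puts the rotation into the group even when the
    condition involves a conjugation, or an adjoint that reverses products. The obstacle for
    symmetric forms is that a shear of an isotropic complement is given by a skew matrix, which is
    singular in odd size; this is the parity that separates the two components. *)

(* [ring] does not apply to rectangular matrices; [abel] decides the identities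
   of abelian groups by comparing the integer coefficients of the atoms. *)
Inductive abexp := AbVar of nat | AbAdd of abexp & abexp | AbOpp of abexp | AbZero.

Section AbelianGroup.
Variable V : zmodType.

Fixpoint abeval (env : seq V) e : V :=
  match e with
  | AbVar i => nth 0 env i
  | AbAdd a b => abeval env a + abeval env b
  | AbOpp a => - abeval env a
  | AbZero => 0
  end.

Fixpoint abcoef (e : abexp) (i : nat) : int :=
  match e with
  | AbVar j => (i == j)%:Z
  | AbAdd a b => abcoef a i + abcoef b i
  | AbOpp a => - abcoef a i
  | AbZero => 0
  end.

Lemma abevalE env e : abeval env e = \sum_(i < size env) env`_i *~ abcoef e i.
Proof.
elim: e => [j|a IHa b IHb|a IHa|] /=.
- have [jl|jl] := ltnP j (size env); last first.
    (* A variable outside the environment evaluates to the default 0, and its coefficient vanishes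
       at every index below [size env]. *)
    rewrite nth_default// big1// => i _; rewrite (_ : (i == j :> nat) = false) ?mulr0z//.
    by apply/negbTE; rewrite neq_ltn (leq_trans (ltn_ord i) jl).
  rewrite (bigD1 (Ordinal jl))//= eqxx big1 ?addr0// => i ij.
  rewrite (_ : (i == j :> nat) = false) ?mulr0z//; exact: negbTE.
- by rewrite IHa IHb -big_split; apply: eq_bigr => i _; rewrite mulrzDr.
- by rewrite IHa -sumrN; apply: eq_bigr => i _; rewrite mulrNz.
- by rewrite big1// => i _; rewrite mulr0z.
Qed.

Lemma abeval_eq env a b :
  all (fun i => abcoef a i == abcoef b i) (iota 0 (size env)) -> abeval env a = abeval env b.
Proof.
move=> /allP h; rewrite !abevalE; apply: eq_bigr => i _.
by rewrite (eqP (h i _)) ?mem_iota ?ltn_ord.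
Qed.
End AbelianGroup.

Ltac ab_atoms t l :=
  match t with
  | (?a + ?b)%R => let l := ab_atoms a l in ab_atoms b l
  | (- ?a)%R => ab_atoms a l
  | 0%R => l
  | _ => match l with
         | context [cons t _] => l
         | _ => constr:(cons t l)
         end
  end.
Ltac ab_index t l :=
  match l with
  | cons t _ => constr:(O)
  | cons _ ?l => let n := ab_index t l in constr:(S n)
  end.
Ltac ab_reify t l :=
  match t with
  | (?a + ?b)%R => let a := ab_reify a l in let b := ab_reify b l in constr:(AbAdd a b)
  | (- ?a)%R => let a := ab_reify a l in constr:(AbOpp a)
  | 0%R => constr:(AbZero)
  | _ => let n := ab_index t l in constr:(AbVar n)
  end.
(* Abstracting the atoms with [set] identifies those that differ only in their
   canonical structures. *)
Ltac ab_abstract t :=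
  match t with
  | (?a + ?b)%R => first [ab_abstract a | ab_abstract b | fail 2]
  | (- ?a)%R => first [ab_abstract a | fail 2]
  | 0%R => fail 1
  | _ => tryif is_var t then fail else
           (let z := fresh "z" in set z := t; clearbody z)
  end.
Ltac abel :=
  repeat match goal with |- @eq _ ?a ?b => first [ab_abstract a | ab_abstract b] end;
  match goal with
  | |- @eq ?T ?a ?b =>
    let l := ab_atoms a (@nil T) in let l := ab_atoms b l in
    let a := ab_reify a l in let b := ab_reify b l in
    exact: (@abeval_eq _ l a b erefl)
  end.

(** * Scalars *)

Section Scalars.
Variable R : realType.

(** With the sum norm, submultiplicativity and the comparison with the product topology need only
    the triangle inequality for the coordinates. *)
Definition qnorm (x : quat R) : R :=
  let: (a, b, c, d) := x in `|a| + `|b| + `|c| + `|d|.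

(** Embedding all three algebras in the quaternions reduces an identity or estimate to one
    calculation with four real coordinates. *)
Definition squat (k : scalars) : scal R k -> quat R :=
  match k return scal R k -> quat R with
  | Reals => fun x => (x, 0, 0, 0)
  | Complexes => fun x => (complex.Re x, complex.Im x, 0, 0)
  | Quaternions => fun x => x
  end.

Definition sreal (k : scalars) : R -> scal R k :=
  match k return R -> scal R k with
  | Reals => fun x => x
  | Complexes => fun x => Complex x 0
  | Quaternions => fun x => (x, 0, 0, 0)
  end.

Definition snorm k (x : scal R k) : R := qnorm (squat x).
Definition sre k (x : scal R k) : R := (squat x).1.1.1.

Variable k : scalars.
Implicit Types x y z : scal R k.

Lemma squatD x y : squat (x + y) = squat x + squat y.
Proof.
case: k x y => [x y|[a b] [c d]|x y] //=; congr (_, _, _, _) => //=;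
  by rewrite addr0.
Qed.

Lemma squatM x y : squat (x * y) = squat x * squat y.
Proof.
case: k x y => [x y|[a b] [c d]|x y] //=; congr (_, _, _, _) => //=; ring.
Qed.

Lemma squatN x : squat (- x) = - squat x.
Proof.
case: k x => [x|[a b]|x] //=; congr (_, _, _, _) => //=; by rewrite oppr0.
Qed.

Lemma squat_inj : injective (@squat k).
Proof. by case: k => [x y []|[a b] [c d] [-> ->]|]. Qed.

Lemma squat_conj x : squat (sconj x) = quat_conj (squat x).
Proof.
by case: k x => [x|[a b]|[[[a b] c] d]] //=; rewrite ?oppr0.
Qed.

Lemma squat_real (r : R) : squat (sreal k r) = (r, 0, 0, 0).
Proof. by case: k. Qed.

Lemma qnormM (x y : quat R) : qnorm (x * y) <= qnorm x * qnorm y.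
Proof.
case: x y => [[[a b] c] d] [[[a' b'] c'] d'] /=.
have H (u v w t : R) : `|u + v + w + t| <= `|u| + `|v| + `|w| + `|t|.
  by rewrite !(le_trans (ler_normD _ _))// !lerD// (le_trans (ler_normD _ _))// lerD// ler_normD.
(* Bounding the four coordinates separately produces sixteen products of absolute values, which are
   exactly the expansion of the right-hand side. *)
apply: le_trans (lerD (lerD (lerD (H _ _ _ _) (H _ _ _ _)) (H _ _ _ _)) (H _ _ _ _)) _.
by rewrite !normrN !normrM le_eqVlt; apply/orP; left; apply/eqP; ring.
Qed.

Lemma snormD x y : snorm (x + y) <= snorm x + snorm y.
Proof.
rewrite /snorm squatD; case: (squat x) (squat y) => [[[a b] c] d] [[[a' b'] c'] d'] /=.
have := (lerD (lerD (lerD (ler_normD a a') (ler_normD b b')) (ler_normD c c')) (ler_normD d d')).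
by move/le_trans; apply; rewrite le_eqVlt; apply/orP; left; apply/eqP; ring.
Qed.

Lemma snormM x y : snorm (x * y) <= snorm x * snorm y.
Proof. by rewrite /snorm squatM qnormM. Qed.

Lemma snormN x : snorm (- x) = snorm x.
Proof.
by rewrite /snorm squatN; case: (squat x) => [[[a b] c] d] /=; rewrite !normrN.
Qed.

Lemma snorm_ge0 x : 0 <= snorm x.
Proof. by rewrite /snorm; case: (squat x) => [[[a b] c] d] /=; rewrite !addr_ge0. Qed.

Lemma snorm0_eq0 x : snorm x = 0 -> x = 0.
Proof.
rewrite /snorm => h; apply: squat_inj; move: h.
have -> : squat (0 : scal R k) = 0 by case: k.
case: (squat x) => [[[a b] c] d] /= /eqP.
by rewrite !paddr_eq0 ?addr_ge0// !normr_eq0 => /andP[/andP[/andP[/eqP-> /eqP->] /eqP->] /eqP->].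
Qed.

Lemma snorm_conj x : snorm (sconj x) = snorm x.
Proof.
by rewrite /snorm squat_conj; case: (squat x) => [[[a b] c] d] /=; rewrite !normrN.
Qed.

Lemma snorm_real r : snorm (sreal k r) = `|r|.
Proof. by rewrite /snorm squat_real /= normr0 !addr0. Qed.

Lemma sreD x y : sre (x + y) = sre x + sre y.
Proof. by rewrite /sre squatD. Qed.

(** Quaternions do not commute, but the real part of a product does not see the order; hence the
    real part of the trace is cyclic. *)
Lemma sreMC x y : sre (x * y) = sre (y * x).
Proof.
rewrite /sre !squatM; case: (squat x) (squat y) => [[[a b] c] d] [[[a' b'] c'] d'] /=.
ring.
Qed.

Lemma sre_real r : sre (sreal k r) = r.
Proof. by rewrite /sre squat_real. Qed.

Lemma srealD r s : sreal k (r + s) = sreal k r + sreal k s.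
Proof.
by apply: squat_inj; rewrite squatD !squat_real; congr (_, _, _, _) => /=; rewrite ?addr0.
Qed.

Lemma srealN r : sreal k (- r) = - sreal k r.
Proof. by apply: squat_inj; rewrite squatN !squat_real; congr (_, _, _, _); rewrite /= ?oppr0. Qed.

Lemma srealM r s : sreal k (r * s) = sreal k r * sreal k s.
Proof. by apply: squat_inj; rewrite squatM !squat_real; congr (_, _, _, _) => /=; ring. Qed.

Lemma sreal1 : sreal k 1 = 1.
Proof. by case: k. Qed.

Lemma sreal0 : sreal k 0 = 0.
Proof. by case: k. Qed.

Lemma srealC r x : sreal k r * x = x * sreal k r.
Proof.
apply: squat_inj; rewrite !squatM !squat_real.
case: (squat x) => [[[a b] c] d]; congr (_, _, _, _) => /=; ring.
Qed.

Lemma sreal_conj r : sconj (sreal k r) = sreal k r.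
Proof. by apply: squat_inj; rewrite squat_conj !squat_real /= oppr0. Qed.

Lemma conj_id_real x : sconj x = x -> x = sreal k (sre x).
Proof.
move/(congr1 (@squat k)); rewrite squat_conj => h; apply: squat_inj.
rewrite squat_real /sre; move: h; case: (squat x) => [[[a b] c] d] /= [h1 h2 h3].
by congr (_, _, _, _); lra.
Qed.

Lemma sreal_inv r : r != 0 -> sreal k r^-1 * sreal k r = 1.
Proof. by move=> r0; rewrite -srealM mulVf// sreal1. Qed.

Definition ssq (x : scal R k) : R := sre (sconj x * x).

Lemma ssqE x : sconj x * x = sreal k (ssq x).
Proof. by apply: conj_id_real; rewrite sconjM sconjK. Qed.

Lemma ssqE' x : x * sconj x = sreal k (ssq x).
Proof.
have -> : ssq x = ssq (sconj x) by rewrite /ssq sreMC sconjK.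
by rewrite -ssqE sconjK.
Qed.

Lemma ssqF x : ssq x = (squat x).1.1.1 ^+ 2 + (squat x).1.1.2 ^+ 2 + (squat x).1.2 ^+ 2
   + (squat x).2 ^+ 2.
Proof.
rewrite /ssq /sre squatM squat_conj; case: (squat x) => [[[a b] c] d] /=; ring.
Qed.

Lemma ssq_ge0 x : 0 <= ssq x.
Proof. by rewrite ssqF !addr_ge0// sqr_ge0. Qed.

Lemma ssq_eq0 x : ssq x = 0 -> x = 0.
Proof.
rewrite ssqF => /eqP; rewrite !paddr_eq0 ?addr_ge0 ?sqr_ge0// !sqrf_eq0.
move=> /andP[/andP[/andP[/eqP h1 /eqP h2] /eqP h3] /eqP h4].
apply: squat_inj; have -> : squat (0 : scal R k) = 0 by case: k.
by move: h1 h2 h3 h4; case: (squat x) => [[[a b] c] d] /= -> -> -> ->.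
Qed.

Lemma ssq_gt0 x : x != 0 -> 0 < ssq x.
Proof.
move=> x0; rewrite lt_neqAle ssq_ge0 andbT eq_sym; apply: contra x0.
by move/eqP/ssq_eq0 => ->.
Qed.

Lemma sinv x : x != 0 -> exists y, x * y = 1 /\ y * x = 1.
Proof.
move=> /ssq_gt0 x0; exists (sreal k (ssq x)^-1 * sconj x); split.
  by rewrite mulrA -srealC -mulrA ssqE' sreal_inv// gt_eqF.
by rewrite -mulrA ssqE sreal_inv// gt_eqF.
Qed.

Lemma scomm x y : k <> Quaternions -> x * y = y * x.
Proof. by case: k x y => // x y _; exact: mulrC. Qed.

End Scalars.

Section ScalarTopology.
Variables (R : realType) (k : scalars).
Implicit Types x y z : scal R k.

Lemma normc_le (z : R[i]) : Normc.normc z <= `|complex.Re z| + `|complex.Im z|.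
Proof.
case: z => a b /=; rewrite -[leRHS]ger0_norm ?addr_ge0// -sqrtr_sqr ler_wsqrtr//.
rewrite sqrrD !real_normK ?num_real// lerD2r lerDl mulrn_wge0// mulr_ge0//.
Qed.

Lemma normc_ge (z : R[i]) : `|complex.Re z| + `|complex.Im z| <= Normc.normc z *+ 2.
Proof.
case: z => a b /=; rewrite mulr2n lerD// -sqrtr_sqr ler_wsqrtr//.
  by rewrite lerDl sqr_ge0.
by rewrite lerDr sqr_ge0.
Qed.

Lemma quat_nbhs (x : quat R) U :
  nbhs x U <-> exists2 e : R, 0 < e & forall y : quat R, qnorm (y - x) < e -> U y.
Proof.
have -> : nbhs x U = @nbhs _ (R * R * R * R)%type x U by [].
split.
  move/(@nbhs_ballP _ (R * R * R * R)%type) => [e /= e0 h]; exists e => // y hy.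
  apply: h; move: hy; case: x y => [[[a b] c] d] [[[a' b'] c'] d'] /= hy.
  have := normr_ge0 (a' - a); have := normr_ge0 (b' - b).
  have := normr_ge0 (c' - c); have := normr_ge0 (d' - d).
  move: (`|a' - a|) (`|b' - b|) (`|c' - c|) (`|d' - d|) (distrC a' a) (distrC b' b)
     (distrC c' c) (distrC d' d) hy => A B C D eA eB eC eD hy *.
  by split; [split; [split|]|]; rewrite /ball /= -?eA -?eB -?eC -?eD; lra.
case=> e e0 h; apply/(@nbhs_ballP _ (R * R * R * R)%type); exists (e / 4%:R) => /=.
  by rewrite divr_gt0.
move=> y hy; apply: h; move: hy.
case: x y => [[[a b] c] d] [[[a' b'] c'] d'] /= [[[]]].
rewrite /ball /= (distrC a) (distrC b) (distrC c) (distrC d); lra.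
Qed.

Lemma snbhs x (U : set (scal R k)) :
  nbhs x U <-> exists2 e : R, 0 < e & forall y, snorm (y - x) < e -> U y.
Proof.
case: k x U => [x U|x U|x U].
- split.
    move/nbhs_ballP => [e /= e0 h]; exists e => // y; rewrite /snorm/= normr0 !addr0 => hy.
    by apply: h; rewrite /ball /= distrC.
  case=> e e0 h; apply/nbhs_ballP; exists e => //= y; rewrite /ball /= => hy.
  by apply: h; rewrite /snorm /= normr0 !addr0 distrC.
- split.
    (* Radii in [R[i]] are complex numbers; positivity forces the imaginary part to vanish. *)
    move/(@nbhs_ballP _ (R[i]^o)) => [[e e'] /= ]; rewrite ltcE /= => /andP[/eqP ee e0 h].
    rewrite {}ee in h.
    exists e => // y hy; apply: h; rewrite /ball /= ltcE /= eqxx /=.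
    apply: le_lt_trans (normc_le _) _; apply: le_lt_trans hy.
    by rewrite -snormN opprB /snorm/= normr0 !addr0.
  case=> e e0 h; apply/(@nbhs_ballP _ (R[i]^o)); exists (Complex (e / 2) 0) => /=.
    by rewrite ltcE /= eqxx; lra.
  move=> y; rewrite /ball /= ltcE /= eqxx /= => hy; apply: h.
  rewrite -snormN opprB /snorm/= normr0 !addr0.
  by apply: le_lt_trans (normc_ge _) _; rewrite mulr2n; lra.
- exact: quat_nbhs.
Qed.

Lemma real_complete (u : nat -> R) (C : R) :
  (forall n, `|u n.+1 - u n| <= C / 2 ^+ n) ->
  exists l, forall n, `|l - u n| <= 2 * C / 2 ^+ n.
Proof.
move=> hu.
have C0 : 0 <= C by have := le_trans (normr_ge0 _) (hu 0%N); rewrite expr0 divr1.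
have h2 n : (0 : R) < 2 ^+ n by rewrite exprn_gt0.
have hb n m : `|u (n + m)%N - u n| <= 2 * C / 2 ^+ n - 2 * C / 2 ^+ (n + m).
  elim: m => [|m IH]; first by rewrite addn0 !subrr normr0.
  have -> : u (n + m.+1)%N - u n = (u (n + m).+1 - u (n + m)%N) + (u (n + m)%N - u n).
    by rewrite addnS; ring.
  apply: le_trans (ler_normD _ _) _; apply: le_trans (lerD (hu _) IH) _.
  have -> : 2 * C / 2 ^+ (n + m.+1) = C / 2 ^+ (n + m).
    by rewrite addnS exprS; field; rewrite lt0r_neq0.
  have -> : 2 * C / 2 ^+ (n + m) = C / 2 ^+ (n + m) + C / 2 ^+ (n + m).
    by field; rewrite lt0r_neq0.
  by lra.
have hb' n m : (n <= m)%N -> `|u m - u n| <= 2 * C / 2 ^+ n.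
  move=> nm; have := hb n (m - n)%N; rewrite subnKC// => /le_trans; apply.
  by rewrite gerBl divr_ge0 ?mulr_ge0 // ltW.
(* By [hb'] every [u n - 2 * C / 2 ^+ n] is a lower bound of the later terms; the limit is the
   supremum of these bounds. *)
pose E := [set x | exists n, x = u n - 2 * C / 2 ^+ n].
have ub n : ubound E (u n + 2 * C / 2 ^+ n).
  move=> _ [m ->].
  have [nm|mn] := leqP n m.
    have := hb' _ _ nm; have : 0 <= 2 * C / 2 ^+ m by rewrite divr_ge0 ?mulr_ge0 // ltW.
    by rewrite ler_norml => ? /andP[]; lra.
  have := hb' _ _ (ltnW mn); have : 0 <= 2 * C / 2 ^+ n by rewrite divr_ge0 ?mulr_ge0 // ltW.
  by rewrite ler_norml => ? /andP[]; lra.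
have E0 : E !=set0 by exists (u 0%N - 2 * C / 2 ^+ 0); exists 0%N.
exists (sup E) => n; rewrite ler_norml; apply/andP; split.
  rewrite lerNl opprB lerBlDr addrC -lerBlDr; apply: ub_le_sup; last by exists n.
  by exists (u 0%N + 2 * C / 2 ^+ 0); exact: ub.
by rewrite lerBlDr addrC; apply: ge_sup => //; exact: ub.
Qed.

(** Each of the four real coordinates converges with error 2 C / 2^n, and [snorm] adds them up:
    hence the factor 8. *)
Lemma scomplete (u : nat -> scal R k) (C : R) :
  (forall n, snorm (u n.+1 - u n) <= C / 2 ^+ n) ->
  exists l, forall n, snorm (l - u n) <= 8 * C / 2 ^+ n.
Proof.
move=> hu.
have hc (f : quat R -> R) : (forall x y : quat R, f (x - y) = f x - f y) -> (forall x : quat R, `|f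
  x| <= qnorm x) ->
    exists l, forall n, `|l - f (squat (u n))| <= 2 * C / 2 ^+ n.
  move=> fB fn; apply: real_complete => n; rewrite -fB -squatN -squatD.
  exact: le_trans (fn _) (hu n).
have [] := hc (fun x : quat R => x.1.1.1).
- by move=> [[[? ?] ?] ?] [[[? ?] ?] ?].
- by move=> [[[a' b'] c'] d'] /=; move: (normr_ge0 a') (normr_ge0 b') (normr_ge0 c') (normr_ge0 d'); lra.
move=> a ha; have [] := hc (fun x : quat R => x.1.1.2).
- by move=> [[[? ?] ?] ?] [[[? ?] ?] ?].
- by move=> [[[a' b'] c'] d'] /=; move: (normr_ge0 a') (normr_ge0 b') (normr_ge0 c') (normr_ge0 d'); lra.
move=> b hb; have [] := hc (fun x : quat R => x.1.2).
- by move=> [[[? ?] ?] ?] [[[? ?] ?] ?].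
- by move=> [[[a' b'] c'] d'] /=; move: (normr_ge0 a') (normr_ge0 b') (normr_ge0 c') (normr_ge0 d'); lra.
move=> c hcc; have [] := hc (fun x : quat R => x.2).
- by move=> [[[? ?] ?] ?] [[[? ?] ?] ?].
- by move=> [[[a' b'] c'] d'] /=; move: (normr_ge0 a') (normr_ge0 b') (normr_ge0 c') (normr_ge0 d'); lra.
move=> d hd.
pose q : quat R := match k with Reals => (a, 0, 0, 0) | Complexes => (a, b, 0, 0)
  | Quaternions => (a, b, c, d) end.
have [l lq] : exists l : scal R k, squat l = q.
  by rewrite /q; case: k; [exists a|exists (Complex a b)|exists (a, b, c, d)].
have C0 : 0 <= C.
  by have := le_trans (snorm_ge0 _) (hu 0%N); rewrite expr0 divr1.
exists l => n; rewrite /snorm squatD squatN lq /q.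
have := ha n; have := hb n; have := hcc n; have := hd n.
rewrite -!mulrA; set e := C / 2 ^+ n.
have e0 : 0 <= e by rewrite divr_ge0 // exprn_ge0.
by case: k (u n) => [x|[x y]|[[[x y] z] t]] /=; rewrite ?subrr ?oppr0 ?addr0 ?normr0; lra.
Qed.

End ScalarTopology.

(** * Matrices over real division algebras *)

Section MatrixNorm.
Variables (R : realType) (k : scalars).
Local Notation K := (scal R k).
Variables (m n : nat).
Implicit Types A B : 'M[K]_(m, n).

(** A sum, not a maximum, so that the norm is submultiplicative without a factor depending on the
    size. *)
Definition mnorm A : R := \sum_i \sum_j snorm (A i j).

Lemma mnorm_ge0 A : 0 <= mnorm A.
Proof. by do 2![apply: sumr_ge0 => ? _]; exact: snorm_ge0. Qed.

Lemma mnormD A B : mnorm (A + B) <= mnorm A + mnorm B.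
Proof.
rewrite /mnorm -big_split; apply: ler_sum => i _; rewrite -big_split.
by apply: ler_sum => j _; rewrite mxE snormD.
Qed.

Lemma mnormN A : mnorm (- A) = mnorm A.
Proof. by apply: eq_bigr => i _; apply: eq_bigr => j _; rewrite mxE snormN. Qed.

Lemma mnormBC A B : mnorm (A - B) = mnorm (B - A).
Proof. by rewrite -mnormN opprB. Qed.

Lemma mnorm_tri A B C : mnorm (A - C) <= mnorm (A - B) + mnorm (B - C).
Proof. by rewrite -[A in leLHS](subrK B) -addrA mnormD. Qed.

Lemma snorm0 : snorm (0 : K) = 0.
Proof. by rewrite -(sreal0 R k) snorm_real normr0. Qed.

Lemma mnorm0 : mnorm 0 = 0.
Proof. by apply: big1 => i _; apply: big1 => j _; rewrite mxE snorm0. Qed.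

Lemma mnorm_entry A i j : snorm (A i j) <= mnorm A.
Proof.
rewrite /mnorm (bigD1 i)//= (bigD1 j)//= -addrA lerDl addr_ge0//.
  by apply: sumr_ge0 => ? _; exact: snorm_ge0.
by do 2![apply: sumr_ge0 => ? _]; exact: snorm_ge0.
Qed.

Lemma mnorm_eq0 A : mnorm A = 0 -> A = 0.
Proof.
move=> h; apply/matrixP => i j; rewrite mxE; apply: snorm0_eq0.
by apply/eqP; rewrite eq_le snorm_ge0 andbT -h mnorm_entry.
Qed.

Lemma mnorm_small A B : (forall e : R, 0 < e -> mnorm (A - B) <= e) -> A = B.
Proof.
move=> h; apply/eqP; rewrite -subr_eq0; apply/eqP/mnorm_eq0/eqP.
rewrite eq_le mnorm_ge0 andbT.
rewrite leNgt; apply/negP => p; have := h (mnorm (A - B) / 2).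
by move: p; lra.
Qed.

Lemma mnbhs A (U : set 'M[K]_(m, n)) :
  nbhs A U <-> exists2 e : R, 0 < e & forall B, mnorm (B - A) < e -> U B.
Proof.
split.
  move=> [P hP PU].
  have {}hP ij : exists e : R, 0 < e /\ forall y, snorm (y - A ij.1 ij.2) < e -> P ij.1 ij.2 y.
    by have /snbhs[e e0 he] := hP ij.1 ij.2; exists e.
  pose f ij := xget 1 [set e : R | 0 < e /\ forall y, snorm (y - A ij.1 ij.2) < e -> P ij.1 ij.2 y].
  have fP ij : 0 < f ij /\ forall y, snorm (y - A ij.1 ij.2) < f ij -> P ij.1 ij.2 y.
    by have := xgetPex 1 (hP ij).
  (* The initial value 1 keeps the minimum positive when the matrix has no entries. *)
  exists (\big[Num.min/1]_ij f ij).
    by elim/big_ind: _ => // [x y x0 y0|ij _]; [rewrite lt_min x0 y0|case: (fP ij)].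
  move=> B hB; apply: PU => i j; apply: (fP (i, j)).2 => /=.
  have := mnorm_entry (B - A) i j; rewrite !mxE => /le_lt_trans; apply.
  apply: lt_le_trans hB _; exact: (bigmin_le 1 (i, j)).
case=> e e0 h.
(* Dividing by m n + 1 instead of m n makes the sum over the entries strictly smaller than [e], also
   for empty matrices. *)
have M0 : 0 < ((m * n).+1%:R : R) by rewrite ltr0n.
exists (fun i j => [set y | snorm (y - A i j) < e / (m * n).+1%:R]).
  by move=> i j; apply/snbhs; exists (e / (m * n).+1%:R) => //; rewrite divr_gt0.
move=> B hB; apply: h; rewrite /mnorm.
apply: (@le_lt_trans _ _ (\sum_(i < m) \sum_(j < n) e / (m * n).+1%:R)).
  by apply: ler_sum => i _; apply: ler_sum => j _; rewrite !mxE ltW//; exact: hB.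
rewrite !sumr_const !card_ord -mulrnA -[_ *+ (_ * _)]mulr_natr mulrAC ltr_pdivrMr// ltr_pM2l//.
by rewrite ltr_nat mulnC.
Qed.

Lemma mcomplete (u : nat -> 'M[K]_(m, n)) (C : R) :
  (forall i, mnorm (u i.+1 - u i) <= C / 2 ^+ i) ->
  exists l, forall e : R, 0 < e -> exists N, forall i, (N <= i)%N -> mnorm (l - u i) <= e.
Proof.
move=> hu.
have hc ij : exists l, forall i, snorm (l - u i ij.1 ij.2) <= 8 * C / 2 ^+ i.
  apply: scomplete => i; have := mnorm_entry (u i.+1 - u i) ij.1 ij.2.
  by rewrite !mxE => /le_trans; apply.
pose f ij := xget 0 [set l | forall i, snorm (l - u i ij.1 ij.2) <= 8 * C / 2 ^+ i].
have fP ij : forall i, snorm (f ij - u i ij.1 ij.2) <= 8 * C / 2 ^+ i.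
  by have := xgetPex 0 (hc ij).
exists (\matrix_(i, j) f (i, j)) => e e0.
have C0 : 0 <= C.
  by have := le_trans (mnorm_ge0 _) (hu 0%N); rewrite expr0 divr1.
pose D : R := 8 * C *+ (m * n); have D0 : 0 <= D by rewrite mulrn_wge0// mulr_ge0.
have hb i : mnorm (\matrix_(i, j) f (i, j) - u i) <= D / 2 ^+ i.
  apply: (@le_trans _ _ (\sum_(i' < m) \sum_(j < n) 8 * C / 2 ^+ i)).
    by apply: ler_sum => i' _; apply: ler_sum => j _; rewrite !mxE; exact: (fP (i', j)).
  by rewrite !sumr_const !card_ord -mulrnA mulnC /D [leRHS]mulrnAl.
have [N hN] : exists N, D / e <= N%:R.
  exists (Num.bound (D / e)); apply/ltW/archi_boundP; apply: divr_ge0 => //; exact: ltW.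
exists N => i Ni; apply: le_trans (hb i) _.
rewrite ler_pdivrMr ?exprn_gt0// mulrC -ler_pdivrMr//.
apply: le_trans hN _; rewrite -natrX ler_nat; apply: (leq_trans Ni).
by apply: ltnW; rewrite ltn_expl.
Qed.

End MatrixNorm.

Lemma mnormM (R : realType) (k : scalars) m n p (A : 'M[scal R k]_(m, n)) (B : 'M[scal R k]_(n, p)) :
  mnorm (A *m B) <= mnorm A * mnorm B.
Proof.
rewrite /mnorm mulr_suml; apply: ler_sum => i _.
rewrite mulr_suml.
apply: (@le_trans _ _ (\sum_j \sum_l snorm (A i l) * snorm (B l j))).
  apply: ler_sum => j _; rewrite mxE.
  elim/big_ind2: _ => [|x1 x2 y1 y2 h1 h2|l _]; [by rewrite snorm0| |exact: snormM].
  by apply: le_trans (snormD _ _) _; exact: lerD.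
rewrite exchange_big; apply: ler_sum => l _; rewrite -mulr_sumr ler_wpM2l ?snorm_ge0//.
rewrite (bigD1 l)//= lerDl.
by do 2![apply: sumr_ge0 => ? _]; exact: snorm_ge0.
Qed.

Lemma open_subspace_nbhs (T : topologicalType) (A U : set T) :
  open (U : set (subspace A)) <->
  forall x, A x -> U x -> nbhs x [set y | A y -> U y].
Proof.
rewrite openE; split => [h x Ax Ux|h x Ux].
  have : nbhs (x : subspace A) U by exact: (h : U `<=` _).
  by case: (nbhs_subspaceP A x).
rewrite /interior /=; have := h x.
by case: (nbhs_subspaceP A x) => [Ax hx|nAx _ y ->//]; exact: hx.
Qed.

Section Scaling.
Variables (R : realType) (k : scalars).
Local Notation K := (scal R k).

(** Real scalars are central in all three algebras, so this scaling passes through products on both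
    sides, which [*:] by a quaternion does not. *)
Definition rsc m n (r : R) (A : 'M[K]_(m, n)) := sreal k r *: A.

Lemma rscAl m n p r (A : 'M[K]_(m, n)) (B : 'M[scal R k]_(n, p)) : rsc r A *m B = rsc r (A *m B).
Proof. by rewrite /rsc scalemxAl. Qed.

Lemma rscAr m n p r (A : 'M[K]_(m, n)) (B : 'M[scal R k]_(n, p)) : A *m rsc r B = rsc r (A *m B).
Proof.
apply/matrixP => i j; rewrite !mxE big_distrr; apply: eq_bigr => l _.
by rewrite /= mxE !mulrA srealC.
Qed.

Lemma rscD m n r (A B : 'M[K]_(m, n)) : rsc r (A + B) = rsc r A + rsc r B.
Proof. exact: scalerDr. Qed.

Lemma rscDl m n r s (A : 'M[K]_(m, n)) : rsc (r + s) A = rsc r A + rsc s A.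
Proof. by rewrite /rsc srealD scalerDl. Qed.

Lemma rscN m n r (A : 'M[K]_(m, n)) : rsc r (- A) = - rsc r A.
Proof. exact: scalerN. Qed.

Lemma rscNl m n r (A : 'M[K]_(m, n)) : rsc (- r) A = - rsc r A.
Proof. by rewrite /rsc srealN scaleNr. Qed.

Lemma rscM m n r s (A : 'M[K]_(m, n)) : rsc r (rsc s A) = rsc (r * s) A.
Proof. by rewrite /rsc scalerA srealM. Qed.

Lemma rsc1 m n (A : 'M[K]_(m, n)) : rsc 1 A = A.
Proof. by rewrite /rsc sreal1 scale1r. Qed.

Lemma rscr0 m n r : rsc r (0 : 'M[K]_(m, n)) = 0.
Proof. exact: scaler0. Qed.

Lemma mnorm_rsc m n r (A : 'M[K]_(m, n)) : mnorm (rsc r A) <= `|r| * mnorm A.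
Proof.
rewrite /mnorm mulr_sumr; apply: ler_sum => i _; rewrite mulr_sumr; apply: ler_sum => j _.
by rewrite mxE; apply: le_trans (snormM _ _) _; rewrite snorm_real.
Qed.

Lemma rsc_half m n (A B : 'M[K]_(m, n)) : A + A = B -> A = rsc 2^-1 B.
Proof.
move=> <-; rewrite rscD -rscDl (_ : 2^-1 + 2^-1 = 1) ?rsc1//; lra.
Qed.

End Scaling.

Section Twist.
Variables (R : realType) (k : scalars) (b : bool).
Local Notation K := (scal R k).

(* The boolean selects the star operation, so that [adj b] is the transpose or
   the conjugate transpose.  Over the quaternions only the latter is
   anti-multiplicative, and only the identity is multiplicative. *)
Definition tw (x : K) : K := if b then sconj x else x.

Definition anti_ok := b = false -> k <> Quaternions.
Definition auto_ok := b = true -> k <> Quaternions.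

Lemma twD x y : tw (x + y) = tw x + tw y.
Proof. by rewrite /tw; case: b => //; exact: sconjD. Qed.

Lemma tw0 : tw 0 = 0.
Proof. by apply: (addrI (tw 0)); rewrite -twD !addr0. Qed.

Lemma twN x : tw (- x) = - tw x.
Proof. by apply: (addrI (tw x)); rewrite -twD !subrr tw0. Qed.

Lemma twK x : tw (tw x) = x.
Proof. by rewrite /tw; case: b => //; exact: sconjK. Qed.

Lemma tw_real r : tw (sreal k r) = sreal k r.
Proof. by rewrite /tw; case: b => //; exact: sreal_conj. Qed.

Lemma tw1 : tw 1 = 1.
Proof. by rewrite -(sreal1 R k) tw_real. Qed.

Lemma snorm_tw x : snorm (tw x) = snorm x.
Proof. by rewrite /tw; case: b => //; exact: snorm_conj. Qed.

Lemma twM_anti : anti_ok -> forall x y, tw (x * y) = tw y * tw x.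
Proof.
rewrite /anti_ok /tw; case: b => [_ x y|/(_ erefl) h x y]; first exact: sconjM.
exact: scomm.
Qed.

Lemma twM_auto : auto_ok -> forall x y, tw (x * y) = tw x * tw y.
Proof.
rewrite /auto_ok /tw; case: b => [/(_ erefl) h x y|_ x y//].
by rewrite sconjM; exact: scomm.
Qed.

Lemma tw_sum (I : Type) (r : seq I) (F : I -> K) :
  tw (\sum_(i <- r) F i) = \sum_(i <- r) tw (F i).
Proof. by elim/big_rec2: _ => [|i x y _ <-]; rewrite ?tw0 ?twD. Qed.

Definition adj m n (A : 'M[K]_(m, n)) : 'M[K]_(n, m) := map_mx tw A^T.
Definition tws m n (A : 'M[K]_(m, n)) : 'M[K]_(m, n) := map_mx tw A.

Lemma adjE m n (A : 'M[K]_(m, n)) i j : adj A i j = tw (A j i).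
Proof. by rewrite !mxE. Qed.

Lemma adjD m n (A B : 'M[K]_(m, n)) : adj (A + B) = adj A + adj B.
Proof. by apply/matrixP => i j; rewrite !mxE twD. Qed.

Lemma adjN m n (A : 'M[K]_(m, n)) : adj (- A) = - adj A.
Proof. by apply/matrixP => i j; rewrite !mxE twN. Qed.

Lemma adj0 m n : adj (0 : 'M[K]_(m, n)) = 0.
Proof. by apply/matrixP => i j; rewrite !mxE tw0. Qed.

Lemma adjK m n (A : 'M[K]_(m, n)) : adj (adj A) = A.
Proof. by apply/matrixP => i j; rewrite !mxE twK. Qed.

Lemma adjmx1 n : adj (1%:M : 'M[K]_n) = 1%:M.
Proof.
apply/matrixP => i j; rewrite !mxE [j == i]eq_sym.
by case: (i == j) => /=; rewrite ?tw0 ?tw1.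
Qed.

Lemma adj_rsc m n r (A : 'M[K]_(m, n)) : adj (rsc r A) = rsc r (adj A).
Proof.
apply/matrixP => i j; rewrite !mxE.
rewrite /tw; case: b => //; by rewrite sconjM sreal_conj srealC.
Qed.

Lemma adjM m n p (A : 'M[K]_(m, n)) (B : 'M[scal R k]_(n, p)) : anti_ok ->
  adj (A *m B) = adj B *m adj A.
Proof.
move=> ok; apply/matrixP => i j; rewrite !mxE tw_sum; apply: eq_bigr => l _.
by rewrite !mxE twM_anti.
Qed.

Lemma mnorm_adj m n (A : 'M[K]_(m, n)) : mnorm (adj A) = mnorm A.
Proof.
rewrite /mnorm exchange_big; apply: eq_bigr => i _; apply: eq_bigr => j _.
by rewrite !mxE snorm_tw.
Qed.

Lemma twsD m n (A B : 'M[K]_(m, n)) : tws (A + B) = tws A + tws B.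
Proof. by apply/matrixP => i j; rewrite !mxE twD. Qed.

Lemma twsN m n (A : 'M[K]_(m, n)) : tws (- A) = - tws A.
Proof. by apply/matrixP => i j; rewrite !mxE twN. Qed.

Lemma tws0 m n : tws (0 : 'M[K]_(m, n)) = 0.
Proof. by apply/matrixP => i j; rewrite !mxE tw0. Qed.

Lemma twsK m n (A : 'M[K]_(m, n)) : tws (tws A) = A.
Proof. by apply/matrixP => i j; rewrite !mxE twK. Qed.

Lemma tws1 n : tws (1%:M : 'M[K]_n) = 1%:M.
Proof.
by apply/matrixP => i j; rewrite !mxE; case: (i == j) => /=; rewrite ?tw0 ?tw1.
Qed.

Lemma tws_rsc m n r (A : 'M[K]_(m, n)) : tws (rsc r A) = rsc r (tws A).
Proof.
apply/matrixP => i j; rewrite !mxE.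
rewrite /tw; case: b => //; by rewrite sconjM sreal_conj srealC.
Qed.

Lemma twsM m n p (A : 'M[K]_(m, n)) (B : 'M[scal R k]_(n, p)) : auto_ok ->
  tws (A *m B) = tws A *m tws B.
Proof.
move=> ok; apply/matrixP => i j; rewrite !mxE tw_sum; apply: eq_bigr => l _.
by rewrite !mxE twM_auto.
Qed.

Lemma mnorm_tws m n (A : 'M[K]_(m, n)) : mnorm (tws A) = mnorm A.
Proof. by apply: eq_bigr => i _; apply: eq_bigr => j _; rewrite !mxE snorm_tw. Qed.

End Twist.

Lemma twC (R : realType) (k : scalars) b c (x : scal R k) : tw b (tw c x) = tw c (tw b x).
Proof. by rewrite /tw; case: b c => [] []. Qed.

Lemma tw_addb (R : realType) (k : scalars) b c (x : scal R k) : tw b (tw c x) = tw (b (+) c) x.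
Proof. by rewrite /tw; case: b c => [] [] //=; rewrite sconjK. Qed.

Lemma adj_tws (R : realType) (k : scalars) b c m n (A : 'M[scal R k]_(m, n)) :
  adj b (tws c A) = tws c (adj b A).
Proof. by apply/matrixP => i j; rewrite !mxE twC. Qed.

(** * Linear algebra over a division ring that need not commute *)

Section LinearAlgebra.
Variables (R : realType) (k : scalars).
Local Notation K := (scal R k).

Lemma mulmx_ext m n (A B : 'M[K]_(m, n)) : (forall v : 'cV_n, A *m v = B *m v) -> A = B.
Proof. by move=> h; apply/matrixP => i j; have := h (delta_mx j 0); rewrite -!colE => /matrixP/(_ i
  0); rewrite !mxE. Qed.

Lemma mulmx_factor m n p (A : 'M[K]_(m, n)) (B : 'M[K]_(m, p)) :
  (forall v : 'cV_n, exists z, A *m v = B *m z) -> exists X, A = B *m X.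
Proof.
move=> /choice[f hf]; exists (\matrix_(i, j) f (delta_mx j 0) i 0).
apply/matrixP => i j; have := hf (delta_mx j 0); rewrite -colE => /matrixP/(_ i 0).
by rewrite !mxE => ->; apply: eq_bigr => l _; rewrite !mxE.
Qed.

Lemma sre_sum (I : Type) (r : seq I) (F : I -> K) :
  sre (\sum_(i <- r) F i) = \sum_(i <- r) sre (F i).
Proof.
elim/big_rec2: _ => [|i x y _ <-]; last exact: sreD.
by rewrite -(sreal0 R k) sre_real.
Qed.

(** Over H only the real part of the trace is cyclic. It takes the value n at the identity of size
    n, and so measures dimension. *)
Definition mtr n (A : 'M[K]_n) : R := sre (\tr A).

Lemma mtrMC m n (A : 'M[K]_(m, n)) (B : 'M[K]_(n, m)) : mtr (A *m B) = mtr (B *m A).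
Proof.
rewrite /mtr /mxtrace !sre_sum.
under eq_bigr do rewrite mxE sre_sum; rewrite exchange_big.
apply: eq_bigr => j _; rewrite mxE sre_sum; apply: eq_bigr => i _; exact: sreMC.
Qed.

Lemma mtr1 n : mtr (1%:M : 'M[K]_n) = n%:R.
Proof.
rewrite /mtr mxtrace1; elim: n => [|n IH]; first by rewrite mulr0n -(sreal0 R k) sre_real.
by rewrite mulrSr sreD IH -(sreal1 R k) sre_real mulrSr.
Qed.

Lemma mtrD n (A B : 'M[K]_n) : mtr (A + B) = mtr A + mtr B.
Proof. by rewrite /mtr raddfD sreD. Qed.

(** Gaussian elimination by induction on [n]: either all first coordinates vanish on [Q], or one
    vector is normalised to have first coordinate 1 and the rest is eliminated against it. The left
    inverse [L] is built along with the basis, which makes rank arguments unnecessary. *)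
Lemma module_basis n (Q : set 'cV[K]_n) : Q 0 ->
  (forall v w, Q v -> Q w -> Q (v + w)) ->
  (forall v c, Q v -> Q (v *m c%:M)) ->
  exists r (F : 'M[K]_(n, r)) (L : 'M[K]_(r, n)),
    L *m F = 1%:M /\ forall v, Q v <-> exists z, F *m z = v.
Proof.
elim: n Q => [|n IH]; last rewrite -[n.+1]/(1 + n)%N; move=> Q Q0 QD QZ.
  exists 0%N, 0, 0; split; first by apply/matrixP => -[].
  move=> v; have -> : v = 0 by apply/matrixP => -[].
  by split=> // _; exists 0; rewrite mulmx0.
have [] := IH [set w | Q (col_mx (0 : 'M[K]_1) w)].
- by rewrite /= col_mx0.
- by move=> v w /= Qv Qw; rewrite -(addr0 (0 : 'M[K]_1)) -add_col_mx; exact: QD.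
- by move=> v c /= Qv; rewrite -(mul0mx 1 (c%:M : 'M[K]_1)) -mul_col_mx; exact: QZ.
move=> r [F [L [LF QF]]].
have subQ v w : Q v -> Q w -> Q (v - w).
  move=> Qv Qw; apply: QD => //; have -> : - w = w *m (- 1)%:M; last exact: QZ.
  by rewrite -[X in _ *m X%:M]/(- (1 : K)) raddfN mulmxN mulmx1.
have [h|] := pselect (forall v : 'cV[K]_(1 + n), Q v -> usubmx v = 0).
  exists r, (col_mx (0 : 'M[K]_(1, r)) F : 'M[K]_(1 + n, r)), (row_mx 0 L : 'M[K]_(r, 1 + n)); split.
    by rewrite (@mul_row_col K r 1 n r) mul0mx add0r.
  move=> v; have [a [w ->]] : exists (a : 'cV[K]_1) (w : 'cV[K]_n), v = col_mx a w.
    by exists (@usubmx _ 1 n _ v), (@dsubmx _ 1 n _ v); rewrite vsubmxK.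
  split.
    move=> Qv; move: (h _ Qv); rewrite col_mxKu => a0; rewrite a0 in Qv *.
    by have [z hz] := (QF _).1 Qv; exists z; rewrite (@mul_col_mx K 1 n r 1) mul0mx hz.
  case=> z; rewrite (@mul_col_mx K 1 n r 1) mul0mx => <-; apply/QF; by exists z.
move/existsNP => [v /not_implyP [Qv /eqP v0]].
have c0 : v 0 0 != 0.
  apply: contra v0 => /eqP v00; apply/eqP/matrixP => i j; rewrite !mxE !ord1 -[RHS]v00.
  by congr (v _ _); apply/val_inj.
have [d [cd dc]] := sinv c0.
(* [d] is the inverse of the first coordinate of [v], so [v1] is the pivot column, with leading
   entry 1. *)
pose v1 : 'cV_(1 + n) := v *m d%:M; have Qv1 : Q v1 by exact: QZ.
have v1E : v1 = col_mx 1%:M (dsubmx v1).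
  rewrite -{1}[v1](@vsubmxK _ 1 n); congr col_mx.
  apply/matrixP => i j; rewrite !ord1 mxE /v1 mxE (bigD1 0)//= big1 ?addr0; last by case=> [[]].
  rewrite !mxE /= mulr1n -[RHS]cd; congr (v _ _ * _); exact: val_inj.
set u := dsubmx v1 in v1E.
exists (1 + r)%N, (block_mx 1%:M 0 u F : 'M[K]_(1 + n, 1 + r)), (block_mx 1%:M 0 (- (L *m u)) L :
  'M[K]_(1 + r, 1 + n)); split.
  rewrite (@mulmx_block _ 1 r 1 n) !mulmx1 !mul1mx !mul0mx !mulmx0 !addr0 !add0r LF addNr.
  by rewrite -scalar_mx_block.
move=> x; rewrite -[x](@vsubmxK _ 1 n); set a := usubmx x; set y := dsubmx x.
have aE : a = (a 0 0)%:M by exact: mx11_scalar.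
split.
  move=> Qx; have : Q (col_mx 0 (y - u *m a)).
    have -> : col_mx 0 (y - u *m a) = col_mx a y - v1 *m a.
      by rewrite v1E mul_col_mx mul1mx opp_col_mx add_col_mx subrr.
    by apply: subQ => //; rewrite aE; exact: QZ.
  move/QF => [z hz]; exists (col_mx a z).
  by rewrite (@mul_block_col _ 1 n 1 r) mul1mx mul0mx addr0 hz addrC subrK.
case=> z; rewrite -[z](@vsubmxK _ 1 r) (@mul_block_col _ 1 n 1 r) mul1mx mul0mx addr0 => <-.
have -> : col_mx (usubmx z) (u *m usubmx z + F *m dsubmx z) =
    v1 *m ((usubmx z) 0 0)%:M + col_mx 0 (F *m dsubmx z).
  by rewrite -mx11_scalar v1E mul_col_mx mul1mx add_col_mx addr0.
apply: QD; first exact: QZ.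
by apply/QF; exists (dsubmx z).
Qed.

Lemma idem_factor n (P : 'M[K]_n) : P *m P = P ->
  exists r (F : 'M[K]_(n, r)) (L : 'M[K]_(r, n)), L *m F = 1%:M /\ F *m L = P.
Proof.
move=> PP; have [] := @module_basis n [set v | P *m v = v].
- by rewrite /= mulmx0.
- by move=> v w /= Pv Pw; rewrite mulmxDr Pv Pw.
- by move=> v c /= Pv; rewrite mulmxA Pv.
move=> r [F [L [LF hQ]]]; have PF : P *m F = F.
  by apply: mulmx_ext => v; rewrite -mulmxA; apply/hQ; exists v.
exists r, F, (L *m P); split; first by rewrite -mulmxA PF.
apply: mulmx_ext => v; rewrite -!mulmxA.
have [z <-] : exists z, F *m z = P *m v by apply/hQ; rewrite /= mulmxA PP.
by rewrite (mulmxA L) LF mul1mx.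
Qed.

Lemma idem_compl n (P : 'M[K]_n) : P *m P = P -> (1%:M - P) *m (1%:M - P) = 1%:M - P.
Proof. by move=> PP; rewrite mulmxBl mul1mx mulmxBr mulmx1 PP subrr subr0. Qed.

(** The complement is the image of the idempotent 1 - F L. The trace of F L + F' L' = 1, computed
    cyclically, is r + s on one side and n on the other. *)
Lemma linv_dim n r (F : 'M[K]_(n, r)) (L : 'M[K]_(r, n)) : L *m F = 1%:M ->
  exists s (F' : 'M[K]_(n, s)) (L' : 'M[K]_(s, n)),
   [/\ L' *m F' = 1%:M, F *m L + F' *m L' = 1%:M & (r + s)%N = n].
Proof.
move=> LF; have PP : (F *m L) *m (F *m L) = F *m L.
  by rewrite mulmxA -[_ *m L *m F]mulmxA LF mulmx1.
have [s [F' [L' [LF' FL']]]] := idem_factor (idem_compl PP).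
exists s, F', L'; split => //; first by rewrite FL' addrC subrK.
have : mtr (F *m L + F' *m L') = n%:R by rewrite FL' addrC subrK mtr1.
by rewrite mtrD !(mtrMC F) !(mtrMC F') LF LF' !mtr1 -natrD => /eqP; rewrite eqr_nat => /eqP.
Qed.

Lemma linv_le n r (F : 'M[K]_(n, r)) (L : 'M[K]_(r, n)) : L *m F = 1%:M -> (r <= n)%N.
Proof. by move=> /linv_dim[s [_ [_ [_ _ <-]]]]; exact: leq_addr. Qed.

Lemma inv2_dim n r (F : 'M[K]_(n, r)) (L : 'M[K]_(r, n)) :
  L *m F = 1%:M -> F *m L = 1%:M -> r = n.
Proof. by move=> /linv_le h1 /linv_le h2; apply/eqP; rewrite eqn_leq h1. Qed.

Lemma linv_inv2 n r (F : 'M[K]_(n, r)) (L : 'M[K]_(r, n)) :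
  L *m F = 1%:M -> r = n -> F *m L = 1%:M.
Proof.
move=> LF rn; have [s [F' [L' [_ h hs]]]] := linv_dim LF.
have s0 : s = 0%N by move/eqP: hs; rewrite rn -[X in _ == X]addn0 eqn_add2l => /eqP.
move: F' L' h; rewrite s0 => F' L' h.
by rewrite -h (_ : F' *m L' = 0) ?addr0//; apply/matrixP => i j; rewrite !mxE big_ord0.
Qed.

(** The image of [F] has a basis [F0] with a left inverse [L0]; writing F0 = F X and cancelling [F]
    shows that X L0 is a left inverse of [F]. *)
Lemma inj_linv n r (F : 'M[K]_(n, r)) :
  (forall z : 'cV_r, F *m z = 0 -> z = 0) -> exists L : 'M[K]_(r, n), L *m F = 1%:M.
Proof.
move=> inj; have [] := @module_basis n [set v | exists z, F *m z = v].
- by exists 0; rewrite mulmx0.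
- by move=> _ _ [x <-] [y <-]; exists (x + y); rewrite mulmxDr.
- by move=> _ c [x <-]; exists (x *m c%:M); rewrite mulmxA.
move=> s [F0 [L0 [LF0 hQ]]].
have FE : F = F0 *m (L0 *m F).
  apply: mulmx_ext => v; have [z hz] : exists z, F0 *m z = F *m v by apply/hQ; exists v.
  by rewrite -!mulmxA -hz (mulmxA L0) LF0 mul1mx.
have [X hX] : exists X, F0 = F *m X.
  apply: mulmx_factor => v; have /hQ[z hz] : exists z, F0 *m z = F0 *m v by exists v.
  by exists z.
exists (X *m L0); apply: mulmx_ext => v; apply/eqP; rewrite -subr_eq0; apply/eqP/inj.
by rewrite mulmxBr mul1mx -!mulmxA (mulmxA F) -hX (mulmxA L0) (mulmxA F0) -FE subrr.
Qed.

Lemma inj_inv2 n (A : 'M[K]_n) :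
  (forall z : 'cV_n, A *m z = 0 -> z = 0) -> exists L, L *m A = 1%:M /\ A *m L = 1%:M.
Proof. by move=> /inj_linv[L LA]; exists L; split => //; exact: linv_inv2. Qed.

End LinearAlgebra.

(** * Transport between nearby decompositions *)

Section SquareRoot.
Variables (R : realType) (k : scalars).
Local Notation K := (scal R k).

Definition lim_closed m n (E : set 'M[K]_(m, n)) := forall M,
  (forall e : R, 0 < e -> exists2 M', E M' & mnorm (M - M') <= e) -> E M.

Definition lipschitz m n p q (f : 'M[K]_(m, n) -> 'M[K]_(p, q)) :=
  exists C : R, forall M M', mnorm (f M - f M') <= C * mnorm (M - M').

Lemma lim_closed_eq m n p q (f g : 'M[K]_(m, n) -> 'M[K]_(p, q)) :
  lipschitz f -> lipschitz g -> lim_closed [set M | f M = g M].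
Proof.
move=> [C hf] [D hg] M h; apply: mnorm_small => e e0.
have p0 : 0 < `|C| + `|D| + 1 by rewrite ltr_wpDl// addr_ge0.
have [M' /= E hM] := h _ (divr_gt0 e0 p0).
have -> : f M - g M = (f M - f M') - (g M - g M') by rewrite E opprB addrA subrK.
apply: le_trans (mnormD _ _) _; rewrite mnormN.
apply: le_trans (lerD (hf _ _) (hg _ _)) _; rewrite -mulrDl.
move: hM; rewrite ler_pdivlMr// mulrC => hM; apply: le_trans hM.
rewrite ler_wpM2r ?mnorm_ge0//; have := ler_norm C; have := ler_norm D; lra.
Qed.

Lemma lim_closedI m n (E F : set 'M[K]_(m, n)) :
  lim_closed E -> lim_closed F -> lim_closed (E `&` F).
Proof.
by move=> hE hF M h; split; [apply: hE|apply: hF] => e /h[M' []]; exists M'.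
Qed.

Lemma lipschitz_mull m n p (A : 'M[K]_(p, m)) : lipschitz (fun M : 'M[K]_(m, n) => A *m M).
Proof. by exists (mnorm A) => M M'; rewrite -mulmxBr mnormM. Qed.

Lemma lipschitz_mulr m n p (A : 'M[K]_(n, p)) : lipschitz (fun M : 'M[K]_(m, n) => M *m A).
Proof. by exists (mnorm A) => M M'; rewrite -mulmxBl mulrC mnormM. Qed.

Lemma lipschitz_comp m n p q r s (f : 'M[K]_(m, n) -> 'M[K]_(p, q))
  (g : 'M[K]_(p, q) -> 'M[K]_(r, s)) : lipschitz f -> lipschitz g -> lipschitz (fun M => g (f M)).
Proof.
move=> [C hf] [D hg]; exists (`|D| * C) => M M'.
apply: le_trans (hg _ _) _; apply: (@le_trans _ _ (`|D| * mnorm (f M - f M'))).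
  by rewrite ler_wpM2r ?mnorm_ge0// ler_norm.
by rewrite -mulrA ler_wpM2l.
Qed.

Lemma lipschitz_adj m n b : lipschitz (fun M : 'M[K]_(m, n) => adj b M).
Proof. by exists 1 => M M'; rewrite mul1r -adjN -adjD mnorm_adj. Qed.

Lemma lipschitz_tws m n b : lipschitz (fun M : 'M[K]_(m, n) => tws b M).
Proof. by exists 1 => M M'; rewrite mul1r -twsN -twsD mnorm_tws. Qed.

Variable n : nat.
Implicit Types X W : 'M[K]_n.

(* The fixed points [W] of [isqrt_step X] satisfy (1 + W)^2 (1 - X) = 1. *)
Definition isqrt_step X W := rsc 2^-1 (X - W *m W + (W + W + W *m W) *m X).

(** The constants are tuned to each other: r <= 1/4 gives |S| <= |D| / 2, and |X| <= 1/5 gives |(2 D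
    + S) X| <= |D| / 2, so the bracket is at most |D| and the outer factor 1/2 is the contraction
    constant. *)
Lemma isqrt_step_lip X (r : R) W W' : 0 <= r <= 4^-1 -> mnorm X <= 5^-1 ->
  mnorm W <= r -> mnorm W' <= r ->
  mnorm (isqrt_step X W - isqrt_step X W') <= 2^-1 * mnorm (W - W').
Proof.
move=> /andP[r0 r4] X5 hW hW'.
rewrite /isqrt_step -rscN -rscD; apply: le_trans (mnorm_rsc _ _) _.
rewrite ger0_norm ?invr_ge0// ler_wpM2l ?invr_ge0//.
set D := W - W'; set S := W *m W - W' *m W'.
have -> : X - W *m W + (W + W + W *m W) *m X - (X - W' *m W' + (W' + W' + W' *m W') *m X) =
   (D + D + S) *m X - S.
  rewrite opprD addrACA addrC -mulmxBl; congr (_ *m _ + _).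
    by rewrite opprD addrACA (opprD W' W') (addrACA W W).
  by rewrite opprB addrC addrA subrK opprB.
have S_le : mnorm S <= 2^-1 * mnorm D.
  have -> : S = W *m D + D *m W' by rewrite mulmxBr mulmxBl addrA subrK.
  apply: le_trans (mnormD _ _) _; apply: le_trans (lerD (mnormM _ _) (mnormM _ _)) _.
  rewrite [X in _ + X]mulrC -mulrDl ler_wpM2r ?mnorm_ge0//; lra.
apply: le_trans (mnormD _ _) _; rewrite mnormN.
have h : mnorm ((D + D + S) *m X) <= (mnorm D + mnorm D + mnorm S) * 5^-1.
  apply: le_trans (mnormM _ _) _; apply: ler_pM => //; rewrite ?mnorm_ge0//.
  by apply: le_trans (mnormD _ _) _; rewrite lerD2r mnormD.
have := mnorm_ge0 D; lra.
Qed.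

Lemma isqrt_step_ball X (r : R) W : 0 <= r <= 4^-1 -> mnorm X <= r / 2 -> mnorm W <= r ->
  mnorm (isqrt_step X W) <= r.
Proof.
move=> r4 hX hW.
have X5 : mnorm X <= 5^-1 by case/andP: r4; lra.
have := isqrt_step_lip r4 X5 hW (_ : mnorm 0 <= r).
rewrite mnorm0 subr0 => /(_ (proj1 (andP r4))) h.
have h0 : mnorm (isqrt_step X 0) <= 2^-1 * mnorm X.
  rewrite /isqrt_step !mul0mx !addr0 mul0mx subr0 addr0.
  by apply: le_trans (mnorm_rsc _ _) _; rewrite ger0_norm.
rewrite -[isqrt_step X W](subrK (isqrt_step X 0)); apply: le_trans (mnormD _ _) _.
apply: le_trans (lerD h h0) _; case/andP: r4; lra.
Qed.

(** The last clause is an induction principle for the limit of the iteration started at 0: it gives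
    commutation with other matrices and compatibility with [adj] and [tws] without any formula for
    [W] in terms of [X]. *)
Lemma isqrt_ex (e : R) : 0 < e -> exists2 d : R, 0 < d & forall X, mnorm X < d ->
  exists W, [/\ mnorm W <= e, (1%:M + W) *m (1%:M + W) *m (1%:M - X) = 1%:M
    & forall E : set 'M[K]_n, E 0 -> (forall W, E W -> E (isqrt_step X W)) -> lim_closed E -> E W].
Proof.
move=> e0; pose r := Num.min e 4^-1.
have r0 : 0 < r by rewrite lt_min e0; lra.
have r4 : r <= 4^-1 by rewrite ge_min lexx orbT.
have re : r <= e by rewrite ge_min lexx.
exists (r / 2); first by lra.
move=> X hX; pose u i := iter i (isqrt_step X) 0.
have r04 : 0 <= r <= 4^-1 by rewrite ltW.
have X5 : mnorm X <= 5^-1 by lra.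
have ur i : mnorm (u i) <= r.
  by elim: i => [|i IH]; [rewrite mnorm0 ltW|apply: isqrt_step_ball => //; exact: ltW].
have [l hl] : exists l, forall e : R, 0 < e -> exists N, forall i, (N <= i)%N -> mnorm (l - u i) <= e.
  apply: (mcomplete (C := 1)); elim => [|i IH].
    by rewrite expr0 divr1 subr0; apply: le_trans (ur 1%N) _; lra.
  have hi : mnorm (u i.+2 - u i.+1) <= 2^-1 * mnorm (u i.+1 - u i).
    exact: isqrt_step_lip r04 X5 (ur i.+1) (ur i).
  by apply: (le_trans hi); rewrite exprS invfM mulrCA ler_wpM2l// invr_ge0.
have lr : mnorm l <= r.
  rewrite leNgt; apply/negP => p; have [|N /(_ N (leqnn _))] := hl ((mnorm l - r) / 2); first lra.
  have := mnormD (l - u N) (u N); rewrite subrK; have := ur N; lra.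
have lim (E : set 'M[K]_n) : E 0 -> (forall W, E W -> E (isqrt_step X W)) -> lim_closed E -> E l.
  move=> E0 ES; apply => e' /hl[N /(_ N (leqnn _))]; exists (u N) => //.
  by elim: (N) => //= i; exact: ES.
have lX : l *m X = X *m l.
  apply: (lim [set W | W *m X = X *m W]).
  - by rewrite /= mul0mx mulmx0.
  - move=> W /= WX; rewrite /isqrt_step rscAl rscAr; congr rsc.
    have WWX : W *m W *m X = X *m (W *m W) by rewrite -mulmxA WX mulmxA WX mulmxA.
    rewrite mulmxDl [RHS]mulmxDr mulmxBl [in RHS]mulmxBr WWX; congr (_ + _).
    by rewrite [RHS]mulmxA; congr (_ *m X); rewrite !mulmxDl !mulmxDr WX WWX.
  - by apply: lim_closed_eq; [exact: lipschitz_mulr|exact: lipschitz_mull].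
have lE : l = isqrt_step X l.
  apply: mnorm_small => e' e'0.
  have [N hN] := hl _ (divr_gt0 e'0 (ltr0Sn _ 1)).
  have h1 := hN N.+1 (leqnSn _); have h2 := hN N (leqnn _).
  apply: le_trans (mnorm_tri _ (u N.+1) _) _.
  have := isqrt_step_lip r04 X5 (ur N) lr; rewrite (mnormBC (u N)) => h3.
  have := mnorm_ge0 (l - u N); move: h1 h2 h3 => /=; lra.
exists l; split => //; first exact: le_trans re.
have ll : l + l = X - l *m l + (l + l + l *m l) *m X.
  by rewrite {1 2}lE /isqrt_step -rscDl (_ : 2^-1 + 2^-1 = 1) ?rsc1//; lra.
have -> : (1%:M + l) *m (1%:M + l) = 1%:M + (l + l + l *m l).
  by rewrite mulmxDl mulmxDr !mulmx1 mul1mx mulmxDr mulmx1 !addrA.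
rewrite mulmxDl mul1mx mulmxBr mulmx1 {1}ll.
abel.
Qed.

End SquareRoot.

Section DirectRotation.
Variables (R : realType) (k : scalars).
Local Notation K := (scal R k).
Variable n : nat.
Implicit Types s g A : 'M[K]_n.

Definition same_parity (f h : 'M[K]_n -> 'M[K]_n) s s' :=
  (f s = h s /\ f s' = h s') \/ (f s = - h s /\ f s' = - h s').

(* For involutions [s], [s'] close to each other, [(1 + s' s) / 2] intertwines
   them; dividing it by the square root of [1 - (s - s')^2 / 4] makes it an
   element of every group defined by [s] up to sign. *)
Lemma direct_rotation s : s *m s = 1%:M -> forall e : R, 0 < e ->
  exists2 d : R, 0 < d & forall s', s' *m s' = 1%:M -> mnorm (s' - s) < d ->
  exists g gi, [/\ gi *m g = 1%:M /\ g *m gi = 1%:M, g *m s = s' *m g, mnorm (g - 1%:M) < e,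
    (forall b A, anti_ok k b -> same_parity (fun s => adj b s *m A) (mulmx A) s s' ->
       adj b g *m A *m g = A)
    & (forall c A, auto_ok k c -> same_parity (mulmx^~ A) (fun s => A *m tws c s) s s' ->
       g *m A = A *m tws c g)].
Proof.
move=> ss e e0.
(* [q - 1] bounds the product of the norms of [s] and [h], because [W] will have norm at most 1; the
   added 1 makes [q] positive. *)
set q := mnorm s * (mnorm (1%:M : 'M[K]_n) + 1) + 1.
have q0 : 0 < q by rewrite ltr_wpDl// mulr_ge0 ?addr_ge0 ?mnorm_ge0.
have m0 : 0 < Num.min (e / 2) 1 by rewrite lt_min; apply/andP; split; lra.
have [d0 d00 hd0] := @isqrt_ex R k n _ m0.
exists (Num.min (Num.min d0 1) (e / q)).
  by rewrite !lt_min d00 ltr01 divr_gt0.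
move=> s' ss'; rewrite !lt_min => /andP[/andP[sd0 s1] sq].
pose X := rsc 4^-1 ((s' - s) *m (s' - s)).
have XE : 1%:M - X = rsc 4^-1 (1%:M + 1%:M + (s *m s' + s' *m s)).
  apply/eqP; rewrite subr_eq /X -rscD mulmxBl !mulmxBr ss ss'; apply/eqP.
  have -> : 1%:M + 1%:M + (s *m s' + s' *m s) + (1%:M - s' *m s - (s *m s' - 1%:M)) =
    (1%:M + 1%:M + (1%:M + 1%:M) : 'M[K]_n) by abel.
  by rewrite !rscD -!rscDl -[LHS]rsc1; congr rsc; lra.
have [W [Wr WX hW]] : exists W, [/\ mnorm W <= Num.min (e / 2) 1,
    (1%:M + W) *m (1%:M + W) *m (1%:M - X) = 1%:M
    & forall E : set 'M[K]_n, E 0 -> (forall W, E W -> E (isqrt_step X W)) -> lim_closed E -> E W].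
  apply: hd0; apply: le_lt_trans (mnorm_rsc _ _) _; rewrite ger0_norm ?invr_ge0//.
  have := mnormM (s' - s) (s' - s); have := mnorm_ge0 (s' - s).
  set t := mnorm (s' - s) in sd0 s1 *; set y := mnorm (_ *m _) => t0 yt.
  have : t * t <= 1 * t by rewrite ler_wpM2r// ltW.
  lra.
set h := 1%:M + W in WX.
(* [g1] is [g0] with the involutions exchanged. Both products of [g0] and [g1] equal 1 - X, and [h]
   is its inverse square root; hence g0 h is invertible with inverse h g1. *)
pose g0 := rsc 2^-1 (1%:M + s' *m s); pose g1 := rsc 2^-1 (1%:M + s *m s').
have e4 : 2^-1 * 2^-1 = 4^-1 :> R by lra.
have g10 : g1 *m g0 = 1%:M - X.
  rewrite /g1 /g0 rscAl rscAr rscM e4 XE; congr rsc.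
  rewrite mulmxDl mulmxDr !mulmx1 mul1mx mulmxDr mulmx1 !mulmxA -(mulmxA s) ss' mulmx1 ss.
  abel.
have g01 : g0 *m g1 = 1%:M - X.
  rewrite /g1 /g0 rscAl rscAr rscM e4 XE; congr rsc.
  rewrite mulmxDl mulmxDr !mulmx1 mul1mx mulmxDr mulmx1 !mulmxA -(mulmxA s') ss mulmx1 ss'.
  abel.
have commW t : t *m X = X *m t -> t *m W = W *m t.
  move=> tX.
  have WXc : forall V, V *m X = X *m V -> V *m V *m X = X *m (V *m V).
    by move=> V VX; rewrite -mulmxA VX mulmxA VX mulmxA.
  apply: (hW [set W | t *m W = W *m t]).
  - by rewrite /= mul0mx mulmx0.
  - move=> V /= VX; rewrite /isqrt_step rscAl rscAr; congr rsc.
    have VV : t *m (V *m V) = V *m V *m t by rewrite mulmxA VX -mulmxA VX mulmxA.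
    rewrite mulmxDr [RHS]mulmxDl mulmxBr [in RHS]mulmxBl VV tX; congr (_ + _).
    by rewrite -[RHS]mulmxA -tX !mulmxA; congr (_ *m X); rewrite !mulmxDl !mulmxDr VX VV.
  - by apply: lim_closed_eq; [exact: lipschitz_mull|exact: lipschitz_mulr].
have commh t : t *m X = X *m t -> t *m h = h *m t.
  by move/commW => tW; rewrite /h mulmxDr mulmxDl mul1mx mulmx1 tW.
set Z := s *m s' + s' *m s in XE.
have XZ : X = 1%:M - rsc 4^-1 (1%:M + 1%:M + Z) by rewrite -XE; abel.
have sX : s *m X = X *m s.
  rewrite XZ mulmxBr mulmxBl mulmx1 mul1mx rscAl rscAr; congr (_ - rsc _ _).
  rewrite mulmxDr [RHS]mulmxDl; congr (_ + _).
    by rewrite mulmxDr mulmxDl mulmx1 mul1mx.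
  by rewrite mulmxDr mulmxDl !mulmxA ss mul1mx -[in RHS](mulmxA s') ss mulmx1 addrC.
have s'X : s' *m X = X *m s'.
  rewrite XZ mulmxBr mulmxBl mulmx1 mul1mx rscAl rscAr; congr (_ - rsc _ _).
  rewrite mulmxDr [RHS]mulmxDl; congr (_ + _).
    by rewrite mulmxDr mulmxDl mulmx1 mul1mx.
  by rewrite mulmxDr mulmxDl !mulmxA ss' mul1mx -[in RHS](mulmxA s) ss' mulmx1 addrC.
have WXc : W *m X = X *m W by rewrite commW.
have XX : X *m h = h *m X by exact: commh.
have YY : (1%:M - X) *m h = h *m (1%:M - X).
  by rewrite mulmxBl mulmxBr XX mul1mx mulmx1.
have hYh : h *m (1%:M - X) *m h = 1%:M by rewrite -mulmxA YY mulmxA.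
have g0h : g0 *m h = h *m g0.
  apply: commh; rewrite /g0 [LHS]rscAl [RHS]rscAr; congr rsc.
  by rewrite mulmxDl mulmxDr mul1mx mulmx1 -mulmxA sX !mulmxA s'X.
exists (g0 *m h), (h *m g1); split.
- split; first by rewrite mulmxA -(mulmxA h) g10.
  by rewrite g0h mulmxA -(mulmxA h) g0h mulmxA -mulmxA g01 WX.
- rewrite -mulmxA -commh// !mulmxA; congr (_ *m h).
  by rewrite rscAl rscAr; congr rsc; rewrite mulmxDl mulmxDr mul1mx mulmx1 -mulmxA ss mulmxA ss'
    mul1mx mulmx1 addrC.
- have -> : g0 *m h - 1%:M = (g0 - 1%:M) *m h + W.
    by rewrite mulmxBl mul1mx /h; abel.
  have -> : g0 - 1%:M = rsc 2^-1 ((s' - s) *m s).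
    have h2 : 1%:M = rsc 2^-1 1%:M + rsc 2^-1 1%:M :> 'M[K]_n.
      by rewrite -rscDl -[LHS]rsc1; congr rsc; lra.
    rewrite /g0 mulmxBl ss !rscD rscN [X in _ - X]h2; abel.
  apply: le_lt_trans (mnormD _ _) _.
  move: Wr; rewrite le_min => /andP[W2 W1].
  have hn : mnorm h <= mnorm (1%:M : 'M[K]_n) + 1.
    by apply: le_trans (mnormD _ _) _; rewrite lerD2l.
  have : mnorm (rsc 2^-1 ((s' - s) *m s) *m h) <= 2^-1 * (mnorm (s' - s) * (q - 1)).
    apply: le_trans (mnormM _ _) _.
    apply: (@le_trans _ _ (2^-1 * (mnorm (s' - s) * mnorm s) * mnorm h)).
      rewrite ler_wpM2r ?mnorm_ge0//; apply: le_trans (mnorm_rsc _ _) _.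
      by rewrite ger0_norm ?invr_ge0// ler_wpM2l ?invr_ge0// mnormM.
    rewrite -!mulrA ler_wpM2l ?invr_ge0// ler_wpM2l ?mnorm_ge0// /q addrK.
    by rewrite ler_wpM2l ?mnorm_ge0.
  move: sq; rewrite ltr_pdivlMr// => sq; have := mnorm_ge0 (s' - s).
  by rewrite mulrBr mulr1; lra.
- move=> b A ok hs.
  have hss' : adj b (s *m s') *m A = A *m (s' *m s).
    by rewrite adjM// -mulmxA; case: hs => -[h1 h2];
      rewrite /= h1 ?mulmxN (mulmxA _ A) /= h2 ?mulNmx ?opprK mulmxA.
  have hs's : adj b (s' *m s) *m A = A *m (s *m s').
    by rewrite adjM// -mulmxA; case: hs => -[h1 h2];
      rewrite /= h2 ?mulmxN (mulmxA _ A) /= h1 ?mulNmx ?opprK mulmxA.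
  have hX : adj b X *m A = A *m X.
    rewrite XZ adjD adjN adjmx1 adj_rsc mulmxBl mulmxBr mul1mx mulmx1 rscAl rscAr.
    congr (_ - rsc _ _); rewrite /Z !adjD adjmx1 !mulmxDl !mulmxDr hss' hs's mul1mx mulmx1.
    by rewrite [X in _ + X]addrC.
  have hg0 : adj b g0 *m A = A *m g1.
    rewrite adj_rsc rscAl rscAr; congr rsc.
    by rewrite adjD adjmx1 mulmxDl mulmxDr mul1mx mulmx1 hs's.
  (* Commutation with [X] is carried through the induction because [adj] reverses the product that
     occurs in [isqrt_step]. *)
  have [_ hWA] : W *m X = X *m W /\ adj b W *m A = A *m W.
    apply: (hW [set V | V *m X = X *m V /\ adj b V *m A = A *m V]).
    - by rewrite /= adj0 !mul0mx !mulmx0.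
    - move=> V /= [VX VA].
      have VVX : V *m V *m X = X *m (V *m V) by rewrite -mulmxA VX mulmxA VX mulmxA.
      split.
        rewrite /isqrt_step rscAl rscAr; congr rsc.
        rewrite mulmxDl [RHS]mulmxDr mulmxBl [in RHS]mulmxBr VVX; congr (_ + _).
        by rewrite [RHS]mulmxA; congr (_ *m X); rewrite !mulmxDl !mulmxDr VX VVX.
      rewrite /isqrt_step adj_rsc rscAl rscAr; congr rsc.
      have VV : adj b (V *m V) *m A = A *m (V *m V).
        by rewrite adjM// -mulmxA VA mulmxA VA mulmxA.
      have VS : adj b (V + V + V *m V) *m A = A *m (V + V + V *m V).
        by rewrite !adjD !mulmxDl VA VV !mulmxDr.
      have XS : X *m (V + V + V *m V) = (V + V + V *m V) *m X.
        by rewrite !mulmxDl !mulmxDr VX VVX.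
      rewrite adjD mulmxDl mulmxDr; congr (_ + _).
        by rewrite adjD adjN mulmxBl mulmxBr hX VV.
      by rewrite adjM// -mulmxA VS mulmxA hX -mulmxA XS.
    - change (lim_closed ([set V | V *m X = X *m V] `&` [set V | adj b V *m A = A *m V])).
      refine (lim_closedI _ _); apply: lim_closed_eq; try exact: lipschitz_mull; try exact: lipschitz_mulr.
      exact: (lipschitz_comp (lipschitz_adj R k n n b) (lipschitz_mulr n A)).
  have hh : adj b h *m A = A *m h by rewrite adjD adjmx1 mulmxDl mulmxDr mul1mx mulmx1 hWA.
  rewrite adjM// -(mulmxA _ _ A) hg0 -!mulmxA (mulmxA g1) g10 mulmxA hh -mulmxA (mulmxA h) hYh.
  by rewrite mulmx1.
- move=> c A ok hs.
  have hss' : (s *m s') *m A = A *m tws c (s *m s').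
    by rewrite twsM// -mulmxA; case: hs => -[h1 h2];
      rewrite /= h2 ?mulmxN (mulmxA _ A) /= h1 ?mulNmx ?opprK mulmxA.
  have hs's : (s' *m s) *m A = A *m tws c (s' *m s).
    by rewrite twsM// -mulmxA; case: hs => -[h1 h2];
      rewrite /= h1 ?mulmxN (mulmxA _ A) /= h2 ?mulNmx ?opprK mulmxA.
  have hX : X *m A = A *m tws c X.
    rewrite XZ twsD twsN tws1 tws_rsc mulmxBl mulmxBr mul1mx mulmx1 rscAl rscAr.
    by congr (_ - rsc _ _); rewrite /Z !twsD tws1 !mulmxDl !mulmxDr hss' hs's mul1mx mulmx1.
  have hg0 : g0 *m A = A *m tws c g0.
    rewrite tws_rsc rscAl rscAr; congr rsc.
    by rewrite twsD tws1 mulmxDl mulmxDr mul1mx mulmx1 hs's.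
  have hWA : W *m A = A *m tws c W.
    apply: (hW [set V | V *m A = A *m tws c V]).
    - by rewrite /= tws0 mul0mx mulmx0.
    - move=> V /= VA; rewrite /isqrt_step tws_rsc rscAl rscAr; congr rsc.
      have VV : (V *m V) *m A = A *m tws c (V *m V).
        by rewrite twsM// -mulmxA VA mulmxA VA mulmxA.
      rewrite !(twsD, twsN, twsM _ X ok) mulmxDl [RHS]mulmxDr mulmxBl [in RHS]mulmxBr hX VV.
      congr (_ + _); rewrite -mulmxA hX !mulmxA; congr (_ *m _).
      by rewrite !mulmxDl !mulmxDr VA VV.
    - apply: lim_closed_eq; first exact: lipschitz_mulr.
      exact: (lipschitz_comp (lipschitz_tws R k n n c) (lipschitz_mull n A)).
  have hh : h *m A = A *m tws c h by rewrite twsD tws1 mulmxDl mulmxDr mul1mx mulmx1 hWA.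
  by rewrite twsM// -mulmxA hh mulmxA hg0 mulmxA.
Qed.
End DirectRotation.

Lemma small_mul (R : realType) (C e : R) : 0 <= C -> 0 < e ->
  exists2 d : R, 0 < d & forall x, 0 <= x -> x < d -> C * x < e.
Proof.
move=> C0 e0; have C1 : 0 < C + 1 by lra.
exists (e / (C + 1)); first by rewrite divr_gt0.
by move=> x x0; rewrite ltr_pdivlMr// => h; rewrite mulrC; lra.
Qed.

Lemma min_gt0 (R : realType) (a b : R) : 0 < a -> 0 < b ->
  exists2 c : R, 0 < c & forall x, x < c -> x < a /\ x < b.
Proof.
move=> a0 b0; exists (Num.min a b); first by rewrite lt_min a0.
by move=> x; rewrite lt_min => /andP.
Qed.

(** * Subspaces, frames and charts of the Grassmannians *)

Section Subspaces.
Variables (R : realType) (k : scalars).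
Local Notation K := (scal R k).

Lemma subsp_ext n (P Q : subsp K n) : (forall v, subsp_set P v <-> subsp_set Q v) -> P = Q.
Proof.
case: P Q => [P P0 PD PZ] [Q Q0 QD QZ] /= h.
have e : P = Q by apply/seteqP; split => v /h.
by subst; congr Subsp; exact: Prop_irrelevance.
Qed.

Lemma colspanP n r (F : 'M[K]_(n, r)) v : subsp_set (colspan F) v <-> exists z, F *m z = v.
Proof. by split=> [[z _ <-]|[z <-]]; [exists z|exists z]. Qed.

Lemma colspan_mul n r s (F : 'M[K]_(n, r)) (C : 'M[K]_(r, s)) (D : 'M[K]_(s, r)) :
  C *m D = 1%:M -> colspan (F *m C) = colspan F.
Proof.
move=> CD; apply: subsp_ext => v; split => /colspanP [z <-]; apply/colspanP.
  by exists (C *m z); rewrite mulmxA.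
by exists (D *m z); rewrite mulmxA -(mulmxA F) CD mulmx1.
Qed.

Lemma mximage_colspan n r (g : 'M[K]_n) (F : 'M[K]_(n, r)) :
  mximage g (colspan F) = colspan (g *m F).
Proof.
apply: subsp_ext => v; split.
  by move=> [x /colspanP[z <-] <-]; apply/colspanP; exists z; rewrite mulmxA.
move=> /colspanP[z <-]; exists (F *m z); last by rewrite mulmxA.
by apply/colspanP; exists z.
Qed.

Lemma colspan_sub n r s (F : 'M[K]_(n, r)) (F' : 'M[K]_(n, s)) :
  (forall v, subsp_set (colspan F) v -> subsp_set (colspan F') v) -> exists X, F = F' *m X.
Proof.
move=> h; apply: mulmx_factor => v.
have /h/colspanP[z hz] : subsp_set (colspan F) (F *m v) by apply/colspanP; exists v.
by exists z.
Qed.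

Lemma frames_linv n r (F : 'M[K]_(n, r)) : frames F <-> exists L, L *m F = 1%:M.
Proof.
split => [inj|[L LF] x y h].
  by apply: inj_linv => z Fz; apply: inj; rewrite Fz mulmx0.
by rewrite -[x]mul1mx -LF -mulmxA h mulmxA LF mul1mx.
Qed.

Lemma subsp_frame n (Q : subsp K n) :
  exists r (F : 'M[K]_(n, r)) (L : 'M[K]_(r, n)), L *m F = 1%:M /\ Q = colspan F.
Proof.
have [r [F [L [LF h]]]] := module_basis (subsp0 Q) (@subspD _ _ Q) (@subspZ _ _ Q).
by exists r, F, L; split=> //; apply: subsp_ext => v; rewrite h colspanP.
Qed.

Lemma mximageM n (g h : 'M[K]_n) (P : subsp K n) : mximage (g *m h) P = mximage g (mximage h P).
Proof.
apply: subsp_ext => v; split.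
  by move=> [x Px <-]; exists (h *m x); [exists x|rewrite mulmxA].
by move=> [_ [x Px <-] <-]; exists x => //; rewrite mulmxA.
Qed.

Lemma mximage1 n (P : subsp K n) : mximage 1%:M P = P.
Proof.
apply: subsp_ext => v; split; first by move=> [x Px <-]; rewrite mul1mx.
by move=> Pv; exists v => //; rewrite mul1mx.
Qed.

Lemma actM n (g h : 'M[K]_n) s : act (g *m h) s = act g (act h s).
Proof. by rewrite /act !mximageM. Qed.

Lemma act1 n (s : subsp K n * subsp K n) : act 1%:M s = s.
Proof. by case: s => P Q; rewrite /act !mximage1. Qed.

(** Applied to X = 1 - A, the square root lemma gives (1 + W)^2 A = 1, so the inverse is (1 + W)^2
    and is close to 1 with [W]. *)
Lemma near_inv n (e : R) : 0 < e -> exists2 d : R, 0 < d & forall A : 'M[K]_n,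
  mnorm (A - 1%:M) < d -> exists Ai, [/\ Ai *m A = 1%:M, A *m Ai = 1%:M & mnorm (Ai - 1%:M) < e].
Proof.
move=> e0; have m0 : 0 < Num.min (e / 4) 1 by rewrite lt_min; apply/andP; split; lra.
have [d d0 hd] := @isqrt_ex R k n _ m0; exists d => // A hA.
have [|W []] := hd (1%:M - A); first by rewrite mnormBC.
have -> : 1%:M - (1%:M - A) = A by abel.
rewrite le_min => /andP[W4 W1] WA _.
exists ((1%:M + W) *m (1%:M + W)); split=> //; first exact: linv_inv2.
have -> : (1%:M + W) *m (1%:M + W) - 1%:M = W + W + W *m W.
  rewrite mulmxDl mul1mx mulmxDr mulmx1; abel.
have hW : mnorm (W *m W) <= 1 * mnorm W.
  by apply: le_trans (mnormM _ _) _; rewrite ler_wpM2r ?mnorm_ge0.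
have := mnormD (W + W) (W *m W); have := mnormD W W; lra.
Qed.

(** A subspace has at most one frame with L F' = 1, since two frames with r columns differ by an
    invertible factor. The normalisation thus turns the distance of matrices into one of
    subspaces. *)
Definition chart n r (F : 'M[K]_(n, r)) (L : 'M[K]_(r, n)) (d : R) : set (subsp K n) :=
  [set Q | exists F', [/\ L *m F' = 1%:M, mnorm (F' - F) < d & Q = colspan F']].

Lemma subsp_openP n (U : set (subsp K n)) :
  (forall r (F : 'M[K]_(n, r)), frames F -> U (colspan F) ->
    exists2 e : R, 0 < e & forall F', frames F' -> mnorm (F' - F) < e -> U (colspan F')) <->
  open U.
Proof.
split.
  move=> h; suff : subsp_open U by []; move=> r.
  apply/open_subspace_nbhs => F fF UF; apply/mnbhs.
  by have [e e0 he] := h _ _ fF UF; exists e => // F' hF' fF'; exact: he.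
move=> oU r F fF UF; have oU' : subsp_open U by exact: oU. clear oU; rename oU' into oU.
have /open_subspace_nbhs/(_ F fF UF)/mnbhs[e e0 he] := oU r.
by exists e => // F' fF' hF'; exact: he.
Qed.

Lemma chart_open n r (F : 'M[K]_(n, r)) (L : 'M[K]_(r, n)) d : open (chart F L d).
Proof.
apply/subsp_openP => s H /frames_linv[M MH] [F' [LF' hF' HF']].
have [C HC] : exists C, H = F' *m C.
  by apply: colspan_sub => v; rewrite -HF'.
have [Y FY] : exists Y, F' = H *m Y.
  by apply: colspan_sub => v; rewrite HF'.
have CL : C = L *m H by rewrite HC mulmxA LF' mul1mx.
have CY : C *m Y = 1%:M by rewrite CL -mulmxA -FY.
have YC : Y *m C = 1%:M.
  by rewrite -[Y]mul1mx -MH -(mulmxA M) -FY -mulmxA -HC.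
set r0 := d - mnorm (F' - F); have r00 : 0 < r0 by rewrite subr_gt0.
have YHn : 0 <= mnorm H * mnorm Y by rewrite mulr_ge0 ?mnorm_ge0.
have YHn' : 0 <= (mnorm (1%:M : 'M[K]_s) + 1) * mnorm Y by rewrite mulr_ge0 ?addr_ge0 ?mnorm_ge0.
have [e1 e10 he1] := small_mul YHn (divr_gt0 r00 (ltr0Sn R 1)).
have [e2 e20 he2] := small_mul YHn' (divr_gt0 r00 (ltr0Sn R 1)).
have [e3 e30 he3] := min_gt0 e10 ltr01.
have [d1 d10 hd1] := near_inv s e30.
have [e4 e40 he4] := small_mul (mnorm_ge0 (Y *m L)) d10.
have [e e0 he] := min_gt0 e20 e40.
exists e => // H2 fH2 /he[h2 h4].
have [|Ai [AiA AAi hAi]] := hd1 (Y *m L *m H2).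
  rewrite -YC CL !mulmxA -mulmxBr; apply: le_lt_trans (mnormM _ _) _.
  by apply: he4; rewrite ?mnorm_ge0.
have [h5 h6] := he3 _ hAi.
(* [Y] is inverse to C = L H. For [H2] near [H] the matrix [Y *m L *m H2] is near 1, and its inverse
   [Ai] renormalises [H2] to the frame demanded by the chart. *)
exists (H2 *m Ai *m Y); split.
- have -> : L *m (H2 *m Ai *m Y) = C *m ((Y *m L *m H2) *m Ai) *m Y.
    by rewrite !mulmxA CY mul1mx.
  by rewrite AAi mulmx1 CY.
- have -> : H2 *m Ai *m Y - F = ((H2 - H) *m Ai *m Y + H *m (Ai - 1%:M) *m Y) + (F' - F).
    rewrite FY !mulmxBl mulmxBr mulmx1 !mulmxBl; abel.
  apply: le_lt_trans (mnormD _ _) _; rewrite -ltrBrDr -/r0.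
  apply: le_lt_trans (mnormD _ _) _.
  have Ain : mnorm Ai <= mnorm (1%:M : 'M[K]_s) + 1.
    rewrite -[Ai](subrK 1%:M) addrC; apply: le_trans (mnormD _ _) _; rewrite lerD2l; exact: ltW.
  have : mnorm ((H2 - H) *m Ai *m Y) < r0 / 2.
    apply: le_lt_trans (he2 _ (mnorm_ge0 _) h2); apply: le_trans (mnormM _ _) _.
    rewrite mulrAC ler_wpM2r ?mnorm_ge0//; apply: le_trans (mnormM _ _) _.
    by rewrite mulrC ler_wpM2r ?mnorm_ge0.
  have : mnorm (H *m (Ai - 1%:M) *m Y) < r0 / 2.
    apply: le_lt_trans (he1 _ (mnorm_ge0 _) h5); apply: le_trans (mnormM _ _) _.
    by rewrite mulrAC ler_wpM2r ?mnorm_ge0// mnormM.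
  lra.
- rewrite -mulmxA; apply/esym/(@colspan_mul _ _ _ _ _ (C *m (Y *m L *m H2))).
  by rewrite mulmxA -(mulmxA Ai) YC mulmx1 AiA.
Qed.

Lemma chart_center n r (F : 'M[K]_(n, r)) (L : 'M[K]_(r, n)) d : 0 < d ->
  L *m F = 1%:M -> chart F L d (colspan F).
Proof. by move=> d0 LF; exists F; rewrite subrr mnorm0. Qed.

Lemma colspan_act_cont n (Q : subsp K n) (U : set (subsp K n)) : open U -> U Q ->
  exists2 e : R, 0 < e & forall g, GL n g -> mnorm (g - 1%:M) < e -> U (mximage g Q).
Proof.
move=> /subsp_openP oU UQ; have [r [F [L [LF QF]]]] := subsp_frame Q.
rewrite {}QF in UQ *; have fF : frames F by apply/frames_linv; exists L.
have [e e0 he] := oU _ _ fF UQ.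
have [d d0 hd] := small_mul (mnorm_ge0 F) e0.
exists d => // g [h [gh hg]] hgn; rewrite mximage_colspan; apply: he.
  by apply/frames_linv; exists (L *m h); rewrite mulmxA -(mulmxA L) hg mulmx1.
rewrite -{2}[F]mul1mx -mulmxBl; apply: le_lt_trans (mnormM _ _) _.
by rewrite mulrC; apply: hd; rewrite ?mnorm_ge0.
Qed.

End Subspaces.

(** * Open embeddings of homogeneous spaces *)

Section OpenRealization.
Variables (R : realType) (k : scalars) (n : nat) (T : topologicalType).
Local Notation K := (scal R k).
Variables (G : set 'M[K]_n) (S : set (subsp K n * subsp K n)) (Grs : set T).
Variable iota : subsp K n * subsp K n -> T.
Hypothesis G1 : G 1%:M.
Hypothesis GM : forall g h, G g -> G h -> G (g *m h).
Hypothesis GV : forall g, G g -> exists h, [/\ G h, g *m h = 1%:M & h *m g = 1%:M].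
Hypothesis GS : forall g s, G g -> S s -> S (act g s).
Hypothesis iotaS : forall s, S s -> Grs (iota s).
Hypothesis iota_inj : forall s s', S s -> S s' -> iota s = iota s' -> s = s'.
Hypothesis iota_cont : forall s, S s -> forall W, open W -> W (iota s) ->
  exists2 e : R, 0 < e & forall g, G g -> mnorm (g - 1%:M) < e -> W (iota (act g s)).
Hypothesis iota_lt : forall s, S s -> forall e : R, 0 < e ->
  exists W, [/\ open W, W (iota s) & forall q, W q -> Grs q ->
    exists g, [/\ G g, mnorm (g - 1%:M) < e & iota (act g s) = q]].

(** Writing g = (g g0^-1) g0 moves a neighbourhood of [g0] in G to one of 1, so the orbit maps need
    to be tested only at 1. *)
Lemma hspace_openP (U : set (hspace G)) :
  (forall s, U s -> exists2 e : R, 0 < e & forall g, G g -> mnorm (g - 1%:M) < e -> U (act g s)) <->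
  open U.
Proof.
split => [h|oU s Us]; last first.
  have oU' : hspace_open U by exact: oU. clear oU; rename oU' into oU.
  have /open_subspace_nbhs/(_ 1%:M G1) := oU s; rewrite /= act1 => /(_ Us)/mnbhs[e e0 he].
  by exists e => // g Gg hg; exact: he.
suff : hspace_open U by []; move=> s.
apply/open_subspace_nbhs => g0 Gg0 /= /h[e e0 he]; apply/mnbhs.
have [h0 [Gh0 gh hg]] := GV Gg0.
have [d d0 hd] := small_mul (mnorm_ge0 h0) e0.
exists d => // g hgn Gg /=.
have -> : g = g *m h0 *m g0 by rewrite -mulmxA hg mulmx1.
rewrite actM; apply: he; first exact: GM.
rewrite -gh -mulmxBl; apply: le_lt_trans (mnormM _ _) _.
by rewrite mulrC; apply: hd; rewrite ?mnorm_ge0.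
Qed.

(** By [iota_lt] the points of [Grs] near [iota s] are images of translates of [s] by small elements
    of G, and [U] is stable under these. *)
Lemma open_image (U : set (subsp K n * subsp K n)) : U `<=` S ->
  (forall s, U s -> exists2 e : R, 0 < e & forall g, G g -> mnorm (g - 1%:M) < e -> U (act g s)) ->
  open (iota @` U : set (subspace Grs)).
Proof.
move=> US h; apply/open_subspace_nbhs => q Gq [s Us sq].
have [e e0 he] := h _ Us.
have [W [oO Os hO]] := iota_lt (US _ Us) e0; rewrite -sq.
have : nbhs (iota s) W by apply: open_nbhs_nbhs.
apply: filterS => q' Oq' Gq'; have [g [Gg hg <-]] := hO _ Oq' Gq'.
by exists (act g s) => //; exact: he.
Qed.

Lemma orbit_sub (s : subsp K n * subsp K n) : S s -> Defs.orbit G s `<=` S.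
Proof. by move=> Ss _ [g Gg <-]; exact: GS. Qed.

Lemma orbit_open (s : subsp K n * subsp K n) : S s -> open (iota @` Defs.orbit G s : set (subspace Grs)).
Proof.
move=> Ss; apply: open_image; first exact: orbit_sub.
move=> _ [g Gg <-]; exists 1 => // h Gh _; exists (h *m g); first exact: GM.
by rewrite actM.
Qed.

Lemma orbit_embedding : @open_embedding (hspace G) T S Grs iota.
Proof.
split.
- by move=> _ [s Ss <-]; exact: iotaS.
- by move=> s s' /set_mem Ss /set_mem Ss'; exact: iota_inj.
- apply/continuousP => W oO; apply/open_subspace_nbhs => s Ss Os.
  have : nbhs (s : hspace G) [set y | S y /\ W (iota y)].
    apply: open_nbhs_nbhs; split => //; apply/hspace_openP => s' [Ss' Os'].
    have [e e0 he] := iota_cont Ss' oO Os'.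
    by exists e => // g Gg hg; split; [exact: GS|exact: he].
  by apply: filterS => y [_ Wy] _.
- move=> U US oU; apply: open_image => // s Us.
  have /open_subspace_nbhs/(_ s (US _ Us) Us) := oU.
  rewrite nbhsE => -[V [oV Vs] VU].
  have [e e0 he] := (hspace_openP V).2 oV s Vs.
  by exists e => // g Gg hg; apply: VU; [exact: he|exact: GS (US _ Us)].
Qed.

Lemma orbit_meet (s s' : subsp K n * subsp K n) : S s -> S s' -> Grs `<=` closure (iota @` Defs.orbit G s) ->
  exists2 g, G g & act g s = s'.
Proof.
move=> Ss Ss' hd.
have Gs' : (iota @` Defs.orbit G s') (iota s') by exists s' => //; exists 1%:M => //; exact: act1.
have /open_subspace_nbhs/(_ _ (iotaS Ss') Gs') hn := orbit_open Ss'.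
have [_ [[_ [g Gg <-] <-]]] := hd _ (iotaS Ss') _ hn.
move=> /(_ (iotaS (GS Gg Ss))) [_ [g' Gg' <-] /iota_inj].
move=> /(_ (GS Gg' Ss') (GS Gg Ss)) e; have [h [Gh gh hg]] := GV Gg'.
by exists (h *m g); [exact: GM|rewrite actM -e -actM hg act1].
Qed.

End OpenRealization.

Lemma adj_sandwich (R : realType) (k : scalars) b m n p q r s (A : 'M[scal R k]_(n, p))
  (U : 'M[scal R k]_(n, q)) (V : 'M[scal R k]_(q, r)) (W : 'M[scal R k]_(p, s))
  (Z : 'M[scal R k]_(s, m)) : anti_ok k b ->
  adj b (U *m V) *m A *m (W *m Z) = adj b V *m (adj b U *m A *m W) *m Z.
Proof. by move=> ok; rewrite adjM// !mulmxA. Qed.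

Section LocalRotation.
Variables (R : realType) (k : scalars) (n : nat).
Local Notation K := (scal R k).
Implicit Types P T A : 'M[K]_n.

Definition reflection P : 'M[K]_n := P + P - 1%:M.

Lemma reflectionK P : P *m P = P -> reflection P *m reflection P = 1%:M.
Proof.
move=> PP; rewrite /reflection mulmxBl !mulmxBr !mulmxDl !mulmxDr !mulmx1 !mul1mx PP; abel.
Qed.

(** [A] pairs the image of [P] with that of [Q] only, so the reflection reverses the form. For
    orthogonal summands it preserves the form instead; these are the two cases of [same_parity]. *)
Lemma isotropic_parity b A P Q : P + Q = 1%:M ->
  adj b P *m A *m P = 0 -> adj b Q *m A *m Q = 0 ->
  adj b (reflection P) *m A = - (A *m reflection P).
Proof.
move=> PQ hP hQ; have QE : Q = 1%:M - P by rewrite -PQ; abel.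
have hPA : adj b P *m A = A *m Q.
  transitivity (adj b P *m A *m Q).
    by rewrite -[LHS]mulmx1 -PQ mulmxDr hP add0r.
  have -> : A *m Q = (adj b (P + Q)) *m (A *m Q) by rewrite PQ adjmx1 mul1mx.
  by rewrite adjD mulmxDl !mulmxA hQ addr0.
rewrite /reflection adjD adjN adjD adjmx1 mulmxBl mulmxDl mul1mx hPA QE !mulmxBr !mulmxDr mulmx1.
abel.
Qed.

Lemma orthogonal_parity b A P Q : P + Q = 1%:M ->
  adj b Q *m A *m P = 0 -> adj b P *m A *m Q = 0 ->
  adj b (reflection P) *m A = A *m reflection P.
Proof.
move=> PQ hP hQ.
have hPA : adj b P *m A = A *m P.
  transitivity (adj b P *m A *m P).
    by rewrite -[LHS]mulmx1 -PQ mulmxDr hQ addr0.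
  have -> : A *m P = (adj b (P + Q)) *m (A *m P) by rewrite PQ adjmx1 mul1mx.
  by rewrite adjD mulmxDl !mulmxA hP addr0.
by rewrite /reflection adjD adjN adjD adjmx1 mulmxBl mulmxDl mul1mx hPA mulmxBr mulmxDr mulmx1.
Qed.

(** The operator exchanges the two summands, on which the reflection is 1 and -1, and therefore
    anticommutes with it. *)
Lemma swap_parity c A P Q : P + Q = 1%:M -> A *m tws c P = Q *m A ->
  reflection P *m A = - (A *m tws c (reflection P)).
Proof.
move=> PQ hP; have QE : Q = 1%:M - P by rewrite -PQ; abel.
rewrite /reflection twsD twsN twsD tws1 mulmxBr mulmxDr mulmx1 hP QE !mulmxBl !mulmxDl mul1mx.
abel.
Qed.

(** [T1] and [T2] map the old summands to the new ones but need not be idempotent. Conjugating [P]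
    by the invertible matrix T1 + T2 gives an idempotent [P'] with the new images. The conditions
    are stated for [T1] and [T2] because these are explicit; they pass to [P'] and [Q'], which
    differ only by the right factor [ai]. *)
Lemma local_rotation P : P *m P = P -> forall e : R, 0 < e ->
  exists2 d : R, 0 < d & forall T1 T2, T1 *m P = T1 -> T2 *m P = 0 ->
  mnorm (T1 - P) < d -> mnorm (T2 - (1%:M - P)) < d ->
  exists g, [/\ GL n g, mnorm (g - 1%:M) < e,
    mximage g (colspan P) = colspan T1 /\ mximage g (colspan (1%:M - P)) = colspan T2,
    (forall b A, anti_ok k b ->
       [/\ adj b P *m A *m P = 0, adj b (1%:M - P) *m A *m (1%:M - P) = 0,
           adj b T1 *m A *m T1 = 0 & adj b T2 *m A *m T2 = 0] \/
       [/\ adj b (1%:M - P) *m A *m P = 0, adj b P *m A *m (1%:M - P) = 0,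
           adj b T2 *m A *m T1 = 0 & adj b T1 *m A *m T2 = 0] ->
       adj b g *m A *m g = A)
    & (forall c A, auto_ok k c -> A *m tws c P = (1%:M - P) *m A ->
       A *m tws c T1 = T2 *m A -> A *m tws c T2 = T1 *m A ->
       g *m A = A *m tws c g)].
Proof.
move=> PP e e0.
have [d0 d00 hd0] := direct_rotation (reflectionK PP) e0.
have Pn : 0 <= mnorm P * 2 by rewrite mulr_ge0 ?mnorm_ge0.
have q1 : 0 < d0 / 4 by lra.
have [e1 e10 he1] := small_mul Pn q1.
have [e2 e20 he2] := min_gt0 e10 ltr01.
have [d1 d10 hd1] := near_inv k n e20.
have I1 : 0 <= mnorm (1%:M : 'M[K]_n) + 1 by rewrite addr_ge0// mnorm_ge0.
have q2 : 0 < d0 / 8 by lra.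
have [d2 d20 hd2] := small_mul I1 q2.
have q3 : 0 < d1 / 2 by lra.
have [d3 d30 hd3] := min_gt0 d20 q3.
exists d3 => // T1 T2 T1P T2P /hd3[hT1 hT1'] /hd3[hT2 hT2'].
have [|ai [aia aai hai]] := hd1 (T1 + T2).
  have -> : T1 + T2 - 1%:M = (T1 - P) + (T2 - (1%:M - P)) by abel.
  apply: le_lt_trans (mnormD _ _) _; lra.
have [hai1 hai2] := he2 _ hai.
pose P' := T1 *m ai; pose Q' := T2 *m ai.
have PQ' : P' + Q' = 1%:M by rewrite -mulmxDl aai.
have aP : (T1 + T2) *m P = T1 by rewrite mulmxDl T1P T2P addr0.
have PPai : ai *m T1 = P *m ai *m (T1 + T2).
  by rewrite -mulmxA aia mulmx1 -aP mulmxA aia mul1mx.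
have P'E : P' = (T1 + T2) *m P *m ai by rewrite aP.
have P'P' : P' *m P' = P'.
  by rewrite P'E -!mulmxA (mulmxA ai) aia mul1mx (mulmxA P) PP.
have ain : mnorm ai <= mnorm (1%:M : 'M[K]_n) + 1.
  rewrite -[ai](subrK 1%:M) addrC; apply: le_trans (mnormD _ _) _; rewrite lerD2l; exact: ltW.
have P'n : mnorm (P' - P) < d0 / 2.
  have -> : P' - P = (T1 - P) *m ai + P *m (ai - 1%:M).
    by rewrite mulmxBl mulmxBr mulmx1 /P'; abel.
  apply: le_lt_trans (mnormD _ _) _.
  have : mnorm ((T1 - P) *m ai) < d0 / 8.
    apply: le_lt_trans (hd2 _ (mnorm_ge0 _) hT1); apply: le_trans (mnormM _ _) _.
    by rewrite mulrC ler_wpM2r ?mnorm_ge0.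
  have : mnorm (P *m (ai - 1%:M)) < d0 / 4.
    apply: le_lt_trans (he1 _ (mnorm_ge0 _) hai1); apply: le_trans (mnormM _ _) _.
    by rewrite ler_wpM2r ?mnorm_ge0// mulr2n mulrDr mulr1 lerDl mnorm_ge0.
  lra.
have [|g [gi [[gig ggi] gs gn hB hJ]]] := hd0 _ (reflectionK P'P').
  have -> : reflection P' - reflection P = (P' - P) + (P' - P) by rewrite /reflection; abel.
  apply: le_lt_trans (mnormD _ _) _; lra.
have gP : g *m P = P' *m g.
  have hh (p : 'M[K]_n) : p = rsc 2^-1 (reflection p + 1%:M).
    by apply: rsc_half; rewrite /reflection; abel.
  rewrite [P in LHS]hh [P' in RHS]hh rscAl rscAr; congr rsc.
  by rewrite mulmxDl mulmxDr mul1mx mulmx1 gs.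
have gQ : g *m (1%:M - P) = Q' *m g.
  have -> : Q' = 1%:M - P' by rewrite -PQ'; abel.
  by rewrite mulmxBl mulmxBr mul1mx mulmx1 gP.
have im (U V T : 'M[K]_n) : V = T *m ai -> g *m U = V *m g -> mximage g (colspan U) = colspan T.
  move=> VE gU; rewrite mximage_colspan gU; rewrite (@colspan_mul _ _ _ _ _ _ _ gi)// VE.
  exact: (@colspan_mul _ _ _ _ _ _ _ (T1 + T2)).
have hBpar b A : adj b T1 *m A *m T1 = 0 -> adj b T2 *m A *m T2 = 0 -> anti_ok k b ->
    adj b P' *m A *m P' = 0 /\ adj b Q' *m A *m Q' = 0.
  move=> h1 h2 ok; split; rewrite adj_sandwich//.
    by rewrite h1 mulmx0 mul0mx.
  by rewrite h2 mulmx0 mul0mx.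
have hOpar b A : adj b T2 *m A *m T1 = 0 -> adj b T1 *m A *m T2 = 0 -> anti_ok k b ->
    adj b Q' *m A *m P' = 0 /\ adj b P' *m A *m Q' = 0.
  move=> h1 h2 ok; split; rewrite adj_sandwich//.
    by rewrite h1 mulmx0 mul0mx.
  by rewrite h2 mulmx0 mul0mx.
have PQ : P + (1%:M - P) = 1%:M by abel.
exists g; split => //; [by exists gi| | |].
- by split; [apply: (im _ P')|apply: (im _ Q')].
- move=> b A ok [] [h1 h2 h3 h4]; apply: hB => //.
    right; have [h5 h6] := hBpar _ _ h3 h4 ok.
    by split; [exact: (isotropic_parity PQ)|exact: (isotropic_parity PQ')].
  left; have [h5 h6] := hOpar _ _ h3 h4 ok.
  by split; [exact: (orthogonal_parity PQ)|exact: (orthogonal_parity PQ')].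
- move=> c A ok h1 h2 h3; apply: hJ => //; right; split.
    exact: (swap_parity PQ).
  apply: (swap_parity PQ').
  (* The operator exchanges [T1] and [T2], so it commutes with their sum and with the inverse [ai]
     of the sum. *)
  have aA : A *m tws c (T1 + T2) = (T1 + T2) *m A.
    by rewrite twsD mulmxDr h2 h3 addrC -mulmxDl addrC.
  have aiA : ai *m A = A *m tws c ai.
    rewrite -[LHS]mulmx1 -(tws1 R k c n) -aai twsM// mulmxA -(mulmxA ai) aA mulmxA aia mul1mx //.
  by rewrite /P' twsM// mulmxA h2 -mulmxA -aiA mulmxA.
Qed.

End LocalRotation.

(** * Forms, operators and decompositions as matrices *)

Section FormMatrices.
Variables (R : realType) (k : scalars).
Local Notation K := (scal R k).

Definition sgm (s : bool) m n (A : 'M[K]_(m, n)) := if s then - A else A.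

Lemma sgmK s m n (A : 'M[K]_(m, n)) : sgm s (sgm s A) = A.
Proof. by case: s; rewrite /= ?opprK. Qed.

Lemma sgm_mull s m n p (A : 'M[K]_(m, n)) (B : 'M[K]_(n, p)) : sgm s A *m B = sgm s (A *m B).
Proof. by case: s; rewrite //= mulNmx. Qed.

Lemma sgm_mulr s m n p (A : 'M[K]_(m, n)) (B : 'M[K]_(n, p)) : A *m sgm s B = sgm s (A *m B).
Proof. by case: s; rewrite //= mulmxN. Qed.

Lemma sgm_tws s c m n (A : 'M[K]_(m, n)) : tws c (sgm s A) = sgm s (tws c A).
Proof. by case: s; rewrite //= twsN. Qed.

Lemma sgm_adj s c m n (A : 'M[K]_(m, n)) : adj c (sgm s A) = sgm s (adj c A).
Proof. by case: s; rewrite //= adjN. Qed.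

Lemma sgm0 s m n : sgm s (0 : 'M[K]_(m, n)) = 0.
Proof. by case: s; rewrite //= oppr0. Qed.

Lemma sgm_addb s t m n (A : 'M[K]_(m, n)) : sgm s (sgm t A) = sgm (s (+) t) A.
Proof. by case: s t => [] []; rewrite /= ?opprK. Qed.

(** The second argument stands on the left: the forms are linear in the first argument, with scalars
    acting on the right, and twisted in the second. *)
Definition mform b n (A : 'M[K]_n) (v w : 'cV[K]_n) : K := (adj b w *m A *m v) 0 0.

Lemma mform_ext b m n (M M' : 'M[K]_(m, n)) :
  (forall (v : 'cV_n) (w : 'cV_m), (adj b w *m M *m v) 0 0 = (adj b w *m M' *m v) 0 0) -> M = M'.
Proof.
move=> h; apply/matrixP => i j; have := h (delta_mx j 0) (delta_mx i 0).
have -> : adj b (delta_mx i 0 : 'cV[K]_m) = delta_mx 0 i.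
  apply/matrixP => x y; rewrite !mxE !ord1 eqxx /= andbT.
  by case: (y == i); rewrite ?tw1 ?tw0.
by rewrite -!colE -!rowE !mxE.
Qed.

Lemma form_mx b n (B : 'cV[K]_n -> 'cV[K]_n -> K) : biadditive B ->
  (forall v w c, B (v *m c%:M) w = B v w * c /\ B v (w *m c%:M) = tw b c * B v w) ->
  exists A : 'M[K]_n, forall v w, B v w = mform b A v w.
Proof.
move=> [Dl Dr] hZ; exists (\matrix_(i, j) B (delta_mx j 0) (delta_mx i 0)) => v w.
have B0l w' : B 0 w' = 0 by apply: (addrI (B 0 w')); rewrite -Dl !addr0.
have B0r v' : B v' 0 = 0 by apply: (addrI (B v' 0)); rewrite -Dr !addr0.
have sl (r : seq 'I_n) F w' : B (\sum_(j <- r) F j) w' = \sum_(j <- r) B (F j) w'.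
  by elim/big_rec2: _ => [|i x y _ <-]; rewrite ?B0l ?Dl.
have sr (r : seq 'I_n) F v' : B v' (\sum_(j <- r) F j) = \sum_(j <- r) B v' (F j).
  by elim/big_rec2: _ => [|i x y _ <-]; rewrite ?B0r ?Dr.
have ex (u : 'cV[K]_n) : u = \sum_j delta_mx j 0 *m (u j 0)%:M.
  rewrite {1}[u]matrix_sum_delta; apply: eq_bigr => j _; rewrite big_ord1.
  apply/matrixP => x y; rewrite !mxE big_ord1 !mxE !ord1 eqxx mulr1n andbT.
  by case: (x == j); rewrite ?mulr0 ?mul0r ?mulr1 ?mul1r.
rewrite {1}[v]ex {1}[w]ex sl /mform -mulmxA mxE.
transitivity (\sum_i \sum_j tw b (w i 0) * (B (delta_mx j 0) (delta_mx i 0) * v j 0)).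
  rewrite exchange_big; apply: eq_bigr => j _; rewrite sr; apply: eq_bigr => i _.
  by rewrite (hZ _ _ _).2 (hZ _ _ _).1.
apply: eq_bigr => i _; rewrite !mxE big_distrr; apply: eq_bigr => j _.
by rewrite !mxE.
Qed.

Lemma operator_mx l n (J : 'cV[K]_n -> 'cV[K]_n) : is_operator l J ->
  exists A : 'M[K]_n, forall v, J v = A *m tws (if l is Antilinear then true else false) v.
Proof.
move=> [JD JZ]; set c := (X in tws X); exists (\matrix_(i, j) J (delta_mx j 0) i 0) => v.
have J0 : J 0 = 0 by apply: (addrI (J 0)); rewrite -JD !addr0.
have Js (r : seq 'I_n) F : J (\sum_(j <- r) F j) = \sum_(j <- r) J (F j).
  by elim/big_rec2: _ => [|i x y _ <-]; rewrite ?J0 ?JD.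
have ex : v = \sum_j delta_mx j 0 *m (v j 0)%:M.
  rewrite {1}[v]matrix_sum_delta; apply: eq_bigr => j _; rewrite big_ord1.
  apply/matrixP => x y; rewrite !mxE big_ord1 !mxE !ord1 eqxx mulr1n andbT.
  by case: (x == j); rewrite ?mulr0 ?mul0r ?mulr1 ?mul1r.
rewrite {1}ex Js; apply/matrixP => i j; rewrite !mxE summxE; apply: eq_bigr => s _.
by rewrite JZ !mxE big_ord1 !mxE !ord1 eqxx mulr1n; case: l @c {JZ}.
Qed.

Lemma direct_sum_frames n (P Q : subsp K n) : direct_sum P Q ->
  exists r1 r2 (F1 : 'M[K]_(n, r1)) (L1 : 'M[K]_(r1, n)) (F2 : 'M[K]_(n, r2)) (L2 : 'M[K]_(r2, n)),
  [/\ P = colspan F1, Q = colspan F2, L1 *m F1 = 1%:M & L2 *m F2 = 1%:M] /\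
  [/\ L1 *m F2 = 0, L2 *m F1 = 0 & F1 *m L1 + F2 *m L2 = 1%:M].
Proof.
have [r1 [F1 [M1 [MF1 ->]]]] := subsp_frame P.
have [r2 [F2 [M2 [MF2 ->]]]] := subsp_frame Q => -[h0 hs].
have [L LM] : exists L, L *m row_mx F1 F2 = 1%:M.
  apply: inj_linv => z; rewrite -[z]vsubmxK mul_row_col => hz.
  have h1 : F1 *m usubmx z = 0.
    apply: h0; first by apply/colspanP; exists (usubmx z).
    apply/colspanP; exists (- dsubmx z); rewrite mulmxN; apply/eqP.
    by rewrite eq_sym -subr_eq0 opprK hz.
  have h2 : F2 *m dsubmx z = 0 by rewrite -hz h1 add0r.
  by rewrite -[usubmx z]mul1mx -[dsubmx z]mul1mx -MF1 -MF2 -!mulmxA h1 h2 !mulmx0 col_mx0.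
have ML : row_mx F1 F2 *m L = 1%:M.
  apply: mulmx_ext => v; have [_ [_ [/colspanP[a <-] /colspanP[b' <-] ->]]] := hs v.
  by rewrite -mul_row_col mul1mx -mulmxA (mulmxA L) LM mul1mx.
move: LM ML; rewrite -[L]vsubmxK mul_col_row mul_row_col scalar_mx_block => /eq_block_mx[e1 e2 e3 e4] e5.
by exists r1, r2, F1, (usubmx L), F2, (dsubmx L).
Qed.

Lemma frames_direct_sum n r1 r2 (F1 : 'M[K]_(n, r1)) (L1 : 'M[K]_(r1, n)) (F2 : 'M[K]_(n, r2))
  (L2 : 'M[K]_(r2, n)) : L1 *m F1 = 1%:M -> L2 *m F1 = 0 ->
  L1 *m F2 = 0 -> F1 *m L1 + F2 *m L2 = 1%:M -> direct_sum (colspan F1) (colspan F2).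
Proof.
move=> L1F1 L2F1 L1F2 h; split.
  move=> v /colspanP[a <-] /colspanP[c hc].
  have : L1 *m (F2 *m c) = L1 *m (F1 *m a) by rewrite hc.
  by rewrite !mulmxA L1F1 L1F2 mul0mx mul1mx => <-; rewrite mulmx0.
move=> v; exists (F1 *m (L1 *m v)), (F2 *m (L2 *m v)); split.
- by apply/colspanP; exists (L1 *m v).
- by apply/colspanP; exists (L2 *m v).
- by rewrite !mulmxA -mulmxDl h mul1mx.
Qed.

Lemma direct_sum_act n g (P Q : subsp K n) : GL n g -> direct_sum P Q ->
  direct_sum (mximage g P) (mximage g Q).
Proof.
move=> [h [gh hg]] [d1 d2]; split.
  move=> _ [x Px <-] [y Qy hy]; have : h *m (g *m y) = h *m (g *m x) by rewrite hy.
  by rewrite !mulmxA hg !mul1mx => e; rewrite (d1 x) ?mulmx0// -e.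
move=> v; have [x [y [Px Qy e]]] := d2 (h *m v); exists (g *m x), (g *m y); split.
- by exists x.
- by exists y.
- by rewrite -mulmxDr -e mulmxA gh mul1mx.
Qed.

Lemma isotropic_mform b n r (A : 'M[K]_n) (F : 'M[K]_(n, r)) : anti_ok k b ->
  isotropic (mform b A) (colspan F) <-> adj b F *m A *m F = 0.
Proof.
move=> ok; split.
  move=> h; apply: (mform_ext (b := b)) => v w; rewrite mulmx0 mul0mx [RHS]mxE.
  rewrite -(h (F *m v) (F *m w)) /mform ?adj_sandwich//; apply/colspanP; [by exists v|by exists w].
move=> h _ _ /colspanP[v <-] /colspanP[w <-].
by rewrite /mform adj_sandwich// h mulmx0 mul0mx mxE.
Qed.

Lemma isometry_mform b n (A g : 'M[K]_n) : anti_ok k b ->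
  (forall v w, mform b A (g *m v) (g *m w) = mform b A v w) <-> adj b g *m A *m g = A.
Proof.
move=> ok; split.
  move=> h; apply: (mform_ext (b := b)) => v w; rewrite -[RHS]/(mform b A v w) -h /mform.
  by rewrite adj_sandwich.
by move=> h v w; rewrite /mform adj_sandwich// h.
Qed.

Lemma GL1 n : GL n (1%:M : 'M[K]_n).
Proof. by exists 1%:M; rewrite mulmx1. Qed.

Lemma GLM n (g h : 'M[K]_n) : GL n g -> GL n h -> GL n (g *m h).
Proof.
move=> [g' [gg' g'g]] [h' [hh' h'h]]; exists (h' *m g'); split.
  by rewrite mulmxA -(mulmxA g) hh' mulmx1.
by rewrite mulmxA -(mulmxA h') g'g mulmx1.
Qed.

Lemma isometries1 n B : isometries B (1%:M : 'M[K]_n).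
Proof. by split; [exact: GL1|move=> v w; rewrite !mul1mx]. Qed.

Lemma isometriesM n B (g h : 'M[K]_n) : isometries B g -> isometries B h -> isometries B (g *m h).
Proof.
by move=> [Gg hg] [Gh hh]; split; [exact: GLM|move=> v w; rewrite -!mulmxA hg hh].
Qed.

Lemma isometriesV n B (g h : 'M[K]_n) : g *m h = 1%:M -> h *m g = 1%:M ->
  isometries B g -> isometries B h.
Proof.
move=> gh hg [Gg hg']; split; first by exists g.
by move=> v w; rewrite -hg' !mulmxA gh !mul1mx.
Qed.

Lemma centralizer1 n J : centralizer J (1%:M : 'M[K]_n).
Proof. by split; [exact: GL1|move=> v; rewrite !mul1mx]. Qed.

Lemma centralizerM n J (g h : 'M[K]_n) : centralizer J g -> centralizer J h -> centralizer J (g *m h).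
Proof.
by move=> [Gg hg] [Gh hh]; split; [exact: GLM|move=> v; rewrite -!mulmxA hh hg].
Qed.

Lemma centralizerV n J (g h : 'M[K]_n) : g *m h = 1%:M -> h *m g = 1%:M ->
  centralizer J g -> centralizer J h.
Proof.
move=> gh hg [Gg hg']; split; first by exists g.
by move=> v; rewrite -[v in LHS]mul1mx -gh -mulmxA -hg' mulmxA hg mul1mx.
Qed.

Lemma isotropic_act n B g (P : subsp K n) : isometries B g -> isotropic B P ->
  isotropic B (mximage g P).
Proof. by move=> [_ hg] h _ _ [x Px <-] [y Py <-]; rewrite hg; exact: h. Qed.

(** The component in [Q] of a vector of a larger isotropic space is orthogonal to [P] and to [Q],
    hence is 0. *)
Lemma split_max_isotropic n (B : 'cV[K]_n -> 'cV[K]_n -> K) (P Q : subsp K n) : Defs.nondegenerate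
  B -> biadditive B ->
  isotropic B P -> isotropic B Q -> direct_sum P Q -> max_isotropic B P.
Proof.
move=> nd [Dl Dr] iP iQ [_ hs]; split=> // P' iP' PP' v P'v.
have [x [y [Px Qy vxy]]] := hs v.
suff y0 : y = 0 by rewrite vxy y0 addr0.
apply: nd => w; have [x' [y' [Px' Qy' ->]]] := hs w.
rewrite Dr (iQ y y')// addr0; apply: iP'; last exact: PP'.
have -> : y = v + x *m (- 1)%:M.
  by rewrite vxy -[X in _ *m X%:M]/(- (1 : K)) raddfN mulmxN mulmx1; abel.
by apply: subspD => //; apply: subspZ; exact: PP'.
Qed.

End FormMatrices.

(** * Local transitivity in each of the five lists *)

Section Models.
Variables (R : realType) (k : scalars) (n : nat).
Local Notation K := (scal R k).

Record open_model (T : topologicalType) (G : set 'M[K]_n) (S : set (subsp K n * subsp K n))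
    (Grs : set T) (iota : subsp K n * subsp K n -> T) : Prop := OpenModel {
  om1 : G 1%:M;
  omM : forall g h, G g -> G h -> G (g *m h);
  omV : forall g, G g -> exists h, [/\ G h, g *m h = 1%:M & h *m g = 1%:M];
  omS : forall g s, G g -> S s -> S (act g s);
  om_iotaS : forall s, S s -> Grs (iota s);
  om_inj : forall s s', S s -> S s' -> iota s = iota s' -> s = s';
  om_cont : forall s, S s -> forall W, open W -> W (iota s) ->
    exists2 e : R, 0 < e & forall g, G g -> mnorm (g - 1%:M) < e -> W (iota (act g s));
  om_lt : forall s, S s -> forall e : R, 0 < e ->
    exists W, [/\ open W, W (iota s) & forall q, W q -> Grs q ->
      exists g, [/\ G g, mnorm (g - 1%:M) < e & iota (act g s) = q]]
}.

Lemma GL_inv (g : 'M[K]_n) : GL n g -> exists h, [/\ GL n h, g *m h = 1%:M & h *m g = 1%:M].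
Proof. by move=> [h [gh hg]]; exists h; split=> //; exists g. Qed.

Lemma fst_cont (G : set 'M[K]_n) (s : subsp K n * subsp K n) : (forall g, G g -> GL n g) ->
  forall W : set (subsp K n), open W -> W s.1 ->
  exists2 e : R, 0 < e & forall g, G g -> mnorm (g - 1%:M) < e -> W (act g s).1.
Proof.
move=> GG W oW Ws; have [e e0 he] := colspan_act_cont oW Ws.
by exists e => // g /GG; exact: he.
Qed.

Lemma pair_cont (G : set 'M[K]_n) (s : subsp K n * subsp K n) : (forall g, G g -> GL n g) ->
  forall W : set (subsp K n * subsp K n), open W -> W s ->
  exists2 e : R, 0 < e & forall g, G g -> mnorm (g - 1%:M) < e -> W (act g s).
Proof.
move=> GG W oW Ws; have : nbhs s W by exact: open_nbhs_nbhs.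
move=> [[U1 U2] /= [n1 n2] hU].
move: n1 n2; rewrite !nbhsE => -[V1 [oV1 V1s] VU1] [V2 [oV2 V2s] VU2].
have [e1 e10 he1] := colspan_act_cont oV1 V1s.
have [e2 e20 he2] := colspan_act_cont oV2 V2s.
have [e e0 he] := min_gt0 e10 e20.
exists e => // g /GG Gg /he[h1 h2]; apply: hU; split; [apply: VU1|apply: VU2].
  exact: he1.
exact: he2.
Qed.

Definition mop c (A : 'M[K]_n) (v : 'cV[K]_n) : 'cV[K]_n := A *m tws c v.

Record is_mform b sg (A Ai : 'M[K]_n) : Prop := IsMform {
  mf_ok : anti_ok k b; mf_l : Ai *m A = 1%:M; mf_r : A *m Ai = 1%:M;
  mf_adj : adj b A = sgm sg A }.

Record is_mop c se (A : 'M[K]_n) : Prop := IsMop {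
  mo_ok : auto_ok k c; mo_sq : A *m tws c A = sgm se 1%:M }.

Definition mconsistent b c sm (A AJ : 'M[K]_n) := adj b AJ *m A *m AJ = sgm sm (tws c A).

Lemma mform_biadditive b (A : 'M[K]_n) : biadditive (mform b A).
Proof.
by split=> v w x; rewrite /mform ?mulmxDr ?adjD ?mulmxDl mxE.
Qed.

Lemma mform_nondegenerate b sg (A Ai : 'M[K]_n) : is_mform b sg A Ai -> Defs.nondegenerate (mform b A).
Proof.
move=> hA v hv; rewrite -[v]mul1mx -(mf_l hA) -mulmxA.
suff -> : A *m v = 0 by rewrite mulmx0.
apply: (mform_ext (b := b)) => x w.
rewrite mulmx0 mul0mx [RHS]mxE mxE big_ord1 mulmxA.
by rewrite -[X in X * _]/(mform b A v w) hv mul0r.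
Qed.

Lemma isometriesP b (A g : 'M[K]_n) : anti_ok k b ->
  isometries (mform b A) g <-> GL n g /\ adj b g *m A *m g = A.
Proof.
by move=> ok; split=> -[h1 h2]; split=> //; move/(isometry_mform A g ok): h2.
Qed.

Lemma centralizerP c (A g : 'M[K]_n) : auto_ok k c ->
  centralizer (mop c A) g <-> GL n g /\ g *m A = A *m tws c g.
Proof.
move=> ok; split=> -[h1 h2]; split=> //.
  apply: mulmx_ext => v; have := h2 (tws c v); rewrite /mop twsM// !twsK -!mulmxA => <-.
  by [].
by move=> v; rewrite /mop mulmxA h2 twsM// mulmxA.
Qed.

(** The inverse of the matrix [A] of J, read off from J^2 = 1 or -1. *)
Definition mopV c se (A : 'M[K]_n) := sgm se (tws c A).

Lemma mopK c se A : is_mop c se A -> A *m mopV c se A = 1%:M.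
Proof. by move=> [_ h]; rewrite /mopV sgm_mulr h sgmK. Qed.

Lemma mopVK c se A : is_mop c se A -> mopV c se A *m A = 1%:M.
Proof.
move=> [ok h]; rewrite /mopV sgm_mull -[A in _ *m A](twsK c) -twsM// h.
by rewrite sgm_tws sgmK tws1.
Qed.

Lemma mop_mop c se A v : is_mop c se A -> mop c A (mop c A v) = sgm se v.
Proof. by move=> [ok h]; rewrite /mop twsM// twsK mulmxA h sgm_mull mul1mx. Qed.

Lemma mop_swap c se A (P Q : 'M[K]_n) : is_mop c se A -> P + Q = 1%:M ->
  P *m A *m tws c P = 0 -> Q *m A *m tws c Q = 0 -> A *m tws c P = Q *m A.
Proof.
move=> hJ PQ h1 h2; transitivity (Q *m A *m tws c P).
  by rewrite -[A in LHS]mul1mx -PQ !mulmxDl h1 add0r.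
by rewrite -[RHS]mulmx1 -(tws1 R k c n) -PQ twsD mulmxDr h2 addr0.
Qed.

(** [T'] is the matrix of J T J^-1, which is linear even when J is antilinear; conjugating twice
    returns [T]. *)
Lemma conj_mop c se A (T : 'M[K]_n) : is_mop c se A ->
  let T' := A *m tws c T *m mopV c se A in
  A *m tws c T = T' *m A /\ A *m tws c T' = T *m A.
Proof.
move=> hJ /=; split; first by rewrite -[RHS]mulmxA mopVK// mulmx1.
rewrite !(twsM _ _ (mo_ok hJ)) twsK !mulmxA (mo_sq hJ) /mopV sgm_tws twsK.
by rewrite sgm_mull mul1mx sgm_mulr sgm_mull sgmK.
Qed.

Lemma conj_isotropic b c se sm (A AJ T : 'M[K]_n) : anti_ok k b -> is_mop c se AJ ->
  mconsistent b c sm A AJ -> adj b T *m A *m T = 0 ->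
  let T' := AJ *m tws c T *m mopV c se AJ in adj b T' *m A *m T' = 0.
Proof.
move=> ok hJ hc h /=; have okc := mo_ok hJ.
rewrite adj_sandwich// adj_sandwich// hc sgm_mulr sgm_mull adj_tws -!twsM//.
by rewrite h tws0 sgm0 mulmx0 mul0mx.
Qed.

Lemma colspan_proj r (F : 'M[K]_(n, r)) (L : 'M[K]_(r, n)) (H : 'M[K]_(n, r)) : L *m F = 1%:M ->
  colspan (H *m L) = colspan H.
Proof. exact: colspan_mul. Qed.

Lemma proj_idem r (F : 'M[K]_(n, r)) (L : 'M[K]_(r, n)) : L *m F = 1%:M ->
  F *m L *m (F *m L) = F *m L.
Proof. by move=> LF; rewrite mulmxA -(mulmxA F) LF mulmx1. Qed.

Lemma chart_rotation r (F F' : 'M[K]_(n, r)) (L : 'M[K]_(r, n)) : L *m F = 1%:M ->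
  F' *m L *m (F *m L) = F' *m L /\ mnorm (F' *m L - F *m L) <= mnorm L * mnorm (F' - F).
Proof.
move=> LF; split; first by rewrite mulmxA -(mulmxA F') LF mulmx1.
by rewrite -mulmxBl mulrC mnormM.
Qed.

Lemma swap_image c se A r1 r2 (F1 : 'M[K]_(n, r1)) (L1 : 'M[K]_(r1, n)) (F2 : 'M[K]_(n, r2))
  (L2 : 'M[K]_(r2, n)) : is_mop c se A ->
  L1 *m F2 = 0 -> L2 *m F1 = 0 -> F1 *m L1 + F2 *m L2 = 1%:M ->
  mop c A @` (colspan F1) = colspan F2 ->
  A *m tws c (F1 *m L1) = (1%:M - F1 *m L1) *m A.
Proof.
move=> hJ LF12 LF21 FL hs; have ok := mo_ok hJ.
have -> : 1%:M - F1 *m L1 = F2 *m L2 by rewrite -FL; abel.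
apply: (mop_swap hJ) => //.
  have h : L1 *m A *m tws c F1 = 0.
    apply: mulmx_ext => v; have : subsp_set (colspan F2) (mop c A (F1 *m tws c v)).
      by rewrite -hs; exists (F1 *m tws c v) => //; apply/colspanP; exists (tws c v).
    move/colspanP => [z]; rewrite /mop twsM// twsK => hz.
    by rewrite -!mulmxA -hz mulmxA LF12 !mul0mx.
  by rewrite twsM// !mulmxA -!(mulmxA F1) h mul0mx mulmx0.
have h : L2 *m A *m tws c F2 = 0.
  apply: mulmx_ext => v; have : (mop c A @` colspan F1) (F2 *m tws c v).
    by rewrite hs; apply/colspanP; exists (tws c v).
  move=> [_ /colspanP[z <-] hz]; have := congr1 (mop c A) hz.
  rewrite (mop_mop _ hJ) {1}/mop twsM// twsK => e.
  by rewrite -!mulmxA -e sgm_mulr mulmxA LF21 mul0mx sgm0 mul0mx.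
by rewrite twsM// !mulmxA -!(mulmxA F2) h mul0mx mulmx0.
Qed.

(** Taking T2 = J T1 J^-1 keeps the second summand equal to J of the first. The isometry clause is
    stated for every consistent form vanishing on the subspaces involved, so that the lemma serves
    both List 1 and List 3. *)
Lemma semilinear_lt c se A (s : subsp K n * subsp K n) : is_mop c se A ->
  direct_sum s.1 s.2 -> mop c A @` s.1 = s.2 -> forall e : R, 0 < e ->
  exists W, [/\ open W, W s.1 & forall q, W q ->
    exists g, [/\ GL n g, mnorm (g - 1%:M) < e, mximage g s.1 = q, g *m A = A *m tws c g
      & forall b sm B, anti_ok k b -> mconsistent b c sm B A ->
        isotropic (mform b B) s.1 -> isotropic (mform b B) s.2 -> isotropic (mform b B) q ->
        adj b g *m B *m g = B]].
Proof.
case: s => s1 s2 /= hJ ds js e e0; have ok := mo_ok hJ.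
have [r1 [r2 [F1 [L1 [F2 [L2 [[s1E s2E LF1 LF2] [LF12 LF21 FL]]]]]]]] := direct_sum_frames ds.
subst s1 s2; set P := F1 *m L1.
have QE : 1%:M - P = F2 *m L2 by rewrite -FL /P; abel.
have JP : A *m tws c P = (1%:M - P) *m A by exact: (swap_image hJ LF12 LF21 FL js).
have [d d0 hd] := local_rotation (proj_idem LF1) e0.
have C0 : 0 <= mnorm A * mnorm (mopV c se A) * mnorm L1 by rewrite !mulr_ge0 ?mnorm_ge0.
have [d1 d10 hd1] := small_mul (mnorm_ge0 L1) d0.
have [d2 d20 hd2] := small_mul C0 d0.
have [d3 d30 hd3] := min_gt0 d10 d20.
exists (chart F1 L1 d3); split; [exact: chart_open|exact: (chart_center d30 LF1)|].
move=> q [F' [LF' hF' ->]]; have [h1 h2] := hd3 _ hF'.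
have [T1P T1n] := chart_rotation F' LF1.
set T1 := F' *m L1 in T1P T1n; pose T2 := A *m tws c T1 *m mopV c se A.
have [J1 J2] := conj_mop T1 hJ; rewrite -/T2 in J1 J2.
have PE : 1%:M - P = A *m tws c P *m mopV c se A by rewrite JP -mulmxA (mopK hJ) mulmx1.
have VP : mopV c se A *m P = tws c (1%:M - P) *m mopV c se A.
  have JQ : P *m A = A *m tws c (1%:M - P).
    by rewrite twsD tws1 twsN mulmxBr mulmx1 JP mulmxBl mul1mx; abel.
  rewrite -[LHS]mulmx1 -[X in _ *m X = _](mopK hJ) mulmxA -(mulmxA (mopV c se A)) JQ mulmxA (mopVK hJ).
  by rewrite mul1mx.
have T2P : T2 *m P = 0.
  rewrite /T2 -mulmxA VP mulmxA -(mulmxA A) -twsM// mulmxBr mulmx1 T1P subrr tws0.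
  by rewrite mulmx0 mul0mx.
have [||g [Gg gn [gP gQ] hB hJg]] := hd T1 T2 T1P T2P.
- by apply: le_lt_trans T1n _; apply: hd1; rewrite ?mnorm_ge0.
- rewrite PE -mulmxBl -mulmxBr -twsN -twsD.
  apply: (@le_lt_trans _ _ (mnorm A * mnorm (mopV c se A) * mnorm L1 * mnorm (F' - F1))).
    apply: le_trans (mnormM _ _) _; rewrite -!mulrA [X in _ <= _ * X]mulrC !mulrA.
    rewrite ler_wpM2r ?mnorm_ge0//; apply: le_trans (mnormM _ _) _.
    by rewrite -!mulrA ler_wpM2l ?mnorm_ge0// mnorm_tws; exact: T1n.
  by apply: hd2; rewrite ?mnorm_ge0.
rewrite (colspan_proj _ LF1) in gP; rewrite (colspan_proj _ LF1) in gP.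
exists g; split=> //; first exact: hJg.
move=> b sm B okb hc /(isotropic_mform _ _ okb) i1 /(isotropic_mform _ _ okb) i2.
move=> /(isotropic_mform _ _ okb) i3; apply: hB => //; left.
have i4 : adj b T1 *m B *m T1 = 0 by rewrite adj_sandwich// i3 mulmx0 mul0mx.
split=> //; [|rewrite QE|exact: conj_isotropic hc i4].
  by rewrite adj_sandwich// i1 mulmx0 mul0mx.
by rewrite adj_sandwich// i2 mulmx0 mul0mx.
Qed.

Lemma pair_lt (s : subsp K n * subsp K n) : direct_sum s.1 s.2 -> forall e : R, 0 < e ->
  exists W, [/\ open W, W s & forall q, W q ->
    exists g, [/\ GL n g, mnorm (g - 1%:M) < e, act g s = q
      & forall b B, anti_ok k b -> isotropic (mform b B) s.1 -> isotropic (mform b B) s.2 ->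
        isotropic (mform b B) q.1 -> isotropic (mform b B) q.2 -> adj b g *m B *m g = B]].
Proof.
case: s => s1 s2 /= ds e e0.
have [r1 [r2 [F1 [L1 [F2 [L2 [[s1E s2E LF1 LF2] [LF12 LF21 FL]]]]]]]] := direct_sum_frames ds.
subst s1 s2; set P := F1 *m L1.
have QE : 1%:M - P = F2 *m L2 by rewrite -FL /P; abel.
have [d d0 hd] := local_rotation (proj_idem LF1) e0.
have [d1 d10 hd1] := small_mul (mnorm_ge0 L1) d0.
have [d2 d20 hd2] := small_mul (mnorm_ge0 L2) d0.
exists (chart F1 L1 d1 `*` chart F2 L2 d2); split.
- rewrite openE => -[q1 q2] [/= h1 h2]; exists (chart F1 L1 d1, chart F2 L2 d2) => //=.
  by split; apply: open_nbhs_nbhs; split=> //; exact: chart_open.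
- by split; [exact: (chart_center d10 LF1)|exact: (chart_center d20 LF2)].
move=> [_ _] [/= [F1' [LF1' h1 ->]] [F2' [LF2' h2 ->]]].
have [T1P T1n] := chart_rotation F1' LF1; have [_ T2n] := chart_rotation F2' LF2.
set T1 := F1' *m L1 in T1P T1n; set T2 := F2' *m L2 in T2n.
have T2P : T2 *m P = 0.
  by rewrite /T2 /P mulmxA -(mulmxA F2') LF21 mulmx0 mul0mx.
have [||g [Gg gn [gP gQ] hB hJg]] := hd T1 T2 T1P T2P.
- by apply: le_lt_trans T1n _; apply: hd1; rewrite ?mnorm_ge0.
- by rewrite QE; apply: le_lt_trans T2n _; apply: hd2; rewrite ?mnorm_ge0.
move: gQ; rewrite QE => gQ.
rewrite (colspan_proj _ LF1) in gP; rewrite (colspan_proj _ LF1) in gP.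
rewrite (colspan_proj _ LF2) in gQ; rewrite (colspan_proj _ LF2) in gQ.
exists g; split=> //; first by rewrite /act /= gP gQ.
move=> b B okb /(isotropic_mform _ _ okb) i1 /(isotropic_mform _ _ okb) i2.
move=> /(isotropic_mform _ _ okb) i3 /(isotropic_mform _ _ okb) i4.
apply: hB => //; left.
by split; rewrite ?QE adj_sandwich// ?i1 ?i2 ?i3 ?i4 mulmx0 mul0mx.
Qed.

Lemma orth_sym b sg A Ai r1 r2 (F1 : 'M[K]_(n, r1)) (F2 : 'M[K]_(n, r2)) : is_mform b sg A Ai ->
  adj b F2 *m A *m F1 = 0 -> adj b F1 *m A *m F2 = 0.
Proof.
move=> hA h1; have ok := mf_ok hA.
have := congr1 (@adj R k b _ _) h1; rewrite adj0 !adjM// adjK (mf_adj hA).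
by rewrite sgm_mull sgm_mulr mulmxA => /(congr1 (@sgm R k sg _ _)); rewrite sgmK sgm0.
Qed.

Lemma orth_mx b sg A Ai r1 r2 (F1 : 'M[K]_(n, r1)) (F2 : 'M[K]_(n, r2)) : is_mform b sg A Ai ->
  (forall w, subsp_set (colspan F2) w -> orthogonal_complement (mform b A) (colspan F1) w) ->
  adj b F2 *m A *m F1 = 0 /\ adj b F1 *m A *m F2 = 0.
Proof.
move=> hA h; have ok := mf_ok hA.
have h1 : adj b F2 *m A *m F1 = 0.
  apply: (mform_ext (b := b)) => v w; rewrite mulmx0 mul0mx [RHS]mxE.
  rewrite -adj_sandwich// -[LHS]/(mform b A (F1 *m v) (F2 *m w)); apply: h.
    by apply/colspanP; exists w.
  by apply/colspanP; exists v.
by split=> //; exact: (orth_sym hA).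
Qed.

Lemma orth_lt b sg A Ai (s : subsp K n * subsp K n) : is_mform b sg A Ai ->
  direct_sum s.1 s.2 -> orthogonal_complement (mform b A) s.1 = s.2 -> forall e : R, 0 < e ->
  exists W, [/\ open W, W s.1 & forall q, W q ->
    exists g, [/\ GL n g, mnorm (g - 1%:M) < e, mximage g s.1 = q & adj b g *m A *m g = A]].
Proof.
case: s => s1 s2 /= hA ds os e e0; have ok := mf_ok hA.
have [r1 [r2 [F1 [L1 [F2 [L2 [[s1E s2E LF1 LF2] [LF12 LF21 FL]]]]]]]] := direct_sum_frames ds.
subst s1 s2; set P := F1 *m L1.
have QE : 1%:M - P = F2 *m L2 by rewrite -FL /P; abel.
have [|o21 o12] := @orth_mx b sg A Ai r1 r2 F1 F2 hA; first by move=> w; rewrite os.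
have QP : adj b (1%:M - P) *m A *m P = 0 by rewrite QE adj_sandwich// o21 mulmx0 mul0mx.
have PQ : adj b P *m A *m (1%:M - P) = 0 by rewrite QE adj_sandwich// o12 mulmx0 mul0mx.
have AP : A *m P = adj b P *m A.
  have h1 : A *m P = adj b P *m A *m P.
    by move: QP; rewrite adjD adjN adjmx1 !mulmxBl mul1mx => /eqP; rewrite subr_eq0 => /eqP.
  by move: PQ; rewrite mulmxBr mulmx1 -h1 => /eqP; rewrite subr_eq0 => /eqP.
have AiP : Ai *m adj b P *m A = P by rewrite -mulmxA -AP mulmxA (mf_l hA) mul1mx.
have [d d0 hd] := local_rotation (proj_idem LF1) e0.
have C0 : 0 <= mnorm Ai * mnorm A * mnorm L1 by rewrite !mulr_ge0 ?mnorm_ge0.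
have [d1 d10 hd1] := small_mul (mnorm_ge0 L1) d0.
have [d2 d20 hd2] := small_mul C0 d0.
have [d3 d30 hd3] := min_gt0 d10 d20.
exists (chart F1 L1 d3); split; [exact: chart_open|exact: (chart_center d30 LF1)|].
move=> q [F' [LF' hF' ->]]; have [h1 h2] := hd3 _ hF'.
have [T1P T1n] := chart_rotation F' LF1.
(* [Ai *m adj b T1 *m A] is the adjoint of the idempotent [T1] for the form; the image of 1 minus it
   is the kernel of the adjoint, which is the orthogonal complement of the image of [T1]. *)
set T1 := F' *m L1 in T1P T1n; pose T2 := 1%:M - Ai *m adj b T1 *m A.
have T1T1 : T1 *m T1 = T1 by exact: proj_idem.
have PT1 : P *m T1 = P by rewrite /P /T1 mulmxA -(mulmxA F1) LF' mulmx1.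
have T2P : T2 *m P = 0.
  rewrite /T2 mulmxBl mul1mx -!mulmxA AP (mulmxA (adj b T1)) -adjM// PT1.
  by rewrite mulmxA AiP subrr.
have T12 : adj b T1 *m A *m T2 = 0.
  rewrite /T2 mulmxBr mulmx1 !mulmxA -(mulmxA _ A Ai) (mf_r hA) mulmx1 -adjM// T1T1 subrr//.
have T21 : adj b T2 *m A *m T1 = 0 by exact: (orth_sym hA).
have [||g [Gg gn [gP gQ] hB hJg]] := hd T1 T2 T1P T2P.
- by apply: le_lt_trans T1n _; apply: hd1; rewrite ?mnorm_ge0.
- have -> : T2 - (1%:M - P) = Ai *m adj b (P - T1) *m A.
    by rewrite adjD adjN mulmxBr mulmxBl AiP /T2; abel.
  apply: (@le_lt_trans _ _ (mnorm Ai * mnorm A * mnorm L1 * mnorm (F' - F1))).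
    apply: le_trans (mnormM _ _) _.
    have -> : mnorm Ai * mnorm A * mnorm L1 * mnorm (F' - F1) =
      mnorm Ai * (mnorm L1 * mnorm (F' - F1)) * mnorm A by ring.
    rewrite ler_wpM2r ?mnorm_ge0//; apply: le_trans (mnormM _ _) _.
    by rewrite ler_wpM2l ?mnorm_ge0// mnorm_adj mnormBC; exact: T1n.
  by apply: hd2; rewrite ?mnorm_ge0.
rewrite (colspan_proj _ LF1) in gP; rewrite (colspan_proj _ LF1) in gP.
by exists g; split=> //; apply: hB => //; right.
Qed.

Lemma max_isotropic_act B g (P : subsp K n) : isometries B g -> max_isotropic B P ->
  max_isotropic B (mximage g P).
Proof.
move=> Ig [iP mP]; split; first exact: isotropic_act.
have [[h [gh hg]] _] := Ig; have Ih := isometriesV gh hg Ig.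
move=> P' iP' sub v P'v.
have : mximage h P' `<=` P.
  apply: mP; first exact: isotropic_act.
  move=> w Pw; exists (g *m w); last by rewrite mulmxA hg mul1mx.
  by apply: sub; exists w.
move/(_ (h *m v)) => hv; exists (h *m v); first by apply: hv; exists v.
by rewrite mulmxA gh mul1mx.
Qed.

Lemma swap_act (J : 'cV[K]_n -> 'cV[K]_n) g (P Q : subsp K n) : centralizer J g -> J @` P = Q ->
  J @` (mximage g P) = mximage g Q.
Proof.
move=> [_ hg] h; apply/seteqP; split => v.
  move=> [_ [x Px <-] <-]; exists (J x); last by rewrite hg.
  by rewrite -h; exists x.
move=> [x]; rewrite -h => -[y Py <-] <-; exists (g *m y); last by rewrite hg.
by exists y.
Qed.

Lemma orth_act D g (P Q : subsp K n) : isometries D g -> orthogonal_complement D P = Q ->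
  orthogonal_complement D (mximage g P) = mximage g Q.
Proof.
move=> [[h [gh hg]] ig] e; apply/seteqP; split => v.
  move=> hv; exists (h *m v); last by rewrite mulmxA gh mul1mx.
  rewrite -e => x Px; rewrite -ig mulmxA gh mul1mx; apply: hv; by exists x.
move=> [x]; rewrite -e => hx <- _ [y Py <-]; rewrite ig; exact: hx.
Qed.

Lemma Gr_act g r (P : subsp K n) : GL n g -> Gr r P -> Gr r (mximage g P).
Proof.
move=> [h [gh hg]] [F fF <-]; exists (g *m F); last by rewrite mximage_colspan.
move/frames_linv: fF => [L LF]; apply/frames_linv; exists (L *m h).
by rewrite mulmxA -(mulmxA L) hg mulmx1.
Qed.

Lemma model1 b sg A Ai c se AJ sm : is_mform b sg A Ai -> is_mop c se AJ -> mconsistent b c sm A AJ ->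
  open_model (isometries (mform b A) `&` centralizer (mop c AJ)) (pairs_BJ (mform b A) (mop c AJ))
    (max_isotropic (mform b A)) (fun s => s.1).
Proof.
move=> hA hJ hc; have ok := mf_ok hA; have okc := mo_ok hJ; split.
- by split; [exact: isometries1|exact: centralizer1].
- by move=> g h [] ? ? [] ? ?; split; [exact: isometriesM|exact: centralizerM].
- move=> g [Ig Cg]; have [[h [gh hg]] _] := Ig; exists h; split=> //.
  by split; [exact: isometriesV Ig|exact: centralizerV Cg].
- move=> g [s1 s2] [Ig Cg] [/= m1 m2 ds js]; split=> /=.
  + exact: max_isotropic_act.
  + exact: max_isotropic_act.
  + exact: (direct_sum_act Ig.1).
  + exact: swap_act.
- by move=> [s1 s2] [].
- move=> [s1 s2] [s1' s2'] [/= _ _ _ js] [/= _ _ _ js'] e; rewrite e in js *.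
  by congr (_, _); apply: subsp_ext => v; rewrite -js js'.
- by move=> s _; apply: fst_cont => g [[]].
- move=> s [/= m1 m2 ds js] e e0.
  have [W [oW Ws hW]] := semilinear_lt hJ ds js e0.
  exists W; split=> // q Wq [iq _]; have [g [Gg gn gq gJ hB]] := hW _ Wq.
  exists g; split=> //; split; first by apply/isometriesP => //; split=> //; apply: (hB _ sm);
    case: m1 m2 => ? _ [].
  by apply/centralizerP.
Qed.

Lemma model2 b sg A Ai : is_mform b sg A Ai ->
  open_model (isometries (mform b A)) (pairs_B (mform b A))
    (max_isotropic (mform b A) `*` max_isotropic (mform b A)) id.
Proof.
move=> hA; have ok := mf_ok hA; split.
- exact: isometries1.
- exact: isometriesM.
- move=> g Ig; have [[h [gh hg]] _] := Ig; exists h; split=> //; exact: isometriesV Ig.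
- move=> g [s1 s2] Ig [/= m1 m2 ds]; split=> /=.
  + exact: max_isotropic_act.
  + exact: max_isotropic_act.
  + exact: (direct_sum_act Ig.1).
- by move=> [s1 s2] [].
- by [].
- by move=> s _; apply: pair_cont => g [].
- move=> s [/= [m1 _] [m2 _] ds] e e0; have [W [oW Ws hW]] := pair_lt ds e0.
  exists W; split=> // q Wq [[iq1 _] [iq2 _]]; have [g [Gg gn gq hB]] := hW _ Wq.
  by exists g; split=> //; apply/isometriesP => //; split=> //; exact: hB.
Qed.

(** Nothing relates [m] to [n] here, so the first summand may have another dimension; the second
    alternative is refuted by [pairs_J_dim] when n = m + m. *)
Lemma model3 c se AJ m : is_mop c se AJ ->
  open_model (centralizer (mop c AJ)) (pairs_J (mop c AJ)) (Gr m : set (subsp K n)) (fun s => s.1)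
  \/ exists2 s, pairs_J (mop c AJ) s & ~ Gr m s.1.
Proof.
move=> hJ; have okc := mo_ok hJ.
have [|h] := pselect (exists2 s, pairs_J (mop c AJ) s & ~ Gr m s.1); [by right|left; split].
- exact: centralizer1.
- exact: centralizerM.
- move=> g Ig; have [[h' [gh hg]] _] := Ig; exists h'; split=> //; exact: centralizerV Ig.
- move=> g [s1 s2] Cg [/= ds js]; split=> /=; last exact: swap_act.
  exact: (direct_sum_act Cg.1).
- by move=> s hs; apply: contrapT => ns; apply: h; exists s.
- move=> [s1 s2] [s1' s2'] [/= _ js] [/= _ js'] e; rewrite e in js *.
  by congr (_, _); apply: subsp_ext => v; rewrite -js js'.
- by move=> s _; apply: fst_cont => g [].
- move=> s [/= ds js] e e0; have [W [oW Ws hW]] := semilinear_lt hJ ds js e0.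
  exists W; split=> // q Wq _; have [g [Gg gn gq gJ hB]] := hW _ Wq.
  by exists g; split=> //; apply/centralizerP.
Qed.

Lemma model4 b sg A Ai m : is_mform b sg A Ai ->
  open_model (isometries (mform b A)) (pairs_D m (mform b A)) (Gr m) (fun s => s.1).
Proof.
move=> hA; have ok := mf_ok hA; split.
- exact: isometries1.
- exact: isometriesM.
- move=> g Ig; have [[h [gh hg]] _] := Ig; exists h; split=> //; exact: isometriesV Ig.
- move=> g [s1 s2] Ig [/= m1 ds os]; split=> /=.
  + exact: (Gr_act Ig.1).
  + exact: (direct_sum_act Ig.1).
  + exact: orth_act.
- by move=> [s1 s2] [].
- move=> [s1 s2] [s1' s2'] [/= _ _ js] [/= _ _ js'] e; rewrite e in js *.
  by congr (_, _); apply: subsp_ext => v; rewrite -js js'.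
- by move=> s _; apply: fst_cont => g [].
- move=> s [/= _ ds os] e e0; have [W [oW Ws hW]] := orth_lt hA ds os e0.
  exists W; split=> // q Wq _; have [g [Gg gn gq hB]] := hW _ Wq.
  by exists g; split=> //; apply/isometriesP.
Qed.

Lemma model5 p q : open_model (GL n) (pairs_dim p q)
  (Gr p `*` Gr q : set (subsp K n * subsp K n)) id.
Proof.
split.
- exact: GL1.
- exact: GLM.
- exact: GL_inv.
- move=> g [s1 s2] Gg [/= m1 m2 ds]; split=> /=; try exact: Gr_act.
  exact: direct_sum_act.
- by move=> [s1 s2] [].
- by [].
- by move=> s _; apply: pair_cont => g.
- move=> s [/= _ _ ds] e e0; have [W [oW Ws hW]] := pair_lt ds e0.
  exists W; split=> // q' Wq _; have [g [Gg gn gq hB]] := hW _ Wq.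
  by exists g.
Qed.

End Models.

(** * Density *)

Section Pencil.
Variables (R : realType) (k : scalars).
Local Notation K := (scal R k).

(** The classical induction, applying X - lam m to a relation; it survives noncommutativity because
    the eigenvalues are real and so commute with the coefficients. *)
Lemma eigen_indep r (X : 'M[K]_r) (v : nat -> 'cV[K]_r) (lam : nat -> R) :
  injective lam -> (forall i, X *m v i = rsc (lam i) (v i)) -> (forall i, v i <> 0) ->
  forall m (c : nat -> K), \sum_(i < m) v i *m (c i)%:M = 0 -> forall i, (i < m)%N -> c i = 0.
Proof.
move=> lam_inj hX v0; elim=> [//|m IH] c hc.
have vc0 i (d : K) : v i *m d%:M = 0 -> d = 0.
  move=> h; apply/eqP/negPn/negP => d0; apply: (v0 i).
  have [d' [dd' _]] := sinv d0.
  by rewrite -[v i]mulmx1 -dd' scalar_mxM mulmxA h mul0mx.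
have hX' : \sum_(i < m) v i *m (sreal k (lam i - lam m) * c i)%:M = 0.
  have h1 : \sum_(i < m.+1) (X - rsc (lam m) 1%:M) *m (v i *m (c i)%:M) = 0.
    by rewrite -mulmx_sumr hc mulmx0.
  rewrite -[RHS]h1 big_ord_recr /= [X in _ = _ + X](_ : _ = 0) ?addr0; last first.
    by rewrite mulmxA mulmxBl hX rscAl mul1mx subrr mul0mx.
  apply: eq_bigr => i _; rewrite mulmxA mulmxBl hX rscAl mul1mx -rscNl -rscDl.
  by rewrite scalar_mxM mulmxA; congr (_ *m _); apply/matrixP => x y;
    rewrite !mxE big_ord1 !mxE !ord1 eqxx mulr1n srealC.
have cm i : (i < m)%N -> c i = 0.
  move=> im; have h := IH (fun i => sreal k (lam i - lam m) * c i) hX' i im.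
  have l0 : lam i - lam m != 0.
    by rewrite subr_eq0; apply/eqP => /lam_inj e; move: im; rewrite e ltnn.
  by rewrite -[c i]mul1r -(sreal_inv k l0) -mulrA h mulr0.
move=> i; rewrite ltnS leq_eqVlt => /orP[/eqP ->|]; last exact: cm.
move: hc; rewrite big_ord_recr /= big1 ?add0r; last by move=> j _; rewrite cm// raddf0 mulmx0.
exact: vc0.
Qed.

(* Only finitely many members of an affine pencil of matrices are singular. *)
Lemma pencil n r (M E : 'M[K]_(n, r)) L : L *m (M + E) = 1%:M -> (M + E) *m L = 1%:M ->
  forall e : R, 0 < e -> exists t, [/\ 0 < t, t < e & exists L', L' *m (M + rsc t E) = 1%:M /\
    (M + rsc t E) *m L' = 1%:M].
Proof.
move=> LM ML e e0; have rn := inv2_dim LM ML.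
apply: contrapT => hno.
(* The bound 1/2 keeps every [t i] below 1, so that 1 - t i is invertible; the denominators i + 2
   make the [t i] distinct and smaller than e'. *)
pose e' := Num.min e 2^-1; have e'0 : 0 < e' by rewrite lt_min e0; lra.
pose t i := e' / i.+2%:R.
have t0 i : 0 < t i by rewrite divr_gt0.
have te i : t i < e'.
  by rewrite ltr_pdivrMr// ltr_pMr// ltr1n.
have [e'e e'2] : e' <= e /\ e' <= 2^-1 by split; rewrite ge_min lexx ?orbT.
have ker i : exists v : 'cV[K]_r, v <> 0 /\ (M + rsc (t i) E) *m v = 0.
  apply: contrapT => hv; apply: hno; exists (t i); split=> //; first exact: lt_le_trans e'e.
  have [|L' hL'] := @inj_linv _ _ _ _ (M + rsc (t i) E).
    by move=> z hz; apply: contrapT => z0; apply: hv; exists z.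
  by exists L'; split => //; exact: linv_inv2.
have [v hv] := choice ker.
(* From L M + L E = 1 and (M + t E) v = 0 one gets v = (1 - t) L E v, so the kernel vectors are
   eigenvectors of the single matrix L E. *)
pose lam i := (1 - t i)^-1.
have tlt1 i : t i < 1 by have := te i; lra.
have lam_inj : injective lam.
  move=> i j /invr_inj /(congr1 (fun x : R => 1 - x)); rewrite !subKr /t.
  move/(mulfI (lt0r_neq0 e'0))/invr_inj/eqP; rewrite eqr_nat => /eqP; by case.
have hX i : (L *m E) *m v i = rsc (lam i) (v i).
  have [_ h] := hv i.
  have h1 : L *m M + L *m E = 1%:M by rewrite -mulmxDr.
  have h2 : v i = rsc (1 - t i) (L *m E *m v i).
    have h3 : L *m M *m v i + rsc (t i) (L *m E *m v i) = 0.
      by rewrite -rscAl -rscAr -mulmxDl -mulmxDr -mulmxA h mulmx0.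
    rewrite rscDl rsc1 rscNl -[v i in LHS]mul1mx -h1 mulmxDl addrC.
    by move/eqP: h3; rewrite addr_eq0 => /eqP ->.
  rewrite {2}h2 rscM /lam mulVf ?rsc1//.
  by rewrite subr_eq0 eq_sym; apply: contraTneq (tlt1 i) => ->; rewrite ltxx.
have indep := eigen_indep lam_inj hX (fun i => (hv i).1) (m := r.+1).
(* The r + 1 independent eigenvectors would be the columns of an injective matrix with only r
   rows. *)
have [|L' hL'] := @inj_linv _ _ _ _ (\matrix_(i < r, j < r.+1) v j i 0).
  move=> z hz; apply/matrixP => i j; rewrite !ord1 [RHS]mxE.
  pose c x := if insub x is Some y then z (y : 'I_r.+1) 0 else 0.
  have ci (x : 'I_r.+1) : c x = z x 0 by rewrite /c valK.
  rewrite -ci; apply: indep => //.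
  rewrite -[RHS]hz; apply/matrixP => x y; rewrite !ord1 summxE !mxE.
  by apply: eq_bigr => s _; rewrite !mxE big_ord1 !mxE eqxx mulr1n ci.
by have := linv_le hL'; rewrite ltnn.
Qed.

Lemma closure_fst n r (Z : set (subsp K n)) (F E : 'M[K]_(n, r)) : frames F ->
  (forall e : R, 0 < e -> exists t, [/\ 0 < t, t < e, frames (F + rsc t E) &
     Z (colspan (F + rsc t E))]) -> closure Z (colspan F).
Proof.
move=> fF h U; rewrite nbhsE => -[V [oV VF] VU].
have [e e0 he] := (subsp_openP V).2 oV _ _ fF VF.
have [d d0 hd] := small_mul (mnorm_ge0 E) e0.
have [t [t0 td ft Zt]] := h _ d0; exists (colspan (F + rsc t E)); split => //.
apply: VU; apply: he => //; rewrite addrC addKr; apply: le_lt_trans (mnorm_rsc _ _) _.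
by rewrite ger0_norm ?ltW// mulrC; apply: hd => //; exact: ltW.
Qed.

Lemma closure_pair n r s (Z : set (subsp K n * subsp K n)) (F E : 'M[K]_(n, r)) (F' E' : 'M[K]_(n, s)) :
  frames F -> frames F' ->
  (forall e : R, 0 < e -> exists t, [/\ 0 < t, t < e, frames (F + rsc t E) /\ frames (F' + rsc t E') &
     Z (colspan (F + rsc t E), colspan (F' + rsc t E'))]) -> closure Z (colspan F, colspan F').
Proof.
move=> fF fF' h U [[U1 U2] /= [n1 n2] hU].
move: n1 n2; rewrite !nbhsE => -[V1 [oV1 V1s] VU1] [V2 [oV2 V2s] VU2].
have [e1 e10 he1] := (subsp_openP V1).2 oV1 _ _ fF V1s.
have [e2 e20 he2] := (subsp_openP V2).2 oV2 _ _ fF' V2s.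
have [d1 d10 hd1] := small_mul (mnorm_ge0 E) e10.
have [d2 d20 hd2] := small_mul (mnorm_ge0 E') e20.
have [d d0 hd] := min_gt0 d10 d20.
have [t [t0 /hd[td1 td2] [ft ft'] Zt]] := h _ d0.
exists (colspan (F + rsc t E), colspan (F' + rsc t E')); split => //; apply: hU.
split => /=; [apply: VU1|apply: VU2].
  apply: he1 => //; rewrite addrC addKr; apply: le_lt_trans (mnorm_rsc _ _) _.
  by rewrite ger0_norm ?ltW// mulrC; apply: hd1 => //; exact: ltW.
apply: he2 => //; rewrite addrC addKr; apply: le_lt_trans (mnorm_rsc _ _) _.
by rewrite ger0_norm ?ltW// mulrC; apply: hd2 => //; exact: ltW.
Qed.

Lemma row_mx_inv2 n r1 r2 (F1 : 'M[K]_(n, r1)) (F2 : 'M[K]_(n, r2)) L :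
  L *m row_mx F1 F2 = 1%:M -> row_mx F1 F2 *m L = 1%:M ->
  [/\ frames F1, frames F2 & direct_sum (colspan F1) (colspan F2)].
Proof.
rewrite -[L]vsubmxK mul_col_row mul_row_col scalar_mx_block => /eq_block_mx[e1 e2 e3 e4] e5.
split; [by apply/frames_linv; exists (usubmx L)|by apply/frames_linv; exists (dsubmx L)|].
exact: (frames_direct_sum e1 e3 e2 e5).
Qed.

Lemma direct_sum_row_mx n r1 r2 (F1 : 'M[K]_(n, r1)) (F2 : 'M[K]_(n, r2)) :
  frames F1 -> frames F2 -> direct_sum (colspan F1) (colspan F2) ->
  exists L, L *m row_mx F1 F2 = 1%:M /\ row_mx F1 F2 *m L = 1%:M.
Proof.
move=> /frames_linv[M1 MF1] /frames_linv[M2 MF2] [h0 hs].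
have [L LM] : exists L, L *m row_mx F1 F2 = 1%:M.
  apply: inj_linv => z; rewrite -[z]vsubmxK mul_row_col => hz.
  have h1 : F1 *m usubmx z = 0.
    apply: h0; first by apply/colspanP; exists (usubmx z).
    apply/colspanP; exists (- dsubmx z); rewrite mulmxN; apply/eqP.
    by rewrite eq_sym -subr_eq0 opprK hz.
  have h2 : F2 *m dsubmx z = 0 by rewrite -hz h1 add0r.
  by rewrite -[usubmx z]mul1mx -[dsubmx z]mul1mx -MF1 -MF2 -!mulmxA h1 h2 !mulmx0 col_mx0.
exists L; split=> //; apply: mulmx_ext => v.
have [_ [_ [/colspanP[a <-] /colspanP[b' <-] ->]]] := hs v.
by rewrite -mul_row_col mul1mx -mulmxA (mulmxA L) LM mul1mx.
Qed.

Lemma direct_sum_dim n r1 r2 (F1 : 'M[K]_(n, r1)) (F2 : 'M[K]_(n, r2)) :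
  frames F1 -> frames F2 -> direct_sum (colspan F1) (colspan F2) -> (r1 + r2)%N = n.
Proof. by move=> f1 f2 /(direct_sum_row_mx f1 f2)[L [h1 h2]]; exact: inv2_dim h1 h2. Qed.

Lemma rsc_row_mx n r1 r2 t (A : 'M[K]_(n, r1)) (B : 'M[K]_(n, r2)) :
  rsc t (row_mx A B) = row_mx (rsc t A) (rsc t B).
Proof. exact: scale_row_mx. Qed.

Lemma complement_dim n r1 r2 (F1 : 'M[K]_(n, r1)) (F2 : 'M[K]_(n, r2)) :
  frames F1 -> frames F2 -> (r1 + r2)%N = n ->
  (forall v, subsp_set (colspan F1) v -> subsp_set (colspan F2) v -> v = 0) ->
  direct_sum (colspan F1) (colspan F2).
Proof.
move=> /frames_linv[M1 MF1] /frames_linv[M2 MF2] hn h0.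
have [L LM] : exists L, L *m row_mx F1 F2 = 1%:M.
  apply: inj_linv => z; rewrite -[z]vsubmxK mul_row_col => hz.
  have h1 : F1 *m usubmx z = 0.
    apply: h0; first by apply/colspanP; exists (usubmx z).
    apply/colspanP; exists (- dsubmx z); rewrite mulmxN; apply/eqP.
    by rewrite eq_sym -subr_eq0 opprK hz.
  have h2 : F2 *m dsubmx z = 0 by rewrite -hz h1 add0r.
  by rewrite -[usubmx z]mul1mx -[dsubmx z]mul1mx -MF1 -MF2 -!mulmxA h1 h2 !mulmx0 col_mx0.
by have [] := row_mx_inv2 LM (linv_inv2 LM hn).
Qed.

Lemma direct_sum_sym n (P Q : set 'cV[K]_n) : direct_sum P Q -> direct_sum Q P.
Proof.
move=> [h1 h2]; split; first by move=> v Qv Pv; exact: h1.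
by move=> v; have [x [y [Px Qy ->]]] := h2 v; exists y, x; split=> //; rewrite addrC.
Qed.

(** The complements of the span of [X] form an affine space with origin [Y]: each is the graph of a
    map from the span of [Y] to that of [X]. *)
Lemma complement_shear n r m s (Y : 'M[K]_(n, r)) (X : 'M[K]_(n, m)) (F : 'M[K]_(n, s)) :
  frames Y -> frames X -> frames F -> direct_sum (colspan Y) (colspan X) ->
  direct_sum (colspan F) (colspan X) -> exists C, colspan (Y + X *m C) = colspan F.
Proof.
move=> fY fX fF dYX dFX.
have [L [LM ML]] := direct_sum_row_mx fF fX dFX.
have [L' [LM' ML']] := direct_sum_row_mx fY fX dYX.
move: LM ML; rewrite -[L]vsubmxK mul_col_row mul_row_col scalar_mx_block => /eq_block_mx[e1 e2 e3 e4] e5.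
move: LM' ML'; rewrite -[L']vsubmxK mul_col_row mul_row_col scalar_mx_block => /eq_block_mx[e1' e2'
  e3' e4'] e5'.
exists (- (dsubmx L *m Y)).
have -> : Y + X *m - (dsubmx L *m Y) = F *m (usubmx L *m Y).
  by rewrite mulmxN -{1}[Y]mul1mx -e5 mulmxDl !mulmxA addrK.
apply: (@colspan_mul _ _ _ _ _ _ _ (usubmx L' *m F)).
rewrite mulmxA -(mulmxA (usubmx L)) -[RHS]e1 -[in RHS](mul1mx F) -e5' mulmxDl mulmxDr.
by rewrite !mulmxA e2 !mul0mx addr0.
Qed.

End Pencil.

(** * Hyperbolic bases and maximal isotropic subspaces *)

Section Hyperbolic.
Variables (R : realType) (k : scalars) (n : nat) (b sg : bool).
Local Notation K := (scal R k).
Variables (A Ai : 'M[K]_n).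
Hypothesis hA : is_mform b sg A Ai.
Let ok := mf_ok hA.

(** The first three fields make [adj b X *m A] and [sgm sg (adj b F *m A)] the two blocks of a left
    inverse of [row_mx F X]; [hypI] says that it is also a right inverse, so that the columns
    span. *)
Record hyperbolic r (F X : 'M[K]_(n, r)) : Prop := Hyperbolic {
  hypF : adj b F *m A *m F = 0;
  hypX : adj b X *m A *m X = 0;
  hypXF : adj b X *m A *m F = 1%:M;
  hypI : F *m (adj b X *m A) + sgm sg (X *m (adj b F *m A)) = 1%:M }.

Lemma gram_sym r s (F : 'M[K]_(n, r)) (X : 'M[K]_(n, s)) :
  adj b F *m A *m X = sgm sg (adj b (adj b X *m A *m F)).
Proof. by rewrite !adjM// adjK (mf_adj hA) sgm_mull sgm_mulr sgmK mulmxA. Qed.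

Lemma hypFX r (F X : 'M[K]_(n, r)) : hyperbolic F X -> adj b F *m A *m X = sgm sg 1%:M.
Proof. by move=> h; rewrite gram_sym (hypXF h) adjmx1. Qed.

Lemma hyp_swap r (F X : 'M[K]_(n, r)) : hyperbolic F X -> hyperbolic X (sgm sg F).
Proof.
move=> h; split; rewrite ?sgm_adj ?sgm_mull ?sgm_mulr ?(hypF h) ?(hypX h) ?(hypFX h) ?sgmK ?sgm0 //.
rewrite -[RHS](hypI h) addrC; congr (_ + _); rewrite ?sgm_mull ?sgmK //.
Qed.

Lemma hyp_linv r (F X : 'M[K]_(n, r)) : hyperbolic F X -> adj b X *m A *m F = 1%:M /\
  sgm sg (adj b F *m A) *m X = 1%:M.
Proof. by move=> h; rewrite (hypXF h) sgm_mull (hypFX h) sgmK. Qed.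

Lemma hyp_frames r (F X : 'M[K]_(n, r)) : hyperbolic F X -> frames F /\ frames X.
Proof.
by move=> /hyp_linv[h1 h2]; split; apply/frames_linv; [exists (adj b X *m A)|exists (sgm sg (adj b F *m A))].
Qed.

Lemma hyp_direct_sum r (F X : 'M[K]_(n, r)) : hyperbolic F X -> direct_sum (colspan F) (colspan X).
Proof.
move=> h; have [h1 h2] := hyp_linv h.
apply: (frames_direct_sum (L1 := adj b X *m A) (L2 := sgm sg (adj b F *m A))) => //.
- by rewrite sgm_mull (hypF h) sgm0.
- exact: hypX h.
- by rewrite sgm_mulr (hypI h).
Qed.

Lemma hyp_dim r (F X : 'M[K]_(n, r)) : hyperbolic F X -> (r + r)%N = n.
Proof.
by move=> h; have [f1 f2] := hyp_frames h; exact: direct_sum_dim f1 f2 (hyp_direct_sum h).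
Qed.

Lemma hyp_isotropic r (F X : 'M[K]_(n, r)) : hyperbolic F X ->
  isotropic (mform b A) (colspan F) /\ isotropic (mform b A) (colspan X).
Proof. by move=> h; split; apply/isotropic_mform => //; [exact: hypF h|exact: hypX h]. Qed.

Lemma hyp_max r (F X : 'M[K]_(n, r)) : hyperbolic F X ->
  max_isotropic (mform b A) (colspan F) /\ max_isotropic (mform b A) (colspan X).
Proof.
move=> h; have [i1 i2] := hyp_isotropic h; have d := hyp_direct_sum h.
have nd := mform_nondegenerate hA; have bi := mform_biadditive b A.
split; first exact: split_max_isotropic i2 d.
exact: split_max_isotropic i1 (direct_sum_sym d).
Qed.

(** Adding F T to [X] adds T + sgm sg (adj b T) to the Gram matrix of [X], which the condition on
    [T] makes 0; the pairing with [F] does not change since [F] is isotropic. *)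
Lemma hyp_shear r (F X : 'M[K]_(n, r)) (T : 'M[K]_r) : hyperbolic F X ->
  adj b T = - sgm sg T -> hyperbolic F (X + F *m T).
Proof.
move=> h hT.
have hXF : adj b (X + F *m T) *m A *m F = 1%:M.
  rewrite adjD adjM// !mulmxDl (hypXF h) -(mulmxA (adj b T)) -(mulmxA (adj b T)).
  by rewrite (hypF h) mulmx0 addr0.
split=> //; first exact: hypF h.
- rewrite mulmxDr mulmxA hXF mul1mx adjD adjM// !mulmxDl (hypX h) add0r.
  rewrite -(mulmxA (adj b T)) -(mulmxA (adj b T)) (hypFX h).
  by rewrite sgm_mulr mulmx1 hT; case: (sg) => /=; abel.
- rewrite adjD adjM// !mulmxDl !mulmxDr -[RHS](hypI h) hT.
  have -> : sgm sg (X *m (adj b F *m A) + F *m T *m (adj b F *m A)) =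
    sgm sg (X *m (adj b F *m A)) + sgm sg (F *m T *m (adj b F *m A)).
    by case: (sg) => //=; abel.
  by case: (sg); rewrite /= ?mulNmx ?mulmxN ?opprK ?mulmxA; abel.
Qed.

(** Two complementary isotropic subspaces are in duality: their pairing [G] is invertible, its
    inverse being an off-diagonal block of A^-1 in the coordinates [L1], [L2]. Rescaling [F2] by
    [adj b Gi] makes it the dual basis of [F1]. *)
Lemma hyp_exists (P Q : subsp K n) : direct_sum P Q -> isotropic (mform b A) P ->
  isotropic (mform b A) Q ->
  exists r (F X : 'M[K]_(n, r)), [/\ hyperbolic F X, P = colspan F & Q = colspan X].
Proof.
move=> ds; have [r1 [r2 [F1 [L1 [F2 [L2 [[-> -> LF1 LF2] [LF12 LF21 FL]]]]]]]] := direct_sum_frames ds.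
move=> /(isotropic_mform _ _ ok) i1 /(isotropic_mform _ _ ok) i2.
set G := adj b F2 *m A *m F1; pose Gi := L1 *m Ai *m adj b L2.
have GGi : G *m Gi = 1%:M.
  rewrite /G /Gi !mulmxA -(mulmxA _ F1 L1); have -> : F1 *m L1 = 1%:M - F2 *m L2 by rewrite -FL; abel.
  rewrite mulmxBr mulmx1 !mulmxA i2 mul0mx subr0 -(mulmxA _ A) (mf_r hA) mulmx1 -adjM//.
  by rewrite LF2 adjmx1.
have GiG : Gi *m G = 1%:M.
  have e : adj b L2 *m adj b F2 = 1%:M - adj b L1 *m adj b F1.
    by rewrite -!adjM// -[X in X - _](adjmx1 R k b) -FL adjD; abel.
  rewrite /G /Gi !mulmxA -(mulmxA _ (adj b L2)) e mulmxBr mulmx1 !mulmxBl !mulmxA.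
  rewrite -(mulmxA _ (adj b F1)) -(mulmxA _ (adj b F1 *m A)) i1 mulmx0 subr0.
  by rewrite -(mulmxA L1) (mf_l hA) mulmx1 LF1.
have e12 := inv2_dim GGi GiG; subst r2.
exists r1, F1, (F2 *m adj b Gi).
have XF : adj b (F2 *m adj b Gi) *m A *m F1 = 1%:M.
  by rewrite (adjM F2 _ ok) adjK -(mulmxA Gi) -(mulmxA Gi) -/G GiG.
have FX : adj b F1 *m A *m (F2 *m adj b Gi) = sgm sg 1%:M by rewrite gram_sym XF adjmx1.
have cs : colspan (F2 *m adj b Gi) = colspan F2.
  by apply: (@colspan_mul _ _ _ _ _ _ _ (adj b G)); rewrite -adjM// GGi adjmx1.
have XX : adj b (F2 *m adj b Gi) *m A *m (F2 *m adj b Gi) = 0.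
  by rewrite adj_sandwich// i2 mulmx0 mul0mx.
split=> //; split=> //.
set X := F2 *m adj b Gi in XF FX XX cs *.
have F2X : F2 = X *m adj b G by rewrite -mulmxA -adjM// GGi adjmx1 mulmx1.
set Z := _ + _; rewrite -[Z]mulmx1 -FL mulmxDr !mulmxA.
have -> : Z *m F1 = F1.
  by rewrite mulmxDl -mulmxA XF mulmx1 sgm_mull -mulmxA i1 mulmx0 sgm0 addr0.
have -> : Z *m F2 = F2; last by [].
rewrite F2X mulmxA; congr (_ *m _).
by rewrite mulmxDl -mulmxA XX mulmx0 add0r sgm_mull -mulmxA FX sgm_mulr mulmx1 sgmK.
Qed.

(** The span of [y] and [u] is isotropic, so maximality of [y] applies to it. *)
Lemma sub_max_isotropic (y : subsp K n) u : max_isotropic (mform b A) y ->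
  mform b A u u = 0 -> (forall v, subsp_set y v -> mform b A v u = 0) -> subsp_set y u.
Proof.
move=> [iy my] uu yu.
have uy v : subsp_set y v -> mform b A u v = 0.
  move=> yv; rewrite /mform gram_sym; have := yu _ yv; rewrite /mform => h.
  have -> : adj b u *m A *m v = 0 by apply/matrixP => i j; rewrite !ord1 h mxE.
  by rewrite adj0 sgm0 mxE.
have [bl br] := mform_biadditive b A.
pose P (x : 'cV[K]_n) := exists v c, subsp_set y v /\ x = v + u *m (c : 'M[K]_1).
have P0 : P 0 by exists 0, 0; split; [exact: subsp0|rewrite mulmx0 addr0].
have PD v w : P v -> P w -> P (v + w).
  move=> [v1 [c1 [h1 ->]]] [v2 [c2 [h2 ->]]]; exists (v1 + v2), (c1 + c2).
  by split; [exact: subspD|rewrite mulmxDr; abel].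
have PZ v c : P v -> P (v *m c%:M).
  move=> [v1 [c1 [h1 ->]]]; exists (v1 *m c%:M), (c1 *m c%:M).
  by split; [exact: subspZ|rewrite mulmxDl mulmxA].
have iP : isotropic (mform b A) (Subsp P0 PD PZ).
  move=> _ _ [v [c [yv ->]]] [w [d [yw ->]]].
  have z (M : 'M[K]_1) : M 0 0 = 0 -> M = 0.
    by move=> h; apply/matrixP => i j; rewrite !ord1 h mxE.
  have e1 : adj b u *m A *m u = 0 by apply: z.
  have e2 : adj b u *m A *m v = 0 by apply: z; exact: yu.
  have e3 : adj b w *m A *m u = 0 by apply: z; exact: uy.
  have e4 : adj b w *m A *m v = 0 by apply: z; exact: (iy v w yv yw).
  rewrite /mform adjD adjM// mulmxDr !mulmxDl !mulmxA -!(mulmxA (adj b d)) e1 e2 e3 e4.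
  by rewrite !(mulmx0, mul0mx, addr0) mxE.
apply: (my (Subsp P0 PD PZ) iP).
  by move=> v yv; exists v, 0; split=> //; rewrite mulmx0 addr0.
by exists 0, 1%:M; split; [exact: subsp0|rewrite mulmx1 add0r].
Qed.

(** Let U be the sum of [y] and the span of [F]. A vector orthogonal to U lies in the span of [F],
    hence is isotropic, hence lies in [y] and is orthogonal to [v]; so [v] lies in U by double
    orthogonality. Its component in the span of [F] is again isotropic and orthogonal to [y], thus
    in [y]. *)
Lemma max_isotropic_perp r (F X : 'M[K]_(n, r)) (y : subsp K n) v : hyperbolic F X ->
  max_isotropic (mform b A) y -> (forall w, subsp_set y w -> mform b A w v = 0) -> subsp_set y v.
Proof.
move=> h my yv; have [bl br] := mform_biadditive b A.
pose U (x : 'cV[K]_n) := exists w a, subsp_set y w /\ x = w + F *m a.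
have [|||s [M [L [LM hU]]]] := @module_basis _ _ _ U.
- by exists 0, 0; split; [exact: subsp0|rewrite mulmx0 addr0].
- move=> _ _ [w [a [yw ->]]] [w' [a' [yw' ->]]]; exists (w + w'), (a + a').
  by split; [exact: subspD|rewrite mulmxDr; abel].
- move=> _ c [w [a [yw ->]]]; exists (w *m c%:M), (a *m c%:M).
  by split; [exact: subspZ|rewrite mulmxDl mulmxA].
pose N := 1%:M - M *m L.
have NM : N *m M = 0 by rewrite mulmxBl mul1mx -mulmxA LM mulmx1 subrr.
have NU x : U x -> N *m x = 0 by move=> /hU[z <-]; rewrite mulmxA NM mul0mx.
have perpF (w : 'cV[K]_n) : adj b F *m A *m w = 0 -> exists a, w = F *m a.
  move=> hw; exists (adj b X *m A *m w).
  by rewrite -[LHS]mul1mx -(hypI h) mulmxDl sgm_mull -mulmxA -(mulmxA X) hw mulmx0 sgm0 addr0 mulmxA.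
(* [w] is chosen with adj b w A = adj b u N. As [N] kills U, [w] is orthogonal to U, and
   orthogonality of [w] and [v] reads off an arbitrary value of N v. *)
have Nv : N *m v = 0.
  apply: (mform_ext (b := b)) => x u; rewrite mulmx0 mul0mx [RHS]mxE.
  pose w := adj b (adj b u *m N *m Ai).
  have wU z : U z -> mform b A z w = 0.
    by move=> Uz; rewrite /mform adjK -(mulmxA _ Ai) (mf_l hA) mulmx1 -mulmxA NU// mulmx0 mxE.
  have [a wa] : exists a, w = F *m a.
    apply: perpF; apply: (mform_ext (b := b)) => z1 z2; rewrite mulmx0 mul0mx [RHS]mxE.
    rewrite -[LHS]mul1r -[z1]mulmx1.
    have -> : adj b z2 *m (adj b F *m A *m w) *m (z1 *m 1%:M) =
       adj b (F *m z2) *m A *m w *m z1 by rewrite mulmx1 adjM// !mulmxA.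
    rewrite gram_sym (_ : adj b w *m A *m (F *m z2) = 0); last first.
      apply/matrixP => i j; rewrite !ord1 [RHS]mxE; apply: wU.
      by exists 0, z2; split; [exact: subsp0|rewrite add0r].
    by rewrite adj0 sgm0 mul0mx mxE mulr0.
  have yw : subsp_set y w.
    apply: (sub_max_isotropic my).
      by rewrite wa /mform adj_sandwich// (hypF h) mulmx0 mul0mx mxE.
    by move=> z yz; apply: wU; exists z, 0; split=> //; rewrite mulmx0 addr0.
  have : adj b w *m A *m v = 0.
    rewrite gram_sym (_ : adj b v *m A *m w = 0) ?adj0 ?sgm0//.
    by apply/matrixP => i j; rewrite !ord1 [RHS]mxE; exact: yv.
  rewrite /w adjK -(mulmxA _ Ai) (mf_l hA) mulmx1 => e.
  by rewrite mulmxA e mul0mx mxE.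
have [w [a [yw vE]]] : U v.
  apply/hU; exists (L *m v); move: Nv; rewrite mulmxBl mul1mx mulmxA.
  by move/eqP; rewrite subr_eq0 => /eqP.
have yFa : subsp_set y (F *m a).
  apply: (sub_max_isotropic my).
    by rewrite /mform adj_sandwich// (hypF h) mulmx0 mul0mx mxE.
  move=> z yz; have := yv z yz; rewrite vE br.
  by rewrite (my.1 z w yz yw) add0r.
by rewrite vE; exact: subspD.
Qed.

(** A dual family [X1] of a basis of [y] is made isotropic by adding vectors of [y]. The two
    families span: what remains after projection is orthogonal to [Y], so lies in [y] by
    [max_isotropic_perp], and pairs to 0 with the dual family. *)
Lemma max_hyp r0 (F0 X0 : 'M[K]_(n, r0)) (y : subsp K n) : hyperbolic F0 X0 ->
  max_isotropic (mform b A) y ->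
  exists r (Y X : 'M[K]_(n, r)), hyperbolic Y X /\ y = colspan Y.
Proof.
move=> h0 my; have perp v := max_isotropic_perp (v := v) h0 my.
have [r [Y [M [MY yY]]]] := subsp_frame y; subst y.
have iY : adj b Y *m A *m Y = 0 by apply/isotropic_mform => //; exact: my.1.
pose X1 := Ai *m adj b M.
have YX1 : adj b Y *m A *m X1 = 1%:M.
  by rewrite /X1 mulmxA -(mulmxA _ A) (mf_r hA) mulmx1 -adjM// MY adjmx1.
pose S := adj b X1 *m A *m X1.
have SE : adj b S = sgm sg S by rewrite [S in RHS]gram_sym sgmK.
(* The two cross terms contribute - S / 2 each and cancel the Gram matrix [S] of [X1]. *)
pose C := rsc 2^-1 (- sgm sg S).
pose X := X1 + Y *m C.
have YX : adj b Y *m A *m X = 1%:M by rewrite /X mulmxDr YX1 mulmxA iY mul0mx addr0.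
have XX : adj b X *m A *m X = 0.
  have XY : adj b X *m A *m Y = sgm sg 1%:M by rewrite gram_sym YX adjmx1.
  have XX1 : adj b X *m A *m X1 = S + adj b C.
    rewrite /X adjD (adjM _ _ ok) !mulmxDl -/S; congr (_ + _).
    by rewrite -(mulmxA (adj b C)) -(mulmxA (adj b C)) YX1 mulmx1.
  rewrite {2}/X mulmxDr mulmxA XY XX1 sgm_mull mul1mx /C adj_rsc adjN sgm_adj SE sgmK.
  have -> : sgm sg (rsc 2^-1 (- sgm sg S)) = rsc 2^-1 (- S) by case: (sg); rewrite /= ?rscN ?opprK.
  rewrite -addrA -rscDl (_ : 2^-1 + 2^-1 = 1); last by lra.
  by rewrite rsc1 subrr.
exists r, Y, (sgm sg X); split=> //; split=> //.
- by rewrite sgm_adj !sgm_mull sgm_mulr sgmK XX.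
- by rewrite gram_sym sgm_mulr YX sgm_adj adjmx1 sgmK.
have XY : adj b (sgm sg X) *m A *m Y = 1%:M.
  by rewrite gram_sym sgm_mulr YX sgm_adj adjmx1 sgmK.
apply: mulmx_ext => v; rewrite mul1mx; set Z := _ + _.
suff : v - Z *m v = 0 by move/eqP; rewrite subr_eq0 eq_sym => /eqP.
have YZ : adj b Y *m A *m (v - Z *m v) = 0.
  rewrite mulmxBr (mulmxA _ Z) (_ : adj b Y *m A *m Z = adj b Y *m A) ?subrr//.
  by rewrite /Z mulmxDr (mulmxA _ Y) iY mul0mx add0r sgm_mull sgmK (mulmxA _ X) YX mul1mx.
have XZ : adj b (sgm sg X) *m A *m (v - Z *m v) = 0.
  rewrite mulmxBr (mulmxA _ Z).
  rewrite (_ : adj b (sgm sg X) *m A *m Z = adj b (sgm sg X) *m A) ?subrr//.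
  rewrite /Z mulmxDr (mulmxA _ Y) XY mul1mx sgm_mull sgmK (mulmxA _ X).
  by rewrite sgm_adj !sgm_mull XX mul0mx sgm0 addr0.
have /colspanP[z hz] : subsp_set (colspan Y) (v - Z *m v).
  apply: perp => w /colspanP[c <-]; rewrite /mform.
  set u := v - _ in YZ *; rewrite (_ : adj b u *m A *m (Y *m c) = 0) ?mxE//.
  by rewrite mulmxA gram_sym YZ adj0 sgm0 mul0mx.
by rewrite -hz -[z]mul1mx -XY -(mulmxA _ Y) hz XZ mulmx0.
Qed.

End Hyperbolic.

(** The first hypothesis makes the closure of [C] relatively open in [Z] as well as closed, so it
    contains every connected subset of [Z] that it meets. *)
Lemma component_closure (T : topologicalType) (Z I C : set T) :
  (forall z, Z z -> closure C z -> exists W, [/\ open W, W z & forall q, W q -> Z q -> closure C q]) ->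
  I `<=` closure C -> forall x, Z x -> connected_component Z x `&` I !=set0 -> closure C x.
Proof.
move=> h IC x Zx [q [[D [Dx DZ cD] Dq] Iq]].
pose W := \bigcup_(V in [set V | open V /\ (V `&` Z `<=` closure C)]) V.
have oW : open W by apply: bigcup_open => V [].
have e1 : D `&` closure C = D `&` W.
  apply/seteqP; split => z [Dz hz]; split=> //.
    have [V [oV Vz hV]] := h z (DZ _ Dz) hz.
    by exists V => //; split=> // t [Vt Zt]; exact: hV.
  by case: hz => V [oV hV] Vz; apply: hV; split=> //; exact: DZ.
have : D `&` closure C = D.
  apply: cD.
  - by exists q; split=> //; exact: IC.
  - by exists W.
  - by exists (closure C); [exact: closed_closure|].
by move=> e; have [] : (D `&` closure C) x by rewrite e.
Qed.

(** * Isotropic complements common to two subspaces *)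

Section Transverse.
Variables (R : realType) (k : scalars) (n : nat) (b sg : bool).
Local Notation K := (scal R k).
Variables (A Ai : 'M[K]_n).
Hypothesis hA : is_mform b sg A Ai.
Let ok := mf_ok hA.
Local Notation hyperbolic := (hyperbolic b sg A).

(** [X *m E] is a basis of the intersection of [y] with the span of [X]. Pairing a vector (X + F T)
    a of [y] with this basis gives S L a = 0, so T a = 0 and the vector is X a: the shear leaves
    only the part of the old intersection on which [S] vanishes. *)
Lemma shear_transverse r w (F X : 'M[K]_(n, r)) (y : subsp K n) (E : 'M[K]_(r, w))
  (L : 'M[K]_(w, r)) (S : 'M[K]_w) : hyperbolic F X -> isotropic (mform b A) y ->
  L *m E = 1%:M -> (forall a, subsp_set y (X *m a) <-> exists z, E *m z = a) ->
  adj b S = - sgm sg S ->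
  let X' := X + F *m (adj b L *m S *m L) in
  hyperbolic F X' /\ (forall v, subsp_set (colspan X') v -> subsp_set y v ->
    exists z, v = X *m E *m z /\ S *m z = 0).
Proof.
move=> h iy LE hE hS /=; set T := adj b L *m S *m L.
have hT : adj b T = - sgm sg T.
  by rewrite /T !adjM// adjK hS mulNmx mulmxN mulmxA sgm_mulr sgm_mull.
split; first exact: (hyp_shear hA h hT).
move=> _ /colspanP[a <-] ya.
have SL : S *m (L *m a) = 0.
  apply: (mform_ext (b := b)) => x z; rewrite mulmx0 mul0mx [RHS]mxE.
  have yE : subsp_set y (X *m (E *m z)) by apply/hE; exists z.
  rewrite -[LHS]/((adj b z *m (S *m (L *m a)) *m x) 0 0).
  rewrite [x]mx11_scalar (_ : adj b z *m (S *m (L *m a)) = 0) ?mul0mx ?mxE//.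
  have e : adj b (X *m (E *m z)) *m A *m ((X + F *m T) *m a) = 0.
    by apply/matrixP => i j; rewrite !ord1 [RHS]mxE; exact: (iy _ _ ya yE).
  have eT : adj b X *m A *m (X + F *m T) = T.
    by rewrite mulmxDr (hypX h) add0r mulmxA (hypXF h) mul1mx.
  rewrite -[RHS]e adj_sandwich// eT (adjM E z ok).
  have -> : adj b z *m adj b E *m T = adj b z *m (adj b E *m adj b L) *m S *m L.
    by rewrite /T !mulmxA.
  by rewrite -adjM// LE adjmx1 mulmx1 !mulmxA.
have Ta : T *m a = 0 by rewrite /T -!mulmxA SL mulmx0.
have Xa : (X + F *m T) *m a = X *m a by rewrite mulmxDl -mulmxA Ta mulmx0 addr0.
rewrite Xa in ya *; have /hE[z hz] := ya; exists z; rewrite -mulmxA hz; split => //.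
by move: SL; rewrite -hz (mulmxA L) LE mul1mx.
Qed.

Lemma intersection_basis r (X : 'M[K]_(n, r)) (y : subsp K n) :
  exists w (E : 'M[K]_(r, w)) (L : 'M[K]_(w, r)), L *m E = 1%:M /\
    forall a, subsp_set y (X *m a) <-> exists z, E *m z = a.
Proof.
apply: module_basis => [|v v' h1 h2|v c h].
- by rewrite mulmx0; exact: subsp0.
- by rewrite mulmxDr; exact: subspD.
- by rewrite mulmxA; exact: subspZ.
Qed.

Lemma transverse_direct_sum r (F X : 'M[K]_(n, r)) (y : subsp K n) : hyperbolic F X ->
  max_isotropic (mform b A) y -> (forall v, subsp_set (colspan X) v -> subsp_set y v -> v = 0) ->
  direct_sum y (colspan X).
Proof.
move=> h my h0; have [r' [Y [Y' [hY yY]]]] := max_hyp hA h my.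
have [fF fX] := hyp_frames hA h; have [fY _] := hyp_frames hA hY.
have d1 := hyp_dim hA h; have d2 := hyp_dim hA hY.
have rr : r' = r.
  by apply: double_inj; rewrite -!addnn d1 d2.
subst y r'; apply: complement_dim => // v vY vX; exact: h0.
Qed.

(** The shear by the scalar matrix [c] is invertible, so nothing of the intersection survives; this
    needs a unit [c] of symmetry opposite to that of the form. *)
Lemma common_complement r (F X : 'M[K]_(n, r)) (y : subsp K n) (c d : K) : hyperbolic F X ->
  max_isotropic (mform b A) y -> d * c = 1 -> tw b c = - (if sg then - c else c) ->
  exists X', hyperbolic F X' /\ direct_sum y (colspan X').
Proof.
move=> h my dc hc.
have [w [E [L [LE hE]]]] := intersection_basis X y.
have hS : adj b (c%:M : 'M[K]_w) = - sgm sg c%:M.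
  apply/matrixP => i j; rewrite adjE !mxE eq_sym; case: (sg) hc => /=; rewrite !mxE;
  by case: (i == j) => /=; rewrite ?tw0 ?oppr0.
have [h' hX'] := shear_transverse h my.1 LE hE hS.
exists (X + F *m (adj b L *m c%:M *m L)); split=> //.
apply: (transverse_direct_sum h') => // v vX yv; have [z [-> cz]] := hX' v vX yv.
have -> : z = 0 by rewrite -[z]mul1mx -dc scalar_mxM -mulmxA cz mulmx0.
by rewrite mulmx0.
Qed.

(** Here the shear needs adj S = - S. The block matrix [S0] is invertible in even size; in odd size
    it is bordered by zeros and a line of the intersection remains. *)
Lemma common_complement_sym r (F X : 'M[K]_(n, r)) (y : subsp K n) : hyperbolic F X ->
  max_isotropic (mform b A) y -> sg = false ->
  exists X', hyperbolic F X' /\ (direct_sum y (colspan X') \/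
    exists w, [/\ w <> 0, subsp_set y w, subsp_set (colspan X') w
      & forall v, subsp_set (colspan X') v -> subsp_set y v -> exists c : 'M[K]_1, v = w *m c]).
Proof.
move=> h my sg0.
have [w [E [L [LE hE]]]] := intersection_basis X y.
pose S0 u : 'M[K]_(u + u) := block_mx 0 1%:M (- 1%:M) 0.
have S0V u : (- S0 u) *m S0 u = 1%:M.
  rewrite /S0 mulNmx mulmx_block !mul0mx !mulmx0 !mul1mx mulmx1 !add0r !addr0.
  by rewrite scalar_mx_block opp_block_mx opprK oppr0.
have adjb m1 m2 m3 m4 (B1 : 'M[K]_(m1, m3)) (B2 : 'M[K]_(m1, m4)) (B3 : 'M[K]_(m2, m3)) (B4 :
  'M[K]_(m2, m4)) :
    adj b (block_mx B1 B2 B3 B4) = block_mx (adj b B1) (adj b B3) (adj b B2) (adj b B4).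
  by rewrite /adj tr_block_mx map_block_mx.
have S0a u : adj b (S0 u) = - S0 u.
  by rewrite /S0 adjb adjN !adjmx1 !adj0 opp_block_mx opprK !oppr0.
have [u [e|e]] : exists u, w = (u + u)%N \/ w = (1 + (u + u))%N.
  exists w./2; rewrite addnn -{1 3}(odd_double_half w).
  by case: (odd w); [right|left].
- subst w; have hS : adj b (S0 u) = - sgm sg (S0 u) by rewrite S0a sg0.
  have [h' hX'] := shear_transverse h my.1 LE hE hS.
  exists (X + F *m (adj b L *m S0 u *m L)); split=> //; left.
  apply: (transverse_direct_sum h') => // v vX yv; have [z [-> Sz]] := hX' v vX yv.
  have -> : z = 0 by rewrite -[z]mul1mx -(S0V u) -mulmxA Sz mulmx0.
  by rewrite mulmx0.
subst w; pose S1 : 'M[K]_(1 + (u + u)) := block_mx 0 0 0 (S0 u).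
have hS : adj b S1 = - sgm sg S1.
  by rewrite sg0 /= /S1 adjb S0a !adj0 [RHS]opp_block_mx !oppr0.
have [h' hX'] := shear_transverse h my.1 LE hE hS.
exists (X + F *m (adj b L *m S1 *m L)); split=> //; right.
pose e0 : 'cV[K]_(1 + (u + u)) := col_mx 1%:M 0.
have S1e0 : S1 *m e0 = 0.
  by rewrite /S1 /e0 mul_block_col !mul0mx !mulmx0 !addr0 col_mx0.
have fX : frames X by exact: (hyp_frames hA h).2.
exists (X *m (E *m e0)); split.
- have [MX MXE] := (frames_linv X).1 fX.
  move=> /(congr1 (mulmx MX)); rewrite mulmxA MXE mul1mx mulmx0 => /(congr1 (mulmx L)).
  rewrite mulmxA LE mul1mx mulmx0 => /(congr1 usubmx); rewrite col_mxKu => /matrixP/(_ 0 0).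
  by rewrite !mxE eqxx mulr1n => h1; have := oner_neq0 K; rewrite h1 eqxx.
- by apply/hE; exists e0.
- apply/colspanP; exists (E *m e0); rewrite mulmxDl -!mulmxA (mulmxA L) LE mul1mx S1e0.
  by rewrite !mulmx0 addr0.
- move=> v vX yv; have [z [-> Sz]] := hX' v vX yv; exists (usubmx z).
  rewrite -!mulmxA; congr (_ *m (_ *m _)).
  move: Sz; rewrite /S1 -{1 2}[z]vsubmxK mul_block_col !mul0mx !add0r => /(congr1 dsubmx).
  rewrite col_mxKd linear0 => S0z; rewrite /e0 mul_col_mx mul1mx mul0mx.
  by rewrite -[dsubmx z]mul1mx -(S0V u) -mulmxA S0z mulmx0.
Qed.

End Transverse.

(** * Density of the set of pairs in List 1 *)

Section Density.
Variables (R : realType) (k : scalars) (n : nat).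
Local Notation K := (scal R k).

Lemma mop_colspan c se AJ r (F : 'M[K]_(n, r)) : is_mop c se AJ ->
  mop c AJ @` (colspan F) = colspan (AJ *m tws c F).
Proof.
move=> hJ; have ok := mo_ok hJ; apply/seteqP; split => v.
  move=> [_ /colspanP[z <-] <-]; apply/colspanP; exists (tws c z).
  by rewrite /mop twsM// mulmxA.
move=> /colspanP[z <-]; exists (F *m tws c z); first by apply/colspanP; exists (tws c z).
by rewrite /mop twsM// twsK mulmxA.
Qed.

(** J commutes with real scalars, antilinear or not, so the matrix with blocks F + t E and J (F + t
    E) is affine in the real parameter t. *)
Lemma pencil_swap c se AJ r (F E : 'M[K]_(n, r)) : is_mop c se AJ -> frames (F + E) ->
  direct_sum (colspan (F + E)) (mop c AJ @` colspan (F + E)) -> forall e : R, 0 < e ->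
  exists t, [/\ 0 < t, t < e, frames (F + rsc t E) &
    direct_sum (colspan (F + rsc t E)) (mop c AJ @` colspan (F + rsc t E))].
Proof.
move=> hJ fFE ds e e0; have ok := mo_ok hJ.
have fJ : frames (AJ *m tws c (F + E)).
  move/frames_linv: fFE => [L LF]; apply/frames_linv; exists (tws c L *m mopV c se AJ).
  by rewrite mulmxA -(mulmxA _ _ AJ) (mopVK hJ) mulmx1 -twsM// LF tws1.
rewrite (mop_colspan _ hJ) in ds.
have [L [LM ML]] := direct_sum_row_mx fFE fJ ds.
have eM : row_mx (F + E) (AJ *m tws c (F + E)) =
    row_mx F (AJ *m tws c F) + row_mx E (AJ *m tws c E).
  by rewrite add_row_mx twsD mulmxDr.
rewrite eM in LM ML; have [t [t0 te [L' [LM' ML']]]] := pencil LM ML e0.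
have eM' : row_mx F (AJ *m tws c F) + rsc t (row_mx E (AJ *m tws c E)) =
    row_mx (F + rsc t E) (AJ *m tws c (F + rsc t E)).
  by rewrite rsc_row_mx add_row_mx twsD mulmxDr tws_rsc rscAr.
rewrite eM' in LM' ML'; have [f1 _ d1] := row_mx_inv2 LM' ML'.
by exists t; split=> //; rewrite (mop_colspan _ hJ).
Qed.

(** The quadratic terms vanish because [Y] and [X] are isotropic; the cross terms are linear in [t]
    and vanish at t = 1, hence everywhere. *)
Lemma shear_isotropic b (A : 'M[K]_n) r m (Y : 'M[K]_(n, r)) (X : 'M[K]_(n, m)) C t : anti_ok k b ->
  isotropic (mform b A) (colspan Y) -> isotropic (mform b A) (colspan X) ->
  isotropic (mform b A) (colspan (Y + X *m C)) ->
  isotropic (mform b A) (colspan (Y + rsc t (X *m C))).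
Proof.
move=> ok /(isotropic_mform _ _ ok) iY /(isotropic_mform _ _ ok) iX /(isotropic_mform _ _ ok) iS.
apply/isotropic_mform => //.
have iXC : adj b (X *m C) *m A *m (X *m C) = 0 by rewrite adj_sandwich// iX mulmx0 mul0mx.
move: iS iXC; set Z := X *m C => iS iZ.
have iS' : adj b Y *m A *m Z + adj b Z *m A *m Y = 0.
  by rewrite -[RHS]iS adjD !mulmxDl !mulmxDr iY iZ add0r addr0.
rewrite adjD !mulmxDl !mulmxDr adj_rsc !(rscAl, rscAr) iY iZ !rscr0 add0r addr0 -rscD.
by rewrite iS' rscr0.
Qed.

Lemma shear_frames r m (Y : 'M[K]_(n, r)) (X : 'M[K]_(n, m)) C t : frames Y -> frames X ->
  direct_sum (colspan Y) (colspan X) -> frames (Y + rsc t (X *m C)).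
Proof.
move=> fY fX ds; have [L [LM ML]] := direct_sum_row_mx fY fX ds.
move: LM ML; rewrite -[L]vsubmxK mul_col_row mul_row_col scalar_mx_block => /eq_block_mx[e1 e2 e3 e4] e5.
apply/frames_linv; exists (usubmx L).
by rewrite mulmxDr rscAr mulmxA e1 e2 mul0mx rscr0 addr0.
Qed.

Lemma complement_open m (X : 'M[K]_(n, m)) : frames X ->
  open [set Q : subsp K n | direct_sum Q (colspan X)].
Proof.
move=> fX; apply/subsp_openP => r F fF /= ds.
have [L [LM ML]] := direct_sum_row_mx fF fX ds.
have [d d0 hd] := @near_inv R k (r + m) 1 ltr01.
have [d1 d10 hd1] := small_mul (mnorm_ge0 L) d0.
exists d1 => // F' fF' hF'.
have [|M [MA AM _]] := hd (L *m row_mx F' X).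
  rewrite -LM -mulmxBr; apply: le_lt_trans (mnormM _ _) _; apply: hd1; rewrite ?mnorm_ge0//.
  apply: le_lt_trans hF'; rewrite opp_row_mx add_row_mx subrr.
  have -> : row_mx (F' - F) 0 = (F' - F) *m row_mx 1%:M (0 : 'M[K]_(r, m)).
    by rewrite mul_mx_row mulmx1 mulmx0.
  rewrite /mnorm; apply: ler_sum => i _; rewrite big_split_ord /=.
  rewrite [X in _ + X]big1 ?addr0; last first.
    by move=> j _; rewrite mul_mx_row mulmx0 row_mxEr mxE snorm0.
  by apply: ler_sum => j _; rewrite mul_mx_row mulmx1 row_mxEl.
have LM' : (M *m L) *m row_mx F' X = 1%:M by rewrite -mulmxA.
have [] := row_mx_inv2 LM' (linv_inv2 LM' (inv2_dim LM ML)).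
by [].
Qed.

Section List1.
Variables (b sg c se sm : bool) (A Ai AJ : 'M[K]_n).
Hypothesis hA : is_mform b sg A Ai.
Hypothesis hJ : is_mop c se AJ.
Hypothesis hc : mconsistent b c sm A AJ.
Let ok := mf_ok hA.
Let okc := mo_ok hJ.
Let B := mform b A.
Let J := mop c AJ.
Local Notation S := (pairs_BJ B J).
Local Notation hyperbolic := (hyperbolic b sg A).

Lemma isotropic_mop r (F : 'M[K]_(n, r)) : isotropic B (colspan F) ->
  isotropic B (colspan (AJ *m tws c F)).
Proof.
move=> /(isotropic_mform _ _ ok) i; apply/isotropic_mform => //.
by rewrite adj_sandwich// hc sgm_mulr sgm_mull adj_tws -!twsM// i tws0 sgm0.
Qed.

Lemma pairs1_intro r (F : 'M[K]_(n, r)) : isotropic B (colspan F) ->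
  direct_sum (colspan F) (J @` colspan F) -> S (colspan F, colspan (AJ *m tws c F)).
Proof.
move=> i ds; have e := mop_colspan F hJ; have i' := isotropic_mop i.
rewrite /J e in ds; have nd := mform_nondegenerate hA; have bi := mform_biadditive b A.
split=> //=.
- exact: split_max_isotropic i' ds.
- exact: split_max_isotropic i (direct_sum_sym ds).
Qed.

Lemma closure_list1 r m s (Y : 'M[K]_(n, r)) (X : 'M[K]_(n, m)) (F : 'M[K]_(n, s)) Q :
  frames Y -> frames X -> frames F -> direct_sum (colspan Y) (colspan X) ->
  direct_sum (colspan F) (colspan X) -> isotropic B (colspan Y) -> isotropic B (colspan X) ->
  S (colspan F, Q) -> closure ((fun s => s.1) @` S) (colspan Y).
Proof.
move=> fY fX fF dYX dFX iY iX SF.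
have [[iF _] _ ds js] : [/\ max_isotropic B (colspan F), max_isotropic B Q,
  direct_sum (colspan F) Q & J @` (colspan F) = Q] := SF.
have [C hC] := complement_shear fY fX fF dYX dFX.
have fYC := @shear_frames _ _ _ _ C 1 fY fX dYX; rewrite rsc1 in fYC.
apply: (closure_fst (E := X *m C)) => // e e0.
have [|t [t0 te ft dt]] := pencil_swap (E := X *m C) hJ fYC _ e0.
  by rewrite hC js.
exists t; split=> //.
exists (colspan (Y + rsc t (X *m C)), colspan (AJ *m tws c (Y + rsc t (X *m C)))) => //.
apply: pairs1_intro => //; apply: shear_isotropic => //.
by rewrite hC.
Qed.

Lemma pairs1_hyp s : S s -> exists r (F X : 'M[K]_(n, r)),
  [/\ hyperbolic F X, s.1 = colspan F & s.2 = colspan X].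
Proof. by move=> [[i1 _] [i2 _] ds _]; exact: (hyp_exists hA). Qed.

Lemma dense_list1 s (x y : K) : S s -> x * y = 1 -> tw b y = - (if sg then - y else y) ->
  max_isotropic B `<=` closure ((fun s => s.1) @` S).
Proof.
case: s => s1 s2 Ss xy hy q mq; have [r [F [X [h /= e1 e2]]]] := pairs1_hyp Ss; subst s1 s2.
have [X' [h' dq]] := common_complement hA h mq xy hy.
have [r' [Y [Y' [hY qE]]]] := max_hyp hA h mq; subst q.
have [fF _] := hyp_frames hA h; have [fY _] := hyp_frames hA hY; have [_ fX'] := hyp_frames hA h'.
apply: (closure_list1 fY fX' fF dq _ mq.1 _ Ss); first exact: (hyp_direct_sum hA h').
exact: (hyp_isotropic hA h').2.
Qed.

(* The closure of the image is relatively open: a chart around a limit point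
   contains points of the image, and lines in the chart end there. *)
Lemma component_list1 s : S s -> forall q, max_isotropic B q ->
  connected_component (max_isotropic B) q `&` ((fun s => s.1) @` S) !=set0 ->
  closure ((fun s => s.1) @` S) q.
Proof.
move=> Ss; have [r [F [X [h e1 e2]]]] := pairs1_hyp Ss.
apply: component_closure; last exact: subset_closure.
move=> z mz cz; have [rz [Z [Z' [hZ zE]]]] := max_hyp hA h mz; subst z.
have [fZ fZ'] := hyp_frames hA hZ.
have oW := complement_open fZ'.
exists [set Q : subsp K n | direct_sum Q (colspan Z')]; split=> //; first exact: (hyp_direct_sum hA hZ).
move=> q dq mq; have [rq [Y [Y' [hY qE]]]] := max_hyp hA h mq; subst q.
have [fY _] := hyp_frames hA hY.
have [_ [[[p1 p2] Sp <-] /= dp]] : ((fun s => s.1) @` S `&` [set Q : subsp K n | direct_sum Q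
  (colspan Z')]) !=set0.
  apply: cz; apply: open_nbhs_nbhs; split => //; exact: (hyp_direct_sum hA hZ).
have [rp [P [P' [hP /= pE1 pE2]]]] := pairs1_hyp Sp; subst p1 p2.
have [fP _] := hyp_frames hA hP.
exact: (closure_list1 fY fZ' fP dq dp mq.1 (hyp_isotropic hA hZ).2 Sp).
Qed.

End List1.
End Density.

(** * Symmetric forms: reflections commuting with the semiinvolution *)

Section SymmetricDensity.
Variables (R : realType) (k : scalars) (n : nat).
Local Notation K := (scal R k).

Lemma sdouble_eq0 (x : K) : x + x = 0 -> x = 0.
Proof.
move=> h; have -> : x = sreal k 2^-1 * (x + x); last by rewrite h mulr0.
by rewrite mulrDr -mulrDl -srealD (_ : 2^-1 + 2^-1 = 1) ?sreal1 ?mul1r//; lra.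
Qed.

Lemma mx11_eq0 (M : 'M[K]_1) : M 0 0 = 0 -> M = 0.
Proof. by move=> h; apply/matrixP => i j; rewrite !ord1 h mxE. Qed.

Lemma mx11_inv (M : 'M[K]_1) : M <> 0 -> exists N : 'M[K]_1, M *m N = 1%:M /\ N *m M = 1%:M.
Proof.
move=> M0; have m0 : M 0 0 != 0 by apply/eqP => h; apply: M0; exact: mx11_eq0.
have [y [h1 h2]] := sinv m0; exists y%:M; rewrite [M]mx11_scalar.
by rewrite -!scalar_mxM h1 h2.
Qed.

Lemma hyp_isometry b sg (A Ai g gi : 'M[K]_n) r (F X : 'M[K]_(n, r)) : is_mform b sg A Ai ->
  gi *m g = 1%:M -> g *m gi = 1%:M -> adj b g *m A *m g = A ->
  hyperbolic b sg A F X -> hyperbolic b sg A (g *m F) (g *m X).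
Proof.
move=> hA gig ggi hg h; have ok := mf_ok hA.
have gA : adj b g *m A = A *m gi by rewrite -[in RHS]hg -mulmxA ggi mulmx1.
have e m p (U : 'M[K]_(n, m)) (V : 'M[K]_(n, p)) : adj b (g *m U) *m A *m (g *m V) = adj b U *m A *m V.
  by rewrite adjM// -(mulmxA (adj b U)) gA -!mulmxA (mulmxA gi) gig mul1mx.
split; rewrite ?e ?(hypF h) ?(hypX h) ?(hypXF h)//.
rewrite !adjM// -!(mulmxA _ (adj b g) A) gA -ggi -[g in RHS]mulmx1 -(hypI h).
rewrite mulmxDr mulmxDl sgm_mulr sgm_mull.
by rewrite !mulmxA.
Qed.

Variables (c : bool) (A Ai AJ : 'M[K]_n).
Hypothesis hA : is_mform false false A Ai.
Hypothesis hJ : is_mop c false AJ.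
Hypothesis hc : mconsistent false c false A AJ.
Let ok := mf_ok hA.
Let okc := mo_ok hJ.
Let B := mform false A.
Let J := mop c AJ.
Local Notation S := (pairs_BJ B J).
Local Notation G := (isometries B `&` centralizer J).
Local Notation adj := (adj false).

Let gsym m p (U : 'M[K]_(n, m)) (V : 'M[K]_(n, p)) : adj U *m A *m V = adj (adj V *m A *m U).
Proof. by rewrite (gram_sym hA). Qed.

Let adj11 (M : 'M[K]_1) : adj M = M.
Proof. by apply/matrixP => i j; rewrite !mxE !ord1. Qed.

Let m11C (M N : 'M[K]_1) : M *m N = N *m M.
Proof.
rewrite [M]mx11_scalar [N]mx11_scalar -!scalar_mxM; congr (_%:M); apply: scomm.
exact: ok.
Qed.

(** [r] is the orthogonal reflection in [u], and [N] is the inverse of B(u,u). It commutes with J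
    because J u = u or - u and B(u,u) is invariant under the twist. *)
Lemma reflection_mem (u : 'cV[K]_n) (eta : bool) (N : 'M[K]_1) : J u = sgm eta u ->
  (adj u *m A *m u) *m N = 1%:M ->
  let r := 1%:M - u *m (N + N) *m (adj u *m A) in
  [/\ r *m r = 1%:M, adj r *m A *m r = A & r *m AJ = AJ *m tws c r].
Proof.
move=> Ju hN /=; set b0 := _ *m u in hN; set m := u *m _ *m _.
have mm : m *m m = m + m.
  have -> : m *m m = u *m ((N + N) *m b0 *m (N + N)) *m (adj u *m A) by rewrite /m /b0 !mulmxA.
  have -> : (N + N) *m b0 *m (N + N) = (N + N) + (N + N).
    by rewrite (m11C (N + N) b0) (mulmxDr b0) hN mulmxDl mul1mx.
  by rewrite mulmxDr mulmxDl.
have mA : adj m *m A = A *m m.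
  rewrite /m !adjM// adj11 adjK (mf_adj hA) /= !mulmxA //.
have rr : (1%:M - m) *m (1%:M - m) = 1%:M.
  by rewrite mulmxBl mul1mx mulmxBr mulmx1 mm; abel.
split=> //.
  rewrite adjD adjN adjmx1 mulmxBl mul1mx mA -[X in X - _]mulmx1 -mulmxBr -mulmxA rr mulmx1 //.
(* Consistency with mu = 1 identifies the twist of B(u,u) with B(J u, J u), and the sign of J u = u
   or - u cancels. *)
have tb0 : tws c b0 = b0.
  have -> : tws c b0 = adj (J u) *m A *m J u.
    by rewrite /J /mop adj_sandwich// hc /= adj_tws -!twsM// twsK.
  by rewrite Ju sgm_adj !sgm_mull sgm_mulr sgmK.
have tN : tws c N = N.
  by rewrite -[LHS]mul1mx -hN (m11C b0) -mulmxA -{1}tb0 -twsM// hN tws1 mulmx1.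
rewrite mulmxBl mul1mx twsD twsN tws1 mulmxBr mulmx1; congr (_ - _).
rewrite /m !twsM// twsD tN !mulmxA -[AJ *m tws c u]/(J u) Ju.
have -> : tws c A = adj AJ *m A *m AJ by rewrite hc.
rewrite -adj_tws !mulmxA -(mulmxA _ (adj (tws c u))) -adjM//.
rewrite -[AJ *m tws c u]/(J u) Ju sgm_adj !sgm_mull sgm_mulr !sgm_mull sgmK //.
Qed.

(** If [q] meets an isotropic complement [X'] of Q1 in the line of [w], a reflection in G along a
    vector [u] not orthogonal to [w] moves [X'] off [q]. Taking u = e + J e or e - J e with e in Q1
    makes [u] an eigenvector of J; it is anisotropic when B(e, J e) is not 0. *)
Lemma dense_list1_sym s e1 : S s -> subsp_set s.1 e1 -> B e1 (J e1) <> 0 ->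
  max_isotropic B `<=` closure ((fun s => s.1) @` S).
Proof.
case: s => s1 s2 Ss; have Ss' := Ss; move: Ss'.
have [r [F [X [h /= sE1 sE2]]]] := pairs1_hyp hA Ss; subst s1 s2.
move=> [/= [iF _] _ ds js] Fe1 De1 q mq.
have [fF _] := hyp_frames hA h.
have [r' [Y [Y' [hY qE]]]] := max_hyp hA h mq; subst q.
have [fY _] := hyp_frames hA hY.
have [bl br] : biadditive B by exact: mform_biadditive.
have [X' [h' [dq|[w [w0 qw Xw hw]]]]] := common_complement_sym hA h mq erefl.
  have [_ fX'] := hyp_frames hA h'.
  apply: (closure_list1 hA hJ hc fY fX' fF dq _ mq.1 _ Ss); first exact: (hyp_direct_sum hA h').
  exact: (hyp_isotropic hA h').2.
have Bs v v' : B v v' = B v' v.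
  by rewrite /B /mform gsym adj11.
have JD v v' : J (v + v') = J v + J v' by rewrite /J /mop twsD mulmxDr.
have JN v : J (- v) = - J v by rewrite /J /mop twsN mulmxN.
have BNr v v' : B v (- v') = - B v v'.
  by rewrite /B /mform (_ : adj (- v') = - adj v') ?adjN// !mulNmx mxE.
have BNl v v' : B (- v) v' = - B v v' by rewrite Bs BNr Bs.
(* If [e1] fails, some [e0] of Q1 has B(w, e0) or B(w, J e0) nonzero. When B(e0, J e0) = 0, one of
   e0 + e1 and e0 - e1 will do, because their values of B(v, J v) add up to 2 B(e1, J e1). *)
have [e [Fe De Bwe]] : exists e, [/\ subsp_set (colspan F) e, B e (J e) <> 0 &
    B w e <> 0 \/ B w (J e) <> 0].
  have [g1|] := pselect (B w e1 <> 0 \/ B w (J e1) <> 0); first by exists e1.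
  move/not_orP => [/contrapT b1 /contrapT b2].
  have [e0 [Fe0 g0]] : exists e0, subsp_set (colspan F) e0 /\ (B w e0 <> 0 \/ B w (J e0) <> 0).
    apply: contrapT => hn; apply: w0; apply: (mform_nondegenerate hA) => v.
    have hz x : subsp_set (colspan F) x -> B w x = 0 /\ B w (J x) = 0.
      move=> Fx; split; apply: contrapT => g; apply: hn; exists x; split=> //; [by left|by right].
    have [x [y [Fx Xy ->]]] := ds.2 v.
    move: Xy; rewrite -js => -[y' Fy' <-]; rewrite -/B br.
    by rewrite (hz x Fx).1 (hz y' Fy').2 addr0.
  have [d0|/contrapT d0] := pselect (B e0 (J e0) <> 0); first by exists e0.
  have key t : B (e0 + sgm t e1) (J (e0 + sgm t e1)) <> 0 -> exists e,
    [/\ subsp_set (colspan F) e, B e (J e) <> 0 & B w e <> 0 \/ B w (J e) <> 0].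
    move=> ht; exists (e0 + sgm t e1); split=> //.
      apply: subspD => //; case: (t) => //.
      have -> : sgm true e1 = e1 *m (- 1)%:M; last exact: subspZ.
      by rewrite /sgm -[X in _ *m X%:M]/(- (1 : K)) raddfN mulmxN mulmx1.
    rewrite JD !br; have -> : B w (sgm t e1) = 0 by case: (t); rewrite /= ?BNr b1 ?oppr0.
    have -> : B w (J (sgm t e1)) = 0 by case: (t); rewrite /= ?JN ?BNr b2 ?oppr0.
    by rewrite !addr0.
  have [k1|/contrapT k1] := pselect (B (e0 + sgm false e1) (J (e0 + sgm false e1)) <> 0).
    exact: key k1.
  have [k2|/contrapT k2] := pselect (B (e0 + sgm true e1) (J (e0 + sgm true e1)) <> 0).
    exact: key k2.
  exfalso; apply: De1; apply: sdouble_eq0.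
  move: k1 k2; rewrite /= !JD !JN !(bl, br, BNl, BNr) d0 opprK => k1 k2.
  rewrite -[RHS]addr0 -[X in _ = X + _]k1 -[X in _ = _ + X]k2; abel.
have [eta Bwu] : exists eta, B w (e + sgm eta (J e)) <> 0.
  apply: contrapT => hn.
  have z1 : B w (e + J e) = 0 by apply: contrapT => g; apply: hn; exists false.
  have z2 : B w (e - J e) = 0 by apply: contrapT => g; apply: hn; exists true.
  have z3 : B w e = 0.
    apply: sdouble_eq0; rewrite -[RHS]addr0 -[X in _ = X + _]z1 -[X in _ = _ + X]z2 !br BNr; abel.
  by move: z1 z2; rewrite !br BNr z3 !add0r => z1 _; case: Bwe => [|/(_ z1)].
set u := e + sgm eta (J e) in Bwu.
have Ju : J u = sgm eta u.
  have JJ v : J (J v) = v by exact: (mop_mop v hJ).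
  by rewrite /u JD; case: (eta); rewrite /= ?JN JJ ?opprD ?opprK addrC.
(* Both e and J e are isotropic, so B(u,u) is 2 B(e, J e) up to sign. *)
have Buu : B u u <> 0.
  have z1 : B e e = 0 by exact: iF.
  have z2 : B (J e) (J e) = 0.
    have -> : B (J e) (J e) = tw c (B e e); last by rewrite z1 tw0.
    rewrite /B /mform /J /mop adj_sandwich// hc /= adj_tws -!twsM// mxE //.
  rewrite /u !(bl, br) z1; case: (eta); rewrite /= ?BNl ?BNr ?BNl ?BNr z2 (Bs (J e)) ?opprK ?oppr0
    add0r addr0.
    by rewrite -opprD => /eqP; rewrite oppr_eq0 => /eqP /sdouble_eq0.
  by move/sdouble_eq0.
have nz v v' : B v v' <> 0 -> adj v' *m A *m v <> 0.
  by move=> h1 h2; apply: h1; rewrite /B /mform h2 mxE.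
have [N [hN _]] := mx11_inv (nz _ _ Buu).
have [rr rA rJ] := reflection_mem Ju hN; set g := 1%:M - _ in rr rA rJ.
have Gg : G g.
  by split; [apply/isometriesP => //; split=> //; exists g|apply/centralizerP => //; split=> //; exists g].
have Sg := omS (model1 hA hJ hc) Gg Ss.
have h'' := hyp_isometry hA rr rr rA h'.
have [fgF fgX] := hyp_frames hA h''.
move: Sg; rewrite /act /= !mximage_colspan => Sg.
have NN0 : exists M : 'M[K]_1, M *m (N + N) = 1%:M.
  exists (rsc 2^-1 (adj u *m A *m u)); rewrite rscAl mulmxDr hN rscD -rscDl -[RHS]rsc1.
  by congr rsc; lra.
(* Let g x lie in [q] with x in the span of [X']. As [w] is orthogonal to both spaces, the multiple
   of [u] in g x vanishes, so g x = x lies on the line of [w] and is orthogonal to [u]; since B(w,u)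
   is not 0, x = 0. *)
have dq : direct_sum (colspan Y) (colspan (g *m X')).
  apply: (transverse_direct_sum hA h'' mq) => v /colspanP[a <-] qv.
  set x := X' *m a in qv *.
  have Xx : subsp_set (colspan X') x by apply/colspanP; exists a.
  have gE : g *m X' *m a = x - u *m ((N + N) *m (adj u *m A *m x)).
    by rewrite /g -mulmxA mulmxBl mul1mx !mulmxA.
  have wx : adj w *m A *m x = 0 by apply: mx11_eq0; exact: (hyp_isotropic hA h').2.
  have ux : adj u *m A *m x = 0.
    have : adj w *m A *m (g *m X' *m a) = 0 by apply: mx11_eq0; exact: mq.1.
    rewrite gE mulmxBr wx sub0r => /eqP; rewrite oppr_eq0 => /eqP.
    have Buw : B u w <> 0 by rewrite Bs.
    have [W [_ WV]] := mx11_inv (nz u w Buw).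
    have [M hM] := NN0.
    rewrite (mulmxA _ u) => /(congr1 (mulmx W)); rewrite (mulmxA W) WV mul1mx mulmx0.
    by move/(congr1 (mulmx M)); rewrite (mulmxA M) hM mul1mx mulmx0.
  move: gE; rewrite ux !mulmx0 subr0 => gE; rewrite gE in qv *.
  have [c' xE] := hw _ Xx qv.
  have [U [_ UV]] := mx11_inv (nz _ _ Bwu).
  have c0 : c' = 0.
    by rewrite -[c']mul1mx -UV -mulmxA -(mulmxA _ w) -xE ux mulmx0.
  by rewrite xE c0 mulmx0.
apply: (closure_list1 hA hJ hc fY fgX fgF dq _ mq.1 _ Sg); first exact: (hyp_direct_sum hA h'').
exact: (hyp_isotropic hA h'').2.
Qed.
End SymmetricDensity.

(** * Transitivity in List 2, density in Lists 2 and 4 *)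

Section Transitivity.
Variables (R : realType) (k : scalars) (n : nat).
Local Notation K := (scal R k).

(** For full bases, equality of the Gram matrices is all that an isometry requires; transitivity
    thus reduces to matching the Gram matrices of adapted bases. *)
Lemma basis_change m (M M' : 'M[K]_(n, m)) L L' : L *m M = 1%:M -> M *m L = 1%:M ->
  L' *m M' = 1%:M -> M' *m L' = 1%:M ->
  [/\ GL n (M' *m L), M' *m L *m M = M' & forall b A, anti_ok k b ->
    adj b M *m A *m M = adj b M' *m A *m M' -> adj b (M' *m L) *m A *m (M' *m L) = A].
Proof.
move=> LM ML LM' ML'; split.
- exists (M *m L'); split.
    by rewrite mulmxA -(mulmxA M') LM mulmx1.
  by rewrite mulmxA -(mulmxA M) LM' mulmx1.
- by rewrite -mulmxA LM mulmx1.
- move=> b A ok h; rewrite adj_sandwich// -h -adj_sandwich//.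
  by rewrite ML adjmx1 mul1mx mulmx1.
Qed.

Lemma gram_row_mx b (A : 'M[K]_n) r s (F : 'M[K]_(n, r)) (X : 'M[K]_(n, s)) :
  adj b (row_mx F X) *m A *m row_mx F X =
  block_mx (adj b F *m A *m F) (adj b F *m A *m X) (adj b X *m A *m F) (adj b X *m A *m X).
Proof.
have -> : adj b (row_mx F X) = col_mx (adj b F) (adj b X).
  by rewrite /adj tr_row_mx map_col_mx.
by rewrite mul_col_mx mul_col_row.
Qed.

Lemma row_mx_mul m r s (g : 'M[K]_(m, n)) (F : 'M[K]_(n, r)) (X : 'M[K]_(n, s)) F' X' :
  g *m row_mx F X = row_mx F' X' -> g *m F = F' /\ g *m X = X'.
Proof. by rewrite mul_mx_row => /eq_row_mx. Qed.

Section Forms.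
Variables (b sg : bool) (A Ai : 'M[K]_n).
Hypothesis hA : is_mform b sg A Ai.
Let ok := mf_ok hA.
Let B := mform b A.

Lemma trans_list2 s s' : pairs_B B s -> pairs_B B s' ->
  exists2 g, isometries B g & act g s = s'.
Proof.
move=> [[i1 _] [i2 _] ds] [[i1' _] [i2' _] ds'].
have [r [F [X [h e1 e2]]]] := hyp_exists hA ds i1 i2.
have [r' [F' [X' [h' e1' e2']]]] := hyp_exists hA ds' i1' i2'.
have rr : r' = r.
  by apply: double_inj; rewrite -!addnn (hyp_dim hA h) (hyp_dim hA h').
subst r'; have [fF fX] := hyp_frames hA h; have [fF' fX'] := hyp_frames hA h'.
have [L [LM ML]] := direct_sum_row_mx fF fX (hyp_direct_sum hA h).
have [L' [LM' ML']] := direct_sum_row_mx fF' fX' (hyp_direct_sum hA h').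
have [Gg gM gB] := basis_change LM ML LM' ML'; set g := _ *m L in Gg gM gB.
have [gF gX] := row_mx_mul gM.
exists g; last by move: s s' e1 e2 e1' e2' {ds ds' i1 i2 i1' i2'} => [? ?] [? ?] /= -> -> -> ->;
  rewrite /act /= !mximage_colspan gF gX.
apply/isometriesP => //; split=> //; apply: gB => //.
by rewrite !gram_row_mx (hypF h) (hypF h') (hypX h) (hypX h') (hypXF h) (hypXF h')
  (hypFX hA h) (hypFX hA h').
Qed.

Lemma closure_list2 r1 m1 s1 (Y1 : 'M[K]_(n, r1)) (X1 : 'M[K]_(n, m1)) (F1 : 'M[K]_(n, s1))
   r2 m2 s2 (Y2 : 'M[K]_(n, r2)) (X2 : 'M[K]_(n, m2)) (F2 : 'M[K]_(n, s2)) :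
  frames Y1 -> frames X1 -> frames F1 -> direct_sum (colspan Y1) (colspan X1) ->
  direct_sum (colspan F1) (colspan X1) -> isotropic B (colspan Y1) -> isotropic B (colspan X1) ->
  frames Y2 -> frames X2 -> frames F2 -> direct_sum (colspan Y2) (colspan X2) ->
  direct_sum (colspan F2) (colspan X2) -> isotropic B (colspan Y2) -> isotropic B (colspan X2) ->
  pairs_B B (colspan F1, colspan F2) -> closure (pairs_B B) (colspan Y1, colspan Y2).
Proof.
move=> fY1 fX1 fF1 dY1 dF1 iY1 iX1 fY2 fX2 fF2 dY2 dF2 iY2 iX2 SF.
have [[iF1 _] [iF2 _] ds] : [/\ max_isotropic B (colspan F1), max_isotropic B (colspan F2) &
  direct_sum (colspan F1) (colspan F2)] := SF.
have [C1 hC1] := complement_shear fY1 fX1 fF1 dY1 dF1.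
have [C2 hC2] := complement_shear fY2 fX2 fF2 dY2 dF2.
have f1 := @shear_frames _ _ _ _ _ _ _ C1 1 fY1 fX1 dY1; rewrite rsc1 in f1.
have f2 := @shear_frames _ _ _ _ _ _ _ C2 1 fY2 fX2 dY2; rewrite rsc1 in f2.
rewrite -hC1 -hC2 in ds; have [L [LM ML]] := direct_sum_row_mx f1 f2 ds.
rewrite -add_row_mx in LM ML.
apply: (closure_pair (E := X1 *m C1) (E' := X2 *m C2)) => // e e0.
have [t [t0 te [L' [LM' ML']]]] := pencil LM ML e0.
rewrite rsc_row_mx add_row_mx in LM' ML'.
have [f1' f2' d'] := row_mx_inv2 LM' ML'.
exists t; split=> //.
have nd := mform_nondegenerate hA; have bi := mform_biadditive b A.
have i1 : isotropic B (colspan (Y1 + rsc t (X1 *m C1))).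
  by apply: shear_isotropic => //; rewrite hC1.
have i2 : isotropic B (colspan (Y2 + rsc t (X2 *m C2))).
  by apply: shear_isotropic => //; rewrite hC2.
split => //; first exact: split_max_isotropic i2 d'.
exact: split_max_isotropic i1 (direct_sum_sym d').
Qed.

(** [X'] is a complement of both [q1] and [q2], and [Z] one of both [X'] and [q2]. So (Z, q2) is a
    pair of the list, and [q1] can move towards it among the complements of [X'] while [q2] stays
    fixed. *)
Lemma dense_list2 s (x y : K) : pairs_B B s -> x * y = 1 -> tw b y = - (if sg then - y else y) ->
  max_isotropic B `*` max_isotropic B `<=` closure (pairs_B B).
Proof.
move=> [[i1 _] [i2 _] ds] xy hy [q1 q2] [/= m1 m2].
have [r [F [X [h _ _]]]] := hyp_exists hA ds i1 i2.
have [r1 [Y1 [Y1' [h1 e1]]]] := max_hyp hA h m1; have [r2 [Y2 [Y2' [h2 e2]]]] := max_hyp hA h m2.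
subst q1 q2; have [X' [h' d1]] := common_complement hA h2 m1 xy hy.
have h'' := hyp_swap hA h'.
have [Z [hZ dZ]] := common_complement hA h'' m2 xy hy.
have [fY1 _] := hyp_frames hA h1; have [fY2 _] := hyp_frames hA h2.
have [fX' fZ] := hyp_frames hA hZ.
have [iX iZ] := hyp_isotropic hA hZ.
apply: (closure_list2 fY1 fX' fZ d1 (direct_sum_sym (hyp_direct_sum hA hZ)) m1.1 iX
  fY2 fX' fY2 (hyp_direct_sum hA h') (hyp_direct_sum hA h') m2.1 iX).
by split=> //=; [exact: (hyp_max hA hZ).2|exact: direct_sum_sym].
Qed.

Lemma component_list2 s : pairs_B B s -> forall q, (max_isotropic B `*` max_isotropic B) q ->
  connected_component (max_isotropic B `*` max_isotropic B) q `&` pairs_B B !=set0 ->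
  closure (pairs_B B) q.
Proof.
move=> [[i1 _] [i2 _] ds]; have [r [F [X [h _ _]]]] := hyp_exists hA ds i1 i2.
apply: component_closure; last exact: subset_closure.
move=> [z1 z2] [/= m1 m2] cz.
have [r1 [Y1 [X1 [h1 e1]]]] := max_hyp hA h m1; have [r2 [Y2 [X2 [h2 e2]]]] := max_hyp hA h m2.
subst z1 z2; have [_ fX1] := hyp_frames hA h1; have [_ fX2] := hyp_frames hA h2.
pose W1 := [set Q : subsp K n | direct_sum Q (colspan X1)].
pose W2 := [set Q : subsp K n | direct_sum Q (colspan X2)].
have oW : open (W1 `*` W2).
  rewrite openE => -[q1 q2] [/= d1 d2]; exists (W1, W2) => //=.
  by split; apply: open_nbhs_nbhs; split=> //; exact: complement_open.
have Wz : (W1 `*` W2) (colspan Y1, colspan Y2).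
  by split; [exact: (hyp_direct_sum hA h1)|exact: (hyp_direct_sum hA h2)].
exists (W1 `*` W2); split=> // -[q1 q2] [/= dq1 dq2] [/= mq1 mq2].
have [t1 [T1 [T1' [ht1 e1]]]] := max_hyp hA h mq1; have [t2 [T2 [T2' [ht2 e2]]]] := max_hyp hA h mq2.
subst q1 q2.
have [[p1 p2] [Sp [/= dp1 dp2]]] : (pairs_B B `&` (W1 `*` W2)) !=set0.
  by apply: cz; apply: open_nbhs_nbhs.
have := Sp; move=> [/= mp1 mp2 _].
have [u1 [U1 [U1' [hu1 e1]]]] := max_hyp hA h mp1; have [u2 [U2 [U2' [hu2 e2]]]] := max_hyp hA h mp2.
subst p1 p2.
have [fT1 _] := hyp_frames hA ht1; have [fT2 _] := hyp_frames hA ht2.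
have [fU1 _] := hyp_frames hA hu1; have [fU2 _] := hyp_frames hA hu2.
exact: (closure_list2 fT1 fX1 fU1 dq1 dp1 mq1.1 (hyp_isotropic hA h1).2
  fT2 fX2 fU2 dq2 dp2 mq2.1 (hyp_isotropic hA h2).2).
Qed.

Lemma gram_inv m s (F : 'M[K]_(n, m)) : frames F -> s.1 = colspan F -> pairs_D m B s ->
  exists G, G *m (adj b F *m A *m F) = 1%:M /\ (adj b F *m A *m F) *m G = 1%:M.
Proof.
case: s => s1 s2 fF /= -> [/= _ ds os]; apply: inj_inv2 => z hz.
have [L LF] := (frames_linv F).1 fF.
suff Fz : F *m z = 0 by rewrite -[z]mul1mx -LF -mulmxA Fz mulmx0.
apply: ds.1; first by apply/colspanP; exists z.
rewrite -os => _ /colspanP[y <-]; rewrite /B /mform.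
rewrite (gram_sym hA) adj_sandwich// -mulmxA (_ : adj b F *m A *m F *m z = 0) //.
by rewrite mulmx0 adj0 sgm0 mxE.
Qed.

(** [P] is the orthogonal projection onto the span of [F], written with the inverse [G] of the Gram
    matrix. *)
Lemma pairs4_intro m (F : 'M[K]_(n, m)) G : G *m (adj b F *m A *m F) = 1%:M ->
  (adj b F *m A *m F) *m G = 1%:M ->
  pairs_D m B (colspan F, colspan (1%:M - F *m G *m (adj b F *m A))).
Proof.
move=> Gl Gr'; set P := F *m G *m (adj b F *m A).
have PF : P *m F = F by rewrite /P -mulmxA -(mulmxA F) Gl mulmx1.
have FP : adj b F *m A *m P = adj b F *m A by rewrite /P !mulmxA Gr' mul1mx.
have PP : P *m P = P by rewrite {2}/P (mulmxA P) (mulmxA P F) PF.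
have fF : frames F by apply/frames_linv; exists (G *m (adj b F *m A)); rewrite -mulmxA.
split=> /=; first by exists F.
  split.
    move=> v /colspanP[z <-] /colspanP[y hy].
    have : P *m (F *m z) = 0 by rewrite -hy mulmxA mulmxBr mulmx1 PP subrr mul0mx.
    by rewrite mulmxA PF.
  move=> v; exists (F *m (G *m (adj b F *m A *m v))), ((1%:M - P) *m v); split.
  - by apply/colspanP; exists (G *m (adj b F *m A *m v)).
  - by apply/colspanP; exists v.
  - by rewrite mulmxBl mul1mx /P !mulmxA; abel.
apply/seteqP; split => w.
  move=> hw; apply/colspanP; exists w; rewrite mulmxBl mul1mx.
  have e : adj b w *m A *m F = 0.
    apply: (mform_ext (b := b)) => x y; rewrite mulmx0 mul0mx [RHS]mxE.
    have [x0|/eqP xn] := eqVneq y 0; first by rewrite x0 adj0 mul0mx mul0mx mxE.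
    rewrite [y]mx11_scalar; set yy := _%:M.
    rewrite -mulmxA -(mulmxA _ F) mxE big_ord1.
    by have := hw (F *m x) ((colspanP F _).2 (ex_intro _ x erefl)); rewrite /B /mform => ->; rewrite mulr0.
  have e' : adj b F *m A *m w = 0 by rewrite (gram_sym hA) e adj0 sgm0.
  by rewrite /P -!mulmxA (mulmxA (adj b F)) e' !mulmx0 subr0.
move=> /colspanP[y <-] _ /colspanP[z <-]; rewrite /B /mform (gram_sym hA).
rewrite (_ : adj b (F *m z) *m A *m ((1%:M - P) *m y) = 0) ?adj0 ?sgm0 ?mxE//.
rewrite adj_sandwich// (_ : adj b F *m A *m (1%:M - P) = 0) ?mulmx0 ?mul0mx//.
by rewrite mulmxBr mulmx1 FP subrr.
Qed.

(* The bordered matrix [0, F^*; F, - A^-1] is invertible exactly when the Gram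
   matrix of [F] is, and is affine in [F]. *)
Lemma dense_list4 m s : pairs_D m B s -> Gr m `<=` closure ((fun s => s.1) @` pairs_D m B).
Proof.
move=> Ss _ [Y fY <-]; have [[F fF sF] _ _] := Ss.
have [G [Gl _]] := gram_inv fF (esym sF) Ss.
pose bd (Z : 'M[K]_(n, m)) : 'M[K]_(m + n) := block_mx 0 (adj b Z) Z (- Ai).
(* Schur complement: in a kernel vector of [bd Z] with upper part u the lower part is A Z u, and the
   first row then says that the Gram matrix of [Z] kills u. *)
have bdinj Z : (forall z : 'cV_m, adj b Z *m A *m Z *m z = 0 -> z = 0) <->
    (forall z : 'cV_(m + n), bd Z *m z = 0 -> z = 0).
  split=> h z.
    rewrite -[z]vsubmxK mul_block_col mul0mx add0r => hz.
    have [h1 h2] : adj b Z *m dsubmx z = 0 /\ Z *m usubmx z + - Ai *m dsubmx z = 0.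
      by have := hz; rewrite -[0]col_mx0 => /eq_col_mx.
    have e : dsubmx z = A *m Z *m usubmx z.
      move/eqP: h2; rewrite mulNmx subr_eq0 => /eqP h2.
      by rewrite -mulmxA h2 mulmxA (mf_r hA) mul1mx.
    have u0 : usubmx z = 0 by apply: h; rewrite -!mulmxA (mulmxA A) -e.
    by rewrite e u0 mulmx0 col_mx0.
  move=> hz; have : bd Z *m col_mx z (A *m Z *m z) = 0.
    rewrite mul_block_col mul0mx add0r !mulmxA hz !mulNmx (mf_l hA) mul1mx.
    by rewrite subrr col_mx0.
  by move/h; rewrite -[0]col_mx0 => /eq_col_mx[].
have [L [LM ML]] : exists L, L *m bd F = 1%:M /\ bd F *m L = 1%:M.
  apply: inj_inv2; apply/bdinj => z hz.
  by rewrite -[z]mul1mx -Gl -mulmxA hz mulmx0.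
pose E := F - Y.
have eF : bd F = bd Y + block_mx 0 (adj b E) E 0.
  by rewrite /bd add_block_mx !addr0 /E adjD adjN; congr block_mx; abel.
rewrite eF in LM ML.
apply: (closure_fst (E := E)) => // e e0.
have [t [t0 te [L' [LM' ML']]]] := pencil LM ML e0.
have eT : bd Y + rsc t (block_mx 0 (adj b E) E 0) = bd (Y + rsc t E).
  by rewrite /rsc scale_block_mx add_block_mx /bd !scaler0 !addr0 adjD adj_rsc.
rewrite eT in LM' ML'.
have [|G' [Gl' Gr']] := @inj_inv2 _ _ _ (adj b (Y + rsc t E) *m A *m (Y + rsc t E)).
  apply/bdinj => z hz; by rewrite -[z]mul1mx -LM' -mulmxA hz mulmx0.
have S' := pairs4_intro Gl' Gr'.
exists t; split=> //; last by exists (colspan (Y + rsc t E), colspan (1%:M - (Y + rsc t E) *m G' *m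
  (adj b (Y + rsc t E) *m A))).
by apply/frames_linv; exists (G' *m (adj b (Y + rsc t E) *m A)); rewrite -mulmxA.
Qed.

Lemma trans_list4 m s s' r1 r2 (F1 F1' : 'M[K]_(n, r1)) (F2 F2' : 'M[K]_(n, r2)) :
  pairs_D m B s -> pairs_D m B s' -> s = (colspan F1, colspan F2) -> s' = (colspan F1', colspan F2') ->
  frames F1 -> frames F2 -> frames F1' -> frames F2' ->
  adj b F1 *m A *m F1 = adj b F1' *m A *m F1' -> adj b F2 *m A *m F2 = adj b F2' *m A *m F2' ->
  exists2 g, isometries B g & act g s = s'.
Proof.
move=> Ss Ss' se se'; subst s s'; move: Ss Ss' => [/= _ ds os] [/= _ ds' os'] f1 f2 f1' f2' g1 g2.
have [p12 p21] : adj b F2 *m A *m F1 = 0 /\ adj b F1 *m A *m F2 = 0.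
  by apply: (orth_mx hA) => w; rewrite os.
have [p12' p21'] : adj b F2' *m A *m F1' = 0 /\ adj b F1' *m A *m F2' = 0.
  by apply: (orth_mx hA) => w; rewrite os'.
have [L [LM ML]] := direct_sum_row_mx f1 f2 ds.
have [L' [LM' ML']] := direct_sum_row_mx f1' f2' ds'.
have [Gg gM gB] := basis_change LM ML LM' ML'; set g := _ *m L in Gg gM gB.
have [gF gX] := row_mx_mul gM.
exists g; last by rewrite /act !mximage_colspan gF gX.
apply/isometriesP => //; split=> //; apply: gB => //.
by rewrite !gram_row_mx p12 p21 p12' p21' g1 g2.
Qed.

End Forms.
End Transitivity.

(** * Classification of forms and transitivity *)

Section Congruence.
Variables (R : realType) (k : scalars).
Local Notation K := (scal R k).

Lemma split_off b sg r s (G Gi : 'M[K]_r) (v : 'M[K]_(r, s)) Si : is_mform b sg G Gi ->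
  Si *m (adj b v *m G *m v) = 1%:M -> (adj b v *m G *m v) *m Si = 1%:M ->
  exists t (W : 'M[K]_(r, t)) Hi, [/\ is_mform b sg (adj b W *m G *m W) Hi,
    adj b v *m G *m W = 0, adj b W *m G *m v = 0 &
    exists L, L *m row_mx v W = 1%:M /\ row_mx v W *m L = 1%:M].
Proof.
move=> hG Sl Sr; have ok := mf_ok hG.
have Ss := pairs4_intro hG Sl Sr; set P := _ *m _ in Ss.
have [t [W [L [LW eW]]]] := subsp_frame (colspan (1%:M - P)).
have fW : frames W by apply/frames_linv; exists L.
have fv : frames v by apply/frames_linv; exists (Si *m (adj b v *m G)); rewrite -mulmxA.
rewrite eW in Ss; have [_ ds os] : [/\ Gr s (colspan v), direct_sum (colspan v) (colspan W) &
  orthogonal_complement (mform b G) (colspan v) = colspan W] := Ss.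
have [q1 q2] : adj b W *m G *m v = 0 /\ adj b v *m G *m W = 0.
  by apply: (orth_mx hG) => w; rewrite os.
have [M [LM ML]] := direct_sum_row_mx fv fW ds.
have [|H [Hl Hr]] := @inj_inv2 _ _ _ (adj b W *m G *m W).
  move=> z hz; have : adj b (row_mx v W) *m G *m row_mx v W *m col_mx 0 z = 0.
    by rewrite gram_row_mx mul_block_col !mulmx0 !add0r q2 hz mul0mx col_mx0.
  have adjM : adj b M *m adj b (row_mx v W) = 1%:M by rewrite -adjM// ML adjmx1.
  move/(congr1 (mulmx (adj b M))); rewrite !mulmxA adjM mul1mx mulmx0.
  move/(congr1 (mulmx (M *m Gi))); rewrite !mulmxA -(mulmxA M) (mf_l hG) mulmx1 LM mul1mx mulmx0.
  by move/(congr1 (@dsubmx _ s t 1)); rewrite col_mxKd linear0.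
exists t, W, H; split=> //; last by exists M.
split=> //; rewrite !adjM// adjK (mf_adj hG) sgm_mull sgm_mulr mulmxA //.
Qed.

(** Once every nonzero form of a type represents one and the same invertible block, splitting off
    its orthogonal complement repeatedly makes all forms of that type and size congruent. *)
Definition has_normal_block b sg s (S : 'M[K]_s) := forall r (G Gi : 'M[K]_r), (0 < r)%N ->
  is_mform b sg G Gi -> exists v : 'M[K]_(r, s), adj b v *m G *m v = S.

Lemma congruent_rigid b sg s (S Si : 'M[K]_s) : (0 < s)%N -> Si *m S = 1%:M -> S *m Si = 1%:M ->
  has_normal_block b sg S -> forall r (G Gi G' Gi' : 'M[K]_r), is_mform b sg G Gi ->
  is_mform b sg G' Gi' -> exists C D, [/\ adj b C *m G *m C = G', C *m D = 1%:M & D *m C = 1%:M].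
Proof.
move=> s0 Sl Sr hn r; have [N] := ubnP r; elim: N r => // N IH r rN G Gi G' Gi' hG hG'.
have ok := mf_ok hG.
have [r0|r0] := posnP r.
  by subst r; exists 1%:M, 1%:M; rewrite !mulmx1; split=> //; apply/matrixP => -[].
have [v vS] := hn _ _ _ r0 hG; have [v' vS'] := hn _ _ _ r0 hG'.
have a1 : Si *m (adj b v *m G *m v) = 1%:M by rewrite vS.
have a2 : adj b v *m G *m v *m Si = 1%:M by rewrite vS.
have a1' : Si *m (adj b v' *m G' *m v') = 1%:M by rewrite vS'.
have a2' : adj b v' *m G' *m v' *m Si = 1%:M by rewrite vS'.
have [t [W [H [hH vW Wv [L [LM ML]]]]]] := split_off hG a1 a2.
have [t' [W' [H' [hH' vW' Wv' [L' [LM' ML']]]]]] := split_off hG' a1' a2'.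
have e1 := inv2_dim LM ML; have e2 := inv2_dim LM' ML'.
have tt : t' = t by apply/eqP; rewrite -(eqn_add2l s) e1 e2.
subst t'; have tN : (t < N)%N.
  by rewrite -ltnS; apply: leq_trans rN; rewrite ltnS -e1 -addn1 addnC leq_add2r.
have [C [D [hC CD DC]]] := IH t tN _ _ _ _ hH hH'.
have LM2 : block_mx 1%:M 0 0 D *m L *m row_mx v (W *m C) = 1%:M.
  have -> : row_mx v (W *m C) = row_mx v W *m block_mx 1%:M 0 0 C.
    by rewrite mul_row_block !mulmx0 mulmx1 addr0 add0r.
  rewrite mulmxA -(mulmxA _ L) LM mulmx1 mulmx_block !mulmx0 !mul0mx mulmx1 !addr0 !add0r DC.
  by rewrite -scalar_mx_block.
have ML2 := linv_inv2 LM2 e1.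
have [_ _ _] := basis_change LM2 ML2 LM' ML'.
exists (row_mx v (W *m C) *m L'), (row_mx v' W' *m (block_mx 1%:M 0 0 D *m L)); split.
- rewrite adj_sandwich// (_ : adj b (row_mx v (W *m C)) *m G *m row_mx v (W *m C) =
    adj b (row_mx v' W') *m G' *m row_mx v' W').
    by rewrite -adj_sandwich// ML' adjmx1 mul1mx mulmx1.
  rewrite !gram_row_mx vS vS' vW' Wv' adj_sandwich// hC.
  by rewrite (mulmxA _ W) vW mul0mx adjM// -!mulmxA (mulmxA (adj b W)) Wv mulmx0.
- by rewrite mulmxA -(mulmxA (row_mx _ _)) LM' mulmx1.
- by rewrite mulmxA -(mulmxA (row_mx _ _)) LM2 mulmx1.
Qed.

End Congruence.

(** * Blocks represented by all forms of a type *)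

Section NormalBlocks.
Variables (R : realType).

Section Generic.
Variable (k : scalars).
Local Notation K := (scal R k).

Lemma unit_pairing b sg r (G Gi : 'M[K]_r) (kap : 'M[K]_1) : (0 < r)%N -> is_mform b sg G Gi ->
  exists x y : 'cV[K]_r, adj b y *m G *m x = kap.
Proof.
case: r G Gi => // r G Gi _ hG; exists (delta_mx 0 0), (adj b (kap *m delta_mx 0 0 *m Gi)).
rewrite adjK -(mulmxA _ Gi) (mf_l hG) mulmx1 -mulmxA mul_delta_mx.
have -> : delta_mx 0 0 = 1%:M :> 'M[K]_1 by apply/matrixP => i j; rewrite !ord1 !mxE eqxx.
exact: mulmx1.
Qed.

(** Polarisation: if all values vanished, the value at x + y would be twice the pairing [kap] of x
    and y, because the symmetry of the form fixes [kap]. *)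
Lemma nonzero_value b sg r (G Gi : 'M[K]_r) (kap : 'M[K]_1) : (0 < r)%N -> is_mform b sg G Gi ->
  kap <> 0 -> sgm sg (adj b kap) = kap -> exists v : 'cV[K]_r, adj b v *m G *m v <> 0.
Proof.
move=> r0 hG k0 kE; have [x [y xy]] := unit_pairing kap r0 hG.
apply: contrapT => hn.
have z (v : 'cV[K]_r) : adj b v *m G *m v = 0 by apply: contrapT => h; apply: hn; exists v.
apply: k0; apply: mx11_eq0; apply: sdouble_eq0.
have := z (x + y); rewrite adjD !mulmxDl !mulmxDr !z xy (gram_sym hG x y) xy kE add0r addr0.
by move/matrixP/(_ 0 0); rewrite !mxE.
Qed.

Lemma normal_skew : k <> Quaternions -> has_normal_block false true
  (block_mx 0 (- 1%:M) 1%:M 0 : 'M[K]_(1 + 1)).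
Proof.
move=> hk r G Gi r0 hG; have [x [y xy]] := unit_pairing 1%:M r0 hG.
have z (v : 'cV[K]_r) : adj false v *m G *m v = 0.
  apply: mx11_eq0; apply: sdouble_eq0; have := gram_sym hG v v => /= /matrixP/(_ 0 0) h.
  by rewrite {1}h !mxE; apply: addNr.
by exists (row_mx x y); rewrite gram_row_mx !z xy (gram_sym hG) xy adjmx1.
Qed.

End Generic.

Lemma adj_scalar k b (x : scal R k) n : adj b (x%:M : 'M[scal R k]_n) = (tw b x)%:M.
Proof.
apply/matrixP => i j; rewrite !mxE eq_sym; by case: (i == j); rewrite ?mulr1n // !mulr0n tw0.
Qed.

Lemma mx11_neq0 k (M : 'M[scal R k]_1) : M <> 0 -> M 0 0 != 0.
Proof. by move=> h; apply/eqP => h0; apply: h; exact: mx11_eq0. Qed.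

Lemma scale_value k b r (G : 'M[scal R k]_r) (v : 'cV[scal R k]_r) (x : scal R k) : anti_ok k b ->
  adj b (v *m x%:M) *m G *m (v *m x%:M) = (tw b x * (adj b v *m G *m v) 0 0 * x)%:M.
Proof.
move=> ok; rewrite adj_sandwich// adj_scalar [X in _ *m X *m _]mx11_scalar.
by rewrite -!scalar_mxM.
Qed.

Lemma normal_sym_complex : has_normal_block false false (1%:M : 'M[scal R Complexes]_1).
Proof.
move=> r G Gi r0 hG; have ok := mf_ok hG.
have [] := @nonzero_value _ _ _ _ _ _ 1%:M r0 hG.
- by move/matrixP/(_ 0 0); rewrite !mxE eqxx mulr1n => h1; have := oner_neq0 (scal R Complexes);
    rewrite h1 eqxx.
- by rewrite adjmx1.
move=> v /mx11_neq0; set a := _ 0 0 => a0.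
have [x hx] : exists x : scal R Complexes, x * a * x = 1.
  exists (sqrtc ((a : R[i])^-1)); rewrite mulrAC -expr2.
  have -> : sqrtc ((a : R[i])^-1) ^+ 2 = (a : R[i])^-1 by exact: sqr_sqrtc.
  exact: (@mulVf (R[i])).
exists (v *m x%:M); rewrite scale_value// -/a -[tw false x]/x.
by rewrite hx.
Qed.

Definition qi : scal R Quaternions := ((0, 1, 0, 0) : quat R).
Definition qj : scal R Quaternions := ((0, 0, 1, 0) : quat R).

Lemma qi2 : qi * qi = - 1.
Proof. by congr (_, _, _, _) => /=; ring. Qed.

(** A nonzero value [a] of an antihermitian form is purely imaginary, a positive real times a square
    root of -1, and all such roots are conjugate to [qi]. *)
Lemma normal_anti_quat : has_normal_block true true (qi%:M : 'M[scal R Quaternions]_1).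
Proof.
move=> r G Gi r0 hG; have ok := mf_ok hG.
have ci : sconj qi = - qi by congr (_, _, _, _) => /=; rewrite ?oppr0.
have qi0 : qi <> 0 by move=> [] /eqP; rewrite oner_eq0.
have [] := @nonzero_value _ _ _ _ _ _ qi%:M r0 hG.
- by move/matrixP/(_ 0 0); rewrite !mxE eqxx mulr1n.
- by rewrite adj_scalar /= /tw ci raddfN opprK.
move=> v /mx11_neq0; set a := _ 0 0 => a0.
have ca : sconj a = - a.
  have e : a = - sconj a by rewrite {1}/a (gram_sym hG v v) [LHS]mxE adjE.
  by rewrite {2}e opprK.
have sa := ssq_gt0 a0; set N := ssq a in sa.
have aa : a * a = - sreal _ N by rewrite -ssqE ca mulNr opprK.
pose rho := Num.sqrt N; have rho0 : 0 < rho by rewrite sqrtr_gt0.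
have rr : rho * rho = N by rewrite -expr2 sqr_sqrtr// ltW.
pose q := sreal Quaternions rho^-1 * a.
have qq : q * q = - 1.
  have -> : q * q = sreal _ (rho^-1 * rho^-1) * (a * a).
    by rewrite /q srealM -!mulrA; congr (_ * _); rewrite !mulrA srealC.
  rewrite aa mulrN -srealM (_ : rho^-1 * rho^-1 * N = 1) ?sreal1//.
  by rewrite -rr; field; rewrite gt_eqF.
have aq : a = sreal Quaternions rho * q by rewrite /q mulrA -srealM divff ?gt_eqF// sreal1 mul1r.
clearbody q.
have [y [y0 hy]] : exists y, y != 0 /\ q * y = y * qi.
  (* 1 - q i intertwines q and i since q^2 = i^2 = -1; it vanishes only for q = - i, and there j
     does the same. *)
  have [e|ne] := eqVneq (1 - q * qi) 0; last first.
    exists (1 - q * qi); split=> //.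
    by rewrite mulrBr mulrBl mulr1 mul1r mulrA qq -[in RHS]mulrA qi2 mulN1r mulrN1 !opprK addrC.
  have qE : q = - qi.
    move/eqP: e; rewrite subr_eq0 => /eqP e; rewrite -[q]mulr1 -[X in _ * X]opprK -qi2 mulrN mulrA -e.
    by rewrite mul1r.
  exists qj; split; first by apply/eqP => -[] /eqP; rewrite oner_eq0.
  by rewrite qE; congr (_, _, _, _) => /=; ring.
(* The factor [la] normalises the modulus: replacing y by la y multiplies the value rho ssq(y) i by
   la^2, and the result has to be i. *)
have sy := ssq_gt0 y0; pose la := Num.sqrt (rho * ssq y)^-1.
have la2 : la * la * (rho * ssq y) = 1.
  by rewrite -expr2 sqr_sqrtr ?mulVf ?gt_eqF ?invr_ge0 ?mulr_gt0// ltW// mulr_gt0.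
pose x := sreal Quaternions la * y.
have hx : sconj x * a * x = qi.
  rewrite /x sconjM sreal_conj aq; set l := sreal _ la; set ro := sreal _ rho.
  have lC z : l * z = z * l by exact: srealC.
  have rC z : ro * z = z * ro by exact: srealC.
  rewrite -(lC (sconj y)) (mulrA _ ro q) -(mulrA l (sconj y) ro) -(rC (sconj y)) (mulrA _ l y).
  rewrite -(lC (l * (ro * sconj y) * q)) -!mulrA hy (mulrA (sconj y)) ssqE.
  by rewrite !mulrA /l /ro -!srealM -!mulrA mulrA la2 sreal1 mul1r.
by exists (v *m x%:M); rewrite scale_value// -/a /= /tw hx.
Qed.

End NormalBlocks.

(** * Signature and the law of inertia *)

Section Signature.
Variables (R : realType) (k : scalars) (b : bool).
Local Notation K := (scal R k).
Hypothesis ok : anti_ok k b.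
Hypothesis hb : forall x : K, tw b x = sconj x.

(** By [hb] the twist is conjugation, which over R is the identity; real symmetric forms are
    therefore included with [b] false. *)
Record signature_frames r (G : 'M[K]_r) p q (F : 'M[K]_(r, p)) (E : 'M[K]_(r, q)) : Prop := {
  sf_dim : (p + q)%N = r;
  sf_pos : adj b F *m G *m F = 1%:M;
  sf_neg : adj b E *m G *m E = - 1%:M;
  sf_pn : adj b F *m G *m E = 0;
  sf_np : adj b E *m G *m F = 0 }.

Lemma adj_col_sqr p (z : 'cV[K]_p) : (adj b z *m z) 0 0 = sreal k (\sum_i ssq (z i 0)).
Proof.
rewrite mxE; elim/big_rec2: _ => [|i x y _ ->]; first by rewrite sreal0.
by rewrite srealD adjE hb ssqE.
Qed.

Lemma sum_ssq_eq0 p (z : 'cV[K]_p) : \sum_i ssq (z i 0) <= 0 -> z = 0.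
Proof.
move=> h; have h0 : \sum_i ssq (z i 0) == 0.
  by rewrite eq_le h sumr_ge0// => i _; exact: ssq_ge0.
apply/matrixP => i j; rewrite !ord1 mxE; apply: ssq_eq0.
move: h0; rewrite psumr_eq0; last by move=> ? _; exact: ssq_ge0.
by move/allP/(_ i (mem_index_enum i)) => /= /eqP.
Qed.

Lemma unit_value r (G Gi : 'M[K]_r) (v : 'cV[K]_r) : is_mform b false G Gi ->
  adj b v *m G *m v <> 0 -> exists (w : 'cV[K]_r) s, adj b w *m G *m w = sgm s 1%:M.
Proof.
move=> hG /mx11_neq0; set a := _ 0 0 => a0.
have ca : sconj a = a.
  have e : a = sconj a by rewrite {1}/a (gram_sym hG v v) [LHS]adjE hb.
  by rewrite -e.
have aE := conj_id_real ca; set rho := sre a in aE.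
have rho0 : rho != 0 by apply: contra a0 => /eqP h; rewrite aE h sreal0.
pose la := Num.sqrt `|rho|^-1.
have la2 : la * la = `|rho|^-1 by rewrite -expr2 sqr_sqrtr// invr_ge0.
exists (v *m (sreal k la)%:M), (rho < 0).
rewrite scale_value// -/a tw_real aE -!srealM mulrAC la2.
have [h|h] := ltP rho 0.
  have -> : `|rho|^-1 * rho = -1 by rewrite ltr0_norm// invrN mulNr mulVf.
  by rewrite srealN sreal1 raddfN.
have -> : `|rho|^-1 * rho = 1 by rewrite ger0_norm// mulVf.
by rewrite sreal1.
Qed.

Lemma signature_exists r (G Gi : 'M[K]_r) : is_mform b false G Gi ->
  exists p q (F : 'M[K]_(r, p)) (E : 'M[K]_(r, q)), signature_frames G F E.
Proof.
have [N] := ubnP r; elim: N r G Gi => // N IH r G Gi rN hG.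
have [r0|r0] := posnP r.
  subst r; exists 0%N, 0%N, 0, 0; split=> //; by apply/matrixP => -[].
have [] := @nonzero_value _ _ _ _ _ _ _ 1%:M r0 hG.
- by move/matrixP/(_ 0 0); rewrite !mxE eqxx mulr1n => h1; have := oner_neq0 K; rewrite h1 eqxx.
- by rewrite adjmx1.
move=> v /(unit_value hG) [w [s ws]].
have a1 : sgm s 1%:M *m (adj b w *m G *m w) = 1%:M.
  by rewrite ws sgm_mull mul1mx sgmK.
have a2 : adj b w *m G *m w *m sgm s 1%:M = 1%:M.
  by rewrite ws sgm_mull mul1mx sgmK.
have [t [W [H [hH vW Wv [L [LM ML]]]]]] := split_off hG a1 a2.
have e1 := inv2_dim LM ML.
have tN : (t < N)%N.
  by rewrite -ltnS; apply: leq_trans rN; rewrite ltnS -e1 addnC addn1.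
have [p [q [F [E [d1 d2 d3 d4 d5]]]]] := IH t _ _ tN hH.
have gr m1 m2 (X : 'M[K]_(t, m1)) (Y : 'M[K]_(t, m2)) :
  adj b (W *m X) *m G *m (W *m Y) = adj b X *m (adj b W *m G *m W) *m Y by rewrite adj_sandwich.
have wW m1 (X : 'M[K]_(t, m1)) : adj b w *m G *m (W *m X) = 0 by rewrite mulmxA vW mul0mx.
have Ww m1 (X : 'M[K]_(t, m1)) : adj b (W *m X) *m G *m w = 0.
  by rewrite adjM// -(mulmxA (adj b X)) -(mulmxA (adj b X)) Wv mulmx0.
have gc m1 m2 m3 (X : 'M[K]_(r, m1)) (Y : 'M[K]_(r, m2)) (Z : 'M[K]_(r, m3)) :
    adj b (row_mx X Y) *m G *m Z = col_mx (adj b X *m G *m Z) (adj b Y *m G *m Z).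
  by rewrite /adj tr_row_mx map_col_mx !mul_col_mx.
case: s ws {a1 a2} => /= ws.
  exists p, (1 + q)%N, (W *m F), (row_mx w (W *m E)); split.
  - by rewrite addnCA d1 e1.
  - by rewrite gr.
  - by rewrite gram_row_mx ws wW Ww gr d3 [in RHS]scalar_mx_block opp_block_mx !oppr0.
  - by rewrite mul_mx_row Ww gr d4 row_mx0.
  - by rewrite gc wW gr d5 col_mx0.
exists (1 + p)%N, q, (row_mx w (W *m F)), (W *m E); split.
- by rewrite -addnA d1 e1.
- by rewrite gram_row_mx ws wW Ww gr d2 -scalar_mx_block.
- by rewrite gr.
- by rewrite gc wW gr d4 col_mx0.
- by rewrite mul_mx_row Ww gr d5 row_mx0.
Qed.

(** A positive and a negative definite subspace meet only in 0: a common vector would have a value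
    that is both nonnegative and nonpositive, hence zero as a sum of squares. *)
Lemma sylvester_le r (G : 'M[K]_r) p q (F : 'M[K]_(r, p)) (E : 'M[K]_(r, q)) :
  adj b F *m G *m F = 1%:M -> adj b E *m G *m E = - 1%:M -> (p + q <= r)%N.
Proof.
move=> hF hE; have [|L LM] := @inj_linv _ _ _ _ (row_mx F E).
  move=> z; rewrite -[z]vsubmxK; set x := usubmx z; set y := dsubmx z; rewrite mul_row_col => hz.
  have xy : F *m x = E *m (- y).
    by move/eqP: hz; rewrite mulmxN addr_eq0 => /eqP.
  have : adj b (F *m x) *m G *m (F *m x) = adj b (E *m (- y)) *m G *m (E *m (- y)) by rewrite xy.
  rewrite !adj_sandwich// hF hE mulmx1 (mulmxN (adj b (- y)) 1%:M) mulmx1 mulNmx => /matrixP/(_ 0 0).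
  rewrite [RHS]mxE !adj_col_sqr -srealN => /(congr1 (@sre R k)); rewrite !sre_real => e.
  have s1 : 0 <= \sum_i ssq (x i 0) by apply: sumr_ge0 => i _; exact: ssq_ge0.
  have s2 : 0 <= \sum_i ssq ((- y) i 0) by apply: sumr_ge0 => i _; exact: ssq_ge0.
  have x0 : x = 0 by apply: sum_ssq_eq0; lra.
  have y0 : - y = 0 by apply: sum_ssq_eq0; lra.
  by rewrite x0 -[y]opprK y0 oppr0 col_mx0.
exact: linv_le LM.
Qed.

Lemma signature_inv2 r (G : 'M[K]_r) p q (F : 'M[K]_(r, p)) (E : 'M[K]_(r, q)) : signature_frames G F E ->
  exists L, L *m row_mx F E = 1%:M /\ row_mx F E *m L = 1%:M.
Proof.
move=> h; pose L := block_mx 1%:M 0 0 (- 1%:M) *m (adj b (row_mx F E) *m G).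
have LM : L *m row_mx F E = 1%:M.
  rewrite /L -mulmxA gram_row_mx (sf_pos h) (sf_neg h) (sf_pn h) (sf_np h).
  rewrite mulmx_block !mulmx0 !mul0mx mulmx1 mulNmx mulmxN mulmx1 opprK !addr0 add0r.
  by rewrite -scalar_mx_block.
exists L; split=> //; exact: linv_inv2 LM (sf_dim h).
Qed.

Lemma congruent_signature r (G G' : 'M[K]_r) p q q' (F : 'M[K]_(r, p)) (E : 'M[K]_(r, q))
  (F' : 'M[K]_(r, p)) (E' : 'M[K]_(r, q')) : signature_frames G F E ->
  signature_frames G' F' E' ->
  exists C D, [/\ adj b C *m G *m C = G', C *m D = 1%:M & D *m C = 1%:M].
Proof.
move=> h h'; have e : q' = q.
  by apply/eqP; rewrite -(eqn_add2l p) (sf_dim h) (sf_dim h').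
subst q'; have [L [LM ML]] := signature_inv2 h; have [L' [LM' ML']] := signature_inv2 h'.
exists (row_mx F E *m L'), (row_mx F' E' *m L); split.
- rewrite adj_sandwich// (_ : adj b (row_mx F E) *m G *m row_mx F E =
    adj b (row_mx F' E') *m G' *m row_mx F' E').
    by rewrite -adj_sandwich// ML' adjmx1 mul1mx mulmx1.
  by rewrite !gram_row_mx (sf_pos h) (sf_neg h) (sf_pn h) (sf_np h)
    (sf_pos h') (sf_neg h') (sf_pn h') (sf_np h').
- by rewrite mulmxA -(mulmxA (row_mx _ _)) LM' mulmx1.
- by rewrite mulmxA -(mulmxA (row_mx _ _)) LM mulmx1.
Qed.

End Signature.

Lemma adj_tws_addb (R : realType) (k : scalars) b c m n (F : 'M[scal R k]_(m, n)) :
  adj b (tws c F) = adj (b (+) c) F.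
Proof. by apply/matrixP => i j; rewrite !mxE tw_addb. Qed.

(** * Transitivity for Lists 1, 3 and 5 and the managing form *)

Section SwapTransitivity.
Variables (R : realType) (k : scalars) (n : nat).
Local Notation K := (scal R k).

Lemma frames_mop c se AJ r (F : 'M[K]_(n, r)) : is_mop c se AJ -> frames F -> frames (AJ *m tws c F).
Proof.
move=> hJ /frames_linv[L LF]; apply/frames_linv; exists (tws c L *m mopV c se AJ).
by rewrite mulmxA -(mulmxA _ _ AJ) (mopVK hJ) mulmx1 -(twsM _ _ (mo_ok hJ)) LF tws1.
Qed.

Lemma mop_mx2 c se AJ r (F : 'M[K]_(n, r)) : is_mop c se AJ ->
  AJ *m tws c (AJ *m tws c F) = sgm se F.
Proof. by move=> [ok h]; rewrite twsM// twsK mulmxA h sgm_mull mul1mx. Qed.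

(** [g] carries the basis F, J F to F', J F' and commutes with J because J^2 is a sign. Isotropy
    makes the diagonal Gram blocks 0, so preserving the form only requires the same pairing of J F
    with F, which is the Gram matrix of the managing form. *)
Lemma trans_swap c se (AJ : 'M[K]_n) r (F F' : 'M[K]_(n, r)) : is_mop c se AJ -> frames F -> frames F' ->
  direct_sum (colspan F) (mop c AJ @` colspan F) ->
  direct_sum (colspan F') (mop c AJ @` colspan F') ->
  exists g, [/\ GL n g, g *m F = F', g *m AJ = AJ *m tws c g &
    forall b sg sm A Ai, is_mform b sg A Ai -> mconsistent b c sm A AJ ->
      adj b F *m A *m F = 0 -> adj b F' *m A *m F' = 0 ->
      adj b (AJ *m tws c F) *m A *m F = adj b (AJ *m tws c F') *m A *m F' ->
      adj b g *m A *m g = A].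
Proof.
move=> hJ fF fF'; rewrite !(mop_colspan _ hJ) => ds ds'; have okc := mo_ok hJ.
have [L [LM ML]] := direct_sum_row_mx fF (frames_mop hJ fF) ds.
have [L' [LM' ML']] := direct_sum_row_mx fF' (frames_mop hJ fF') ds'.
have [Gg gM gB] := basis_change LM ML LM' ML'; set g := _ *m L in Gg gM gB.
have [gF gJF] := row_mx_mul gM.
have tM : tws c (row_mx F (AJ *m tws c F)) *m tws c L = 1%:M by rewrite -twsM// ML tws1.
exists g; split=> //.
  rewrite -[LHS]mulmx1 -[RHS]mulmx1 -tM !mulmxA; congr (_ *m _).
  have -> : tws c (row_mx F (AJ *m tws c F)) = row_mx (tws c F) (tws c (AJ *m tws c F)).
    by rewrite /tws map_row_mx.
  rewrite mul_mx_row [RHS]mul_mx_row.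
  have e1 : g *m AJ *m tws c F = AJ *m tws c g *m tws c F.
    by rewrite -mulmxA gJF -mulmxA -(twsM _ _ okc) gF.
  have e2 : g *m AJ *m tws c (AJ *m tws c F) = AJ *m tws c g *m tws c (AJ *m tws c F).
    rewrite -(mulmxA g) (mop_mx2 _ hJ) sgm_mulr gF -mulmxA -(twsM _ _ okc) gJF.
    by rewrite (mop_mx2 _ hJ).
  by rewrite e1 e2.
move=> b sg sm A Ai hA hc i i' gr; have ok := mf_ok hA; apply: gB => //.
have iso m (X : 'M[K]_(n, m)) : adj b X *m A *m X = 0 ->
    adj b (AJ *m tws c X) *m A *m (AJ *m tws c X) = 0.
  by move=> h; rewrite adj_sandwich// hc sgm_mulr sgm_mull adj_tws -!twsM// h tws0 sgm0.
rewrite !gram_row_mx i i' !iso// gr; congr block_mx.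
by rewrite (gram_sym hA) gr -(gram_sym hA).
Qed.

Lemma trans_list3 c se (AJ : 'M[K]_n) s s' : is_mop c se AJ -> pairs_J (mop c AJ) s -> pairs_J (mop
  c AJ) s' ->
  exists2 g, centralizer (mop c AJ) g & act g s = s'.
Proof.
move=> hJ; case: s s' => [s1 s2] [s1' s2'] [/= ds js] [/= ds' js'].
have [r [F [L [LF e]]]] := subsp_frame s1; have [r' [F' [L' [LF' e']]]] := subsp_frame s1'.
subst s1 s1'; have fF : frames F by apply/frames_linv; exists L.
have fF' : frames F' by apply/frames_linv; exists L'.
rewrite -js in ds; rewrite -js' in ds'.
have d : (r + r)%N = n.
  by apply: (direct_sum_dim fF (frames_mop hJ fF)); rewrite -(mop_colspan _ hJ).
have d' : (r' + r')%N = n.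
  by apply: (direct_sum_dim fF' (frames_mop hJ fF')); rewrite -(mop_colspan _ hJ).
have rr : r' = r by apply: double_inj; rewrite -!addnn d d'.
subst r'; have [g [Gg gF gJ _]] := trans_swap hJ fF fF' ds ds'.
have Cg : centralizer (mop c AJ) g by apply/(centralizerP _ _ (mo_ok hJ)).
exists g => //; rewrite /act /= mximage_colspan gF; congr (_, _).
apply: subsp_ext => v; rewrite -js' -gF -mximage_colspan.
by rewrite (swap_act Cg js).
Qed.

Lemma pairs_J_dim c se (AJ : 'M[K]_n) m s : is_mop c se AJ -> n = (m + m)%N -> pairs_J (mop c AJ) s
  -> Gr m s.1.
Proof.
move=> hJ nm; case: s => [s1 s2] [/= ds js].
have [r [F [L [LF e]]]] := subsp_frame s1; subst s1; rewrite -js in ds.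
have fF : frames F by apply/frames_linv; exists L.
have d : (r + r)%N = n.
  by apply: (direct_sum_dim fF (frames_mop hJ fF)); rewrite -(mop_colspan _ hJ).
have rm : r = m by apply: double_inj; rewrite -!addnn d nm.
by subst r; exists F.
Qed.

Lemma dense_list3 c se (AJ : 'M[K]_n) m s : is_mop c se AJ -> n = (m + m)%N -> pairs_J (mop c AJ) s ->
  Gr m `<=` closure ((fun s => s.1) @` pairs_J (mop c AJ)).
Proof.
move=> hJ nm Ss _ [Y fY <-]; have [F fF eF] := pairs_J_dim hJ nm Ss.
case: s Ss eF => [s1 s2] [/= ds js] eF; subst s1; rewrite -js in ds.
have eYF : Y + (F - Y) = F by abel.
apply: (closure_fst (E := F - Y)) => // e e0.
have [||t [t0 te ft dt]] := pencil_swap (F := Y) (E := F - Y) hJ _ _ e0; rewrite ?eYF//.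
exists t; split=> //.
exists (colspan (Y + rsc t (F - Y)), colspan (AJ *m tws c (Y + rsc t (F - Y)))) => //.
have e1 := mop_colspan (Y + rsc t (F - Y)) hJ; rewrite e1 in dt; exact: (conj dt e1).
Qed.

Lemma trans_list5 p q (s s' : subsp K n * subsp K n) : pairs_dim p q s -> pairs_dim p q s' ->
  exists2 g : 'M[K]_n, GL n g & act g s = s'.
Proof.
case: s s' => [s1 s2] [s1' s2'] [/= [F1 f1 <-] [F2 f2 <-] ds] [/= [F1' f1' <-] [F2' f2' <-] ds'].
have [L [LM ML]] := direct_sum_row_mx f1 f2 ds.
have [L' [LM' ML']] := direct_sum_row_mx f1' f2' ds'.
have [Gg gM _] := basis_change LM ML LM' ML'; have [g1 g2] := row_mx_mul gM.
by exists (row_mx F1' F2' *m L) => //; rewrite /act /= !mximage_colspan g1 g2.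
Qed.

Lemma dense_list5 p q (s : subsp K n * subsp K n) : pairs_dim p q s -> (Gr p `*` Gr q : set (subsp
  K n * subsp K n)) `<=` closure (pairs_dim p q).
Proof.
case: s => [s1 s2] [/= [F1 f1 <-] [F2 f2 <-] ds] [q1 q2] [/= [Y1 fY1 <-] [Y2 fY2 <-]].
have [L [LM ML]] := direct_sum_row_mx f1 f2 ds.
have eM : row_mx F1 F2 = row_mx Y1 Y2 + row_mx (F1 - Y1) (F2 - Y2).
  by rewrite add_row_mx; congr row_mx; abel.
rewrite eM in LM ML.
apply: (closure_pair (E := F1 - Y1) (E' := F2 - Y2)) => // e e0.
have [t [t0 te [L' [LM' ML']]]] := pencil LM ML e0.
rewrite rsc_row_mx add_row_mx in LM' ML'.
have [h1 h2 h3] := row_mx_inv2 LM' ML'.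
exists t; split=> //; split=> //=; first by exists (Y1 + rsc t (F1 - Y1)).
by exists (Y2 + rsc t (F2 - Y2)).
Qed.

Section List1.
Variables (b sg c se sm : bool) (A Ai AJ : 'M[K]_n).
Hypothesis hA : is_mform b sg A Ai.
Hypothesis hJ : is_mop c se AJ.
Hypothesis hc : mconsistent b c sm A AJ.
Let ok := mf_ok hA.
Let okc := mo_ok hJ.
Let B := mform b A.
Let J := mop c AJ.
(* [bD], [sD] and [D] are the type and the matrix of the managing form. *)
Let bD := b (+) c.
Let sD := (sg (+) se) (+) sm.
Let D := adj b AJ *m A.
Local Notation S := (pairs_BJ B J).
Local Notation hyperbolic := (hyperbolic b sg A).

Lemma anti_ok_managing : anti_ok k bD.
Proof. by move: ok okc; rewrite /bD /anti_ok /auto_ok; case: b c => [] []; auto. Qed.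
Let okD := anti_ok_managing.

Lemma managing_gram r s (X : 'M[K]_(n, r)) (Y : 'M[K]_(n, s)) :
  adj b (AJ *m tws c X) *m A *m Y = adj bD X *m D *m Y.
Proof. by rewrite adjM// adj_tws_addb !mulmxA. Qed.

Lemma managing_adj : adj bD D = sgm sD D.
Proof.
rewrite /D -adj_tws_addb adj_tws adjM// adjK (mf_adj hA) sgm_mull sgm_tws twsM//.
have -> : tws c A = sgm sm (adj b AJ *m A *m AJ) by rewrite hc sgmK.
rewrite sgm_mull -mulmxA (mo_sq hJ) sgm_mulr mulmx1.
by rewrite /sD; case: sg se sm => [] [] []; rewrite /= ?opprK.
Qed.

Lemma managing_mform : exists Di, is_mform bD sD D Di.
Proof.
have h1 : adj b AJ *m adj b (mopV c se AJ) = 1%:M by rewrite -adjM// (mopVK hJ) adjmx1.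
have h2 : adj b (mopV c se AJ) *m adj b AJ = 1%:M by rewrite -adjM// (mopK hJ) adjmx1.
exists (Ai *m adj b (mopV c se AJ)); split.
- exact: okD.
- by rewrite mulmxA -(mulmxA Ai) h2 mulmx1 (mf_l hA).
- by rewrite mulmxA -(mulmxA (adj b AJ)) (mf_r hA) mulmx1 h1.
- exact: managing_adj.
Qed.

(** J multiplies the managing form by the sign sm, up to the twist. This carries the signature on Q1
    over to J Q1, with the same sign or reversed. *)
Lemma managing_swap r s (X : 'M[K]_(n, r)) (Y : 'M[K]_(n, s)) :
  adj bD (AJ *m tws c X) *m D *m (AJ *m tws c Y) = sgm sm (tws c (adj bD X *m D *m Y)).
Proof.
rewrite -managing_gram -[X in sgm sm (tws c X)]managing_gram.
by rewrite adj_sandwich// hc sgm_mulr sgm_mull adj_tws -!twsM.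
Qed.

Lemma pairs1_of_gram r (F : 'M[K]_(n, r)) M : (r + r)%N = n -> adj b F *m A *m F = 0 ->
  M *m (adj bD F *m D *m F) = 1%:M -> S (colspan F, colspan (AJ *m tws c F)).
Proof.
move=> rn i hM; have fF : frames F by apply/frames_linv; exists (M *m (adj bD F *m D)); rewrite -mulmxA.
have i' : isotropic B (colspan F) by apply/isotropic_mform.
apply: (pairs1_intro hA hJ hc i'); rewrite (mop_colspan _ hJ).
apply: complement_dim => //; first exact: (frames_mop hJ fF).
move=> _ /colspanP[x <-] /colspanP[y hy].
have iJ := isotropic_mop hA hJ hc i'; move/(isotropic_mform _ _ ok) : iJ => iJ.
have : adj b (AJ *m tws c F) *m A *m (F *m x) = 0 by rewrite -hy mulmxA iJ mul0mx.
rewrite mulmxA managing_gram => /(congr1 (mulmx M)); rewrite mulmxA hM mul1mx mulmx0 => ->.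
by rewrite mulmx0.
Qed.

Lemma pairs1_gram s : S s -> exists r (F : 'M[K]_(n, r)) Gi, [/\ s.1 = colspan F, frames F,
  adj b F *m A *m F = 0, is_mform bD sD (adj bD F *m D *m F) Gi & (r + r)%N = n] /\
  direct_sum (colspan F) (J @` colspan F).
Proof.
move=> Ss; have [r [F [X [h e1 e2]]]] := pairs1_hyp hA Ss; case: Ss => _ _ ds js.
have [fF fX] := hyp_frames hA h.
exists r, F; rewrite e1 e2 in ds js *.
have eJ : colspan (AJ *m tws c F) = colspan X.
  by apply: subsp_ext => v; rewrite -js (mop_colspan _ hJ).
have [C hC] : exists C, X = (AJ *m tws c F) *m C by apply: colspan_sub => v; rewrite eJ.
have CG : adj b C *m (adj bD F *m D *m F) = 1%:M.
by rewrite -managing_gram -(hypXF h) hC [in RHS](adjM (AJ *m tws c F) C ok) !mulmxA.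
have [Di hD] := managing_mform.
exists (adj b C); split; last by rewrite js.
split=> //; [exact: hypF h| |exact: (hyp_dim hA h)].
split=> //; [exact: linv_inv2|have o := okD].
by rewrite adjM// adjM// managing_adj adjK sgm_mull sgm_mulr mulmxA.
Qed.

(** The congruence [C] only changes the frame of Q1, not Q1 itself; after it the two Gram matrices
    agree and [trans_swap] applies. *)
Lemma trans_of_gram s s' r (F F' : 'M[K]_(n, r)) : S s -> S s' -> s.1 = colspan F -> s'.1 = colspan F' ->
  frames F -> frames F' ->
  (exists C C', [/\ adj bD C *m (adj bD F *m D *m F) *m C = adj bD F' *m D *m F', C *m C' = 1%:M &
    C' *m C = 1%:M]) ->
  exists2 g, (isometries B `&` centralizer J) g & act g s = s'.
Proof.
move=> Ss Ss' e e' fF fF' [C [C' [hC CC' C'C]]].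
have eFC : colspan (F *m C) = colspan F by apply: (colspan_mul _ CC').
have fFC : frames (F *m C).
  move/frames_linv: fF => [L LF]; apply/frames_linv; exists (C' *m L).
  by rewrite mulmxA -(mulmxA C') LF mulmx1.
have ds : direct_sum (colspan (F *m C)) (J @` colspan (F *m C)).
  by rewrite eFC; case: Ss => _ _ ds js; rewrite -e js.
have ds' : direct_sum (colspan F') (J @` colspan F').
  by case: Ss' => _ _ ds' js'; rewrite -e' js'.
have [g [Gg gF gJ gB]] := trans_swap hJ fFC fF' ds ds'.
have Hg : (isometries B `&` centralizer J) g.
  split; last by apply/centralizerP.
  apply/isometriesP => //; split=> //; apply: (gB b sg sm A Ai hA hc).
  - by apply/isotropic_mform => //; rewrite eFC -e; case: Ss => [[]].
  - by apply/isotropic_mform => //; rewrite -e'; case: Ss' => [[]].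
  - by rewrite !managing_gram; have o := okD; rewrite adj_sandwich.
exists g => //; have M1 := model1 hA hJ hc.
apply: (om_inj M1 (omS M1 Hg Ss) Ss').
by rewrite e' -gF /= e -eFC mximage_colspan.
Qed.

Lemma trans_rigid t (N Ni : 'M[K]_t) : (0 < t)%N -> Ni *m N = 1%:M -> N *m Ni = 1%:M ->
  has_normal_block bD sD N -> forall s s', S s -> S s' ->
  exists2 g, (isometries B `&` centralizer J) g & act g s = s'.
Proof.
move=> t0 Nl Nr hn s s' Ss Ss'.
have [r [F [Gi [[e fF i hG d] _]]]] := pairs1_gram Ss.
have [r' [F' [Gi' [[e' fF' i' hG' d'] _]]]] := pairs1_gram Ss'.
have rr : r' = r by apply: double_inj; rewrite -!addnn d d'.
subst r'; apply: (trans_of_gram Ss Ss' e e' fF fF').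
exact: (congruent_rigid t0 Nl Nr hn hG hG').
Qed.

End List1.
End SwapTransitivity.

Lemma gram_colsub (R : realType) (k : scalars) b n r s (D : 'M[scal R k]_n) (f : 'I_r -> 'I_n) (h :
  'I_s -> 'I_n) e i j :
  (adj b (colsub f e) *m D *m colsub h e) i j = mform b D (col (h j) e) (col (f i) e).
Proof.
rewrite /mform !mxE; apply: eq_bigr => l _; rewrite !mxE; congr (_ * _).
by apply: eq_bigr => u _; rewrite !adjE !mxE.
Qed.

Lemma inertia_frames (R : realType) (k : scalars) b n (D : 'M[scal R k]_n) p q :
  has_inertia (mform b D) (p, q) -> exists (F : 'M[scal R k]_(n, p)) (E : 'M[scal R k]_(n, q)),
    adj b F *m D *m F = 1%:M /\ adj b E *m D *m E = - 1%:M.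
Proof.
move=> [/= pq [e _ he]].
exists (colsub (fun j => cast_ord pq (lshift q j)) e), (colsub (fun j => cast_ord pq (rshift p j)) e).
split; apply/matrixP => i j; rewrite gram_colsub he !mxE.
  by rewrite (inj_eq (@cast_ord_inj _ _ _)) (inj_eq (@lshift_inj _ _)) eq_sym /= ltn_ord; case: eqP.
rewrite (inj_eq (@cast_ord_inj _ _ _)) (inj_eq (@rshift_inj _ _)) eq_sym /= ltnNge leq_addr /=.
by case: eqP; rewrite ?mulr0n ?oppr0 ?mulr1n.
Qed.

Lemma subsp_eq0 (R : realType) (k : scalars) n (P Q : subsp (scal R k) n) : n = 0%N -> P = Q.
Proof.
move=> n0; apply: subsp_ext => v; have -> : v = 0.
  by apply/matrixP => i; have := ltn_ord i; rewrite {2}n0.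
by split=> _; exact: subsp0.
Qed.

(** A dense orbit meets each open orbit, and all orbits are open, so it is all of S. Two
    inequivalent points [s1], [s2] thus refute the density of every orbit at once. *)
Lemma dense_orbit_trans (R : realType) (k : scalars) n (T : topologicalType) (G : set 'M[scal R k]_n) S
  (Grs : set T) iota s s1 s2 : open_model G S Grs iota -> S s -> S s1 -> S s2 ->
  Grs `<=` closure (iota @` Defs.orbit G s) -> exists2 g, G g & act g s1 = s2.
Proof.
move=> [G1 GM GV GS iS ii ic il] Ss Ss1 Ss2 hd.
have [g Gg e1] := orbit_meet G1 GM GV GS iS ii il Ss Ss1 hd.
have [g' Gg' e2] := orbit_meet G1 GM GV GS iS ii il Ss Ss2 hd.
have [h [Gh gh hg]] := GV _ Gg; exists (g' *m h); first exact: GM.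
by rewrite actM -e1 -(actM h) hg act1.
Qed.

(** * List 1: prescribed inertia and several orbits *)

Section Signature1.
Variables (R : realType) (k : scalars) (n : nat).
Local Notation K := (scal R k).
Variables (b sg c se sm : bool) (A Ai AJ : 'M[K]_n).
Hypothesis hA : is_mform b sg A Ai.
Hypothesis hJ : is_mop c se AJ.
Hypothesis hc : mconsistent b c sm A AJ.
Let ok := mf_ok hA.
Let okc := mo_ok hJ.
Local Notation B := (mform b A).
Local Notation J := (mop c AJ).
Local Notation bD := (b (+) c).
Local Notation sD := ((sg (+) se) (+) sm).
Local Notation D := (adj b AJ *m A).
Let okD := anti_ok_managing hA hJ.
Local Notation S := (pairs_BJ B J).

Lemma managing_mformE : managing B J = mform bD D.
Proof.
by apply/funext => v; apply/funext => w; rewrite /managing /mform -(managing_gram c AJ hA).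
Qed.

Lemma managing_value s : (0 < n)%N -> sD = false -> S s ->
  exists2 v, subsp_set s.1 v & B v (J v) <> 0.
Proof.
move=> n0 sD0 Ss; have [r [F [Gi [[e fF i hG d] _]]]] := pairs1_gram hA hJ hc Ss.
have r0 : (0 < r)%N by case: r d {F e fF Gi i hG} => // d; rewrite -d in n0.
have [] := @nonzero_value _ _ _ _ _ _ _ 1%:M r0 hG.
- by move/matrixP/(_ 0 0); rewrite !mxE eqxx mulr1n => h1; have := oner_neq0 K; rewrite h1 eqxx.
- by rewrite sD0 adjmx1.
move=> v hv; exists (F *m v); first by rewrite e; apply/colspanP; exists v.
have o := okD; rewrite -[B _ _]/(managing B J _ _) managing_mformE /mform adj_sandwich// => h; apply: hv.
by apply/matrixP => x y; rewrite !ord1 [RHS]mxE.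
Qed.

Section Inertia.
Hypothesis hb : forall x : K, tw bD x = sconj x.
Hypothesis sD0 : sD = false.
Hypothesis sm0 : sm = false.

(** Q1 and J Q1 are orthogonal for the managing form, which has the same signature on both since sm
    is trivial. The indices on V are therefore twice those on Q1, and prescribing them fixes the
    congruence class on Q1. *)
Lemma trans_inertia p q s s' : has_inertia (mform bD D) (2 * p, 2 * q)%N -> S s -> S s' ->
  exists2 g, (isometries B `&` centralizer J) g & act g s = s'.
Proof.
move=> hin; have [U [W [hU hW]]] := inertia_frames hin; have [/= pqn _] := hin.
have sig t : S t -> exists r (F : 'M[K]_(n, r)) q1 (X : 'M[K]_(r, p)) (Y : 'M[K]_(r, q1)),
    [/\ t.1 = colspan F, frames F, (r + r)%N = n & signature_frames bD (adj bD F *m D *m F) X Y].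
  move=> St; have [r [F [Gi [[e fF i hG d] _]]]] := pairs1_gram hA hJ hc St.
  rewrite sD0 in hG.
  have [p1 [q1 [X [Y h]]]] := signature_exists okD hb hG.
  have dbl t1 (Z : 'M[K]_(r, t1)) m : adj bD Z *m (adj bD F *m D *m F) *m Z = sgm m 1%:M ->
      adj bD (row_mx (F *m Z) (AJ *m tws c (F *m Z))) *m D *m row_mx (F *m Z) (AJ *m tws c (F *m
        Z)) = sgm m 1%:M.
    move=> hZ; have o := okD; have hZ' : adj bD (F *m Z) *m D *m (F *m Z) = sgm m 1%:M.
      by rewrite adj_sandwich.
    have iZ : adj b (F *m Z) *m A *m (F *m Z) = 0 by rewrite adj_sandwich// i mulmx0 mul0mx.
    rewrite gram_row_mx hZ' (managing_swap hA hJ hc) hZ' sm0 /=.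
    rewrite -!(managing_gram c AJ hA) (mop_mx2 _ hJ).
    rewrite (_ : adj b (AJ *m tws c (F *m Z)) *m A *m (AJ *m tws c (F *m Z)) = 0); last first.
      by rewrite adj_sandwich// hc sm0 /= adj_tws -!twsM// iZ tws0.
    rewrite sgm_adj sgm_mull sgm_mull iZ sgm0 sgm_tws tws1.
    by case: m {hZ hZ'}; rewrite /= [in RHS]scalar_mx_block ?opp_block_mx ?oppr0.
  (* The two bounds read 2 p1 + 2 q <= n and 2 p + 2 q1 <= n, while p1 + q1 and p + q are both n /
     2. *)
  have le1 := sylvester_le okD hb (dbl _ X false (sf_pos h)) hW.
  have le2 := sylvester_le okD hb hU (dbl _ Y true (sf_neg h)).
  have dm := sf_dim h; have p1p : p1 = p by lia.
  by subst p1; exists r, F, q1, X, Y.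
move=> Ss Ss'; have [r [F [q1 [X [Y [e fF d h]]]]]] := sig _ Ss.
have [r' [F' [q1' [X' [Y' [e' fF' d' h']]]]]] := sig _ Ss'.
have rr : r' = r by apply: double_inj; rewrite -!addnn d d'.
subst r'; apply: (trans_of_gram hA hJ hc Ss Ss' e e' fF fF').
exact: (congruent_signature okD h h').
Qed.

End Inertia.

Section NotTransitive.
Hypothesis hb : forall x : K, tw bD x = sconj x.
Variables (x y : K).
Hypothesis xC : forall z, x * z = z * x.
Hypothesis xy : x * y = 1.
Hypothesis xh : (if sD then - tw bD x else tw bD x) = x.
Hypothesis yh : (if sm then - tw c y else tw c y) = - y.

Lemma central_scalar m1 m2 (Z : 'M[K]_(m1, m2)) : x%:M *m Z = Z *m x%:M.
Proof.
apply/matrixP => i j; rewrite mul_scalar_mx !mxE (bigD1 j)//= !mxE eqxx mulr1n big1 ?addr0 ?xC//.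
by move=> l /negPf lj; rewrite mxE lj mulr0n mulr0.
Qed.

(* With [F] a frame of [Q1] split as [P, N] into a positive and a negative
   definite part of the managing form, exchanging [N] or [P] for its image under
   [J] yields a definite space of either sign. *)
Lemma not_transitive s : (0 < n)%N -> S s -> exists s1 s2, [/\ S s1, S s2 &
  ~ exists2 g, (isometries B `&` centralizer J) g & act g s1 = s2].
Proof.
move=> n0 Ss; have [r [F [Gi [[e fF i hG d] _]]]] := pairs1_gram hA hJ hc Ss.
have r0 : (0 < r)%N by case: r d {F e fF Gi i hG} => // d; rewrite -d in n0.
have o := okD; set G := _ *m F in hG.
have yx : y * x = 1 by rewrite -xC.
have cxy m : x%:M *m y%:M = 1%:M :> 'M[K]_m by rewrite -scalar_mxM xy.
have cyx m : y%:M *m x%:M = 1%:M :> 'M[K]_m by rewrite -scalar_mxM yx.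
(* Multiplication by the central scalar [x] turns the managing form into a hermitian one, so that a
   signature exists even in the antihermitian case. *)
have hH : is_mform bD false (x%:M *m G) (Gi *m y%:M).
  split=> //=.
  - by rewrite mulmxA -(mulmxA Gi) cyx mulmx1 (mf_l hG).
  - by rewrite mulmxA -(mulmxA _ G) (mf_r hG) mulmx1 cxy.
  - rewrite adjM// (mf_adj hG) adj_scalar sgm_mull -sgm_mulr central_scalar; congr (_ *m _).
    by rewrite -[in RHS]xh; case: (sD) => //=; rewrite raddfN.
have [p [q [X [Y h]]]] := signature_exists okD hb hH.
have gr m1 m2 (Z1 : 'M[K]_(r, m1)) (Z2 : 'M[K]_(r, m2)) :
    adj bD (F *m Z1) *m D *m (F *m Z2) = y%:M *m (adj bD Z1 *m (x%:M *m G) *m Z2).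
  rewrite adj_sandwich// -/G (mulmxA (adj bD Z1) x%:M) -[adj bD Z1 *m x%:M]central_scalar.
  by rewrite -!(mulmxA x%:M) (mulmxA y%:M) cyx mul1mx.
have Pp := gr _ _ X X; rewrite (sf_pos h) mulmx1 in Pp.
have Nn := gr _ _ Y Y; rewrite (sf_neg h) mulmxN mulmx1 in Nn.
have Pn := gr _ _ X Y; rewrite (sf_pn h) mulmx0 in Pn.
have Np := gr _ _ Y X; rewrite (sf_np h) mulmx0 in Np.
have ib m1 m2 (Z1 : 'M[K]_(r, m1)) (Z2 : 'M[K]_(r, m2)) : adj b (F *m Z1) *m A *m (F *m Z2) = 0.
  by rewrite adj_sandwich// i mulmx0 mul0mx.
clear gr; move: (F *m X) (F *m Y) Pp Nn Pn Np (ib _ _ X X) (ib _ _ Y Y) (ib _ _ X Y) (ib _ _ Y X).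
move=> P N Pp Nn Pn Np bPp bNn bPn bNp.
have J1 m1 m2 (Z1 : 'M[K]_(n, m1)) (Z2 : 'M[K]_(n, m2)) : adj b Z1 *m A *m Z2 = 0 ->
    adj bD Z1 *m D *m (AJ *m tws c Z2) = 0.
  by move=> h0; rewrite -(managing_gram c AJ hA) adj_sandwich// hc sgm_mulr sgm_mull adj_tws
    -!twsM// h0 tws0 sgm0.
have J2 m1 m2 (Z1 : 'M[K]_(n, m1)) (Z2 : 'M[K]_(n, m2)) : adj b Z1 *m A *m Z2 = 0 ->
    adj bD (AJ *m tws c Z1) *m D *m Z2 = 0.
  by move=> h0; rewrite -(managing_gram c AJ hA) (mop_mx2 _ hJ) sgm_adj !sgm_mull h0 sgm0.
have J3 m1 m2 (Z1 : 'M[K]_(n, m1)) (Z2 : 'M[K]_(n, m2)) : adj b Z1 *m A *m Z2 = 0 ->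
    adj b (AJ *m tws c Z1) *m A *m (AJ *m tws c Z2) = 0.
  by move=> h0; rewrite adj_sandwich// hc sgm_mulr sgm_mull adj_tws -!twsM// h0 tws0 sgm0.
have B1 m1 m2 (Z1 : 'M[K]_(n, m1)) (Z2 : 'M[K]_(n, m2)) : adj bD Z1 *m D *m Z2 = 0 ->
    adj b (AJ *m tws c Z1) *m A *m Z2 = 0 /\ adj b Z2 *m A *m (AJ *m tws c Z1) = 0.
  move=> h0; have h1 : adj b (AJ *m tws c Z1) *m A *m Z2 = 0 by rewrite (managing_gram c AJ hA).
  by split=> //; rewrite (gram_sym hA) h1 adj0 sgm0.
have Jy m : sgm sm (tws c (y%:M : 'M[K]_m)) = - y%:M.
  rewrite -(raddfN (scalar_mx : K -> 'M[K]_m)) -yh (_ : tws c y%:M = (tw c y)%:M); last first.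
    by apply/matrixP => u v; rewrite !mxE; case: eqP; rewrite ?mulr1n ?mulr0n ?tw0.
  by case: (sm) => //=; rewrite raddfN.
have JP : adj bD (AJ *m tws c P) *m D *m (AJ *m tws c P) = - y%:M.
  by rewrite (managing_swap hA hJ hc) Pp Jy.
have JN : adj bD (AJ *m tws c N) *m D *m (AJ *m tws c N) = y%:M.
  rewrite (managing_swap hA hJ hc) Nn twsN; have := Jy q.
  by rewrite /sgm; case: (sm) => ->; rewrite opprK.
pose Y1 := row_mx P (AJ *m tws c N); pose Y2 := row_mx (AJ *m tws c P) N.
have g1 : adj bD Y1 *m D *m Y1 = y%:M by rewrite gram_row_mx Pp JN J1// J2// -scalar_mx_block.
have g2 : adj bD Y2 *m D *m Y2 = - y%:M.
  by rewrite gram_row_mx JP Nn J1// J2// [in RHS]scalar_mx_block opp_block_mx !oppr0.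
have [a1 a2] := B1 _ _ _ _ Np; have [a3 a4] := B1 _ _ _ _ Pn.
have i1 : adj b Y1 *m A *m Y1 = 0 by rewrite gram_row_mx bPp a1 a2 J3// block_mx0.
have i2 : adj b Y2 *m A *m Y2 = 0 by rewrite gram_row_mx bNn a3 a4 J3// block_mx0.
have dd : ((p + q) + (p + q))%N = n by rewrite (sf_dim h).
exists (colspan Y1, colspan (AJ *m tws c Y1)), (colspan Y2, colspan (AJ *m tws c Y2)); split.
- by apply: (pairs1_of_gram hA hJ hc dd i1 (M := x%:M)); rewrite g1.
- by apply: (pairs1_of_gram hA hJ hc dd i2 (M := - x%:M)); rewrite g2 mulNmx mulmxN opprK.
move=> [g [/(isometriesP _ _ ok)[_ gA] /(centralizerP _ _ okc)[_ gJ]]] /(congr1 fst) e1.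
have [Z hZ] : exists Z, Y2 = (g *m Y1) *m Z.
  have e2 : colspan (g *m Y1) = colspan Y2 by rewrite -mximage_colspan; exact: e1.
  by apply: colspan_sub => v; rewrite e2.
have gg : adj bD (g *m Y1) *m D *m (g *m Y1) = y%:M.
  by rewrite -g1 -!(managing_gram c AJ hA) twsM// (mulmxA AJ) -gJ -(mulmxA g) adj_sandwich// gA.
(* Expressing [Y2] through the image of [Y1] by [Z] would give Z^* Z = -1, while its diagonal
   entries are sums of squares. *)
have Zz : adj bD Z *m Z = - 1%:M.
  have : adj bD Z *m y%:M *m Z = - y%:M by rewrite -g2 hZ adj_sandwich// gg.
  move/(congr1 (mulmx x%:M)); rewrite mulmxN cxy => <-.
  by rewrite !mulmxA central_scalar -(mulmxA _ x%:M) cxy mulmx1.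
have pq0 : (0 < p + q)%N by rewrite (sf_dim h).
pose z := col (Ordinal pq0) Z; have zz : (adj bD z *m z) 0 0 = - 1.
  have -> : (adj bD z *m z) 0 0 = (adj bD Z *m Z) (Ordinal pq0) (Ordinal pq0).
    by rewrite !mxE; apply: eq_bigr => l _; rewrite !adjE !mxE.
  by rewrite Zz !mxE eqxx mulr1n.
have s0 : 0 <= \sum_i ssq (z i 0) by apply: sumr_ge0 => l _; exact: ssq_ge0.
move: zz; rewrite (adj_col_sqr hb) => /(congr1 (@sre R k)).
by rewrite -sreal1 -srealN !sre_real => ez; rewrite ez lerNr oppr0 ler10 in s0.
Qed.

End NotTransitive.
End Signature1.

(** * List 4: one orbit or several *)

Section List4.
Variables (R : realType) (k : scalars) (n : nat).
Local Notation K := (scal R k).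
Variables (b sg : bool) (A Ai : 'M[K]_n).
Hypothesis hA : is_mform b sg A Ai.
Let ok := mf_ok hA.
Local Notation B := (mform b A).

Lemma gram_mform r (F : 'M[K]_(n, r)) G : G *m (adj b F *m A *m F) = 1%:M ->
  (adj b F *m A *m F) *m G = 1%:M -> is_mform b sg (adj b F *m A *m F) G.
Proof. by move=> h1 h2; split=> //; rewrite !adjM// adjK (mf_adj hA) sgm_mull sgm_mulr mulmxA. Qed.

Lemma pairs4_gram m s : pairs_D m B s -> exists r (F : 'M[K]_(n, m)) (E : 'M[K]_(n, r)) G H,
  [/\ s = (colspan F, colspan E), frames F /\ frames E, (m + r)%N = n,
    is_mform b sg (adj b F *m A *m F) G & is_mform b sg (adj b E *m A *m E) H].
Proof.
case: s => s1 s2 Ss; have [[F fF sF] ds os] : [/\ Gr m s1, direct_sum s1 s2 &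
  orthogonal_complement B s1 = s2] := Ss.
have [G [G1 G2]] := gram_inv hA (s := (s1, s2)) fF (esym sF) Ss.
have [r [E [L [LE eE]]]] := subsp_frame s2; subst s1 s2.
have fE : frames E by apply/frames_linv; exists L.
have [q1 q2] : adj b E *m A *m F = 0 /\ adj b F *m A *m E = 0.
  by apply: (orth_mx hA) => w; rewrite os.
have [M [LM ML]] := direct_sum_row_mx fF fE ds.
have [|H [H1 H2]] := @inj_inv2 _ _ _ (adj b E *m A *m E).
  move=> z hz; have : adj b (row_mx F E) *m A *m row_mx F E *m col_mx 0 z = 0.
    by rewrite gram_row_mx mul_block_col !mulmx0 !add0r q2 hz mul0mx col_mx0.
  have adjM : adj b M *m adj b (row_mx F E) = 1%:M by rewrite -adjM// ML adjmx1.
  move/(congr1 (mulmx (adj b M))); rewrite !mulmxA adjM mul1mx mulmx0.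
  move/(congr1 (mulmx (M *m Ai))); rewrite !mulmxA -(mulmxA M) (mf_l hA) mulmx1 LM mul1mx mulmx0.
  by move/(congr1 (@dsubmx _ m r 1)); rewrite col_mxKd linear0.
exists r, F, E, G, H; split=> //; try exact: gram_mform.
exact: direct_sum_dim fF fE ds.
Qed.

Lemma trans_rigid4 m t (N Ni : 'M[K]_t) : (0 < t)%N -> Ni *m N = 1%:M -> N *m Ni = 1%:M ->
  has_normal_block b sg N -> forall s s', pairs_D m B s -> pairs_D m B s' ->
  exists2 g, isometries B g & act g s = s'.
Proof.
move=> t0 N1 N2 hn s s' Ss Ss'.
have [r [F [E [G [H [e [fF fE] d hG hH]]]]]] := pairs4_gram Ss.
have [r' [F' [E' [G' [H' [e' [fF' fE'] d' hG' hH']]]]]] := pairs4_gram Ss'.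
have rr : r' = r by apply/eqP; rewrite -(eqn_add2l m) d d'.
subst r'; have [C [C' [hC CC' C'C]]] := congruent_rigid t0 N1 N2 hn hG hG'.
have [Z [Z' [hZ ZZ' Z'Z]]] := congruent_rigid t0 N1 N2 hn hH hH'.
have fr u (X : 'M[K]_(n, u)) Y Y' : Y' *m Y = 1%:M -> frames X -> frames (X *m Y).
  move=> YY /frames_linv[L LX]; apply/frames_linv; exists (Y' *m L).
  by rewrite mulmxA -(mulmxA Y') LX mulmx1.
apply: (trans_list4 hA Ss Ss' (F1 := F *m C) (F2 := E *m Z) (F1' := F') (F2' := E')) => //.
- by rewrite (colspan_mul _ CC') (colspan_mul _ ZZ').
- exact: fr C'C fF.
- exact: fr Z'Z fE.
- by rewrite adj_sandwich.
- by rewrite adj_sandwich.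
Qed.

Section NotTransitive.
Hypothesis hb : forall x : K, tw b x = sconj x.
Hypothesis sg0 : sg = false.
Variables (p q : nat) (e ei : 'M[K]_n).
Hypothesis pq : (p + q)%N = n.
Hypothesis eie : e *m ei = 1%:M.
Local Notation sgn i := (if (i < p)%N then 1 else - 1 : R).
Hypothesis he : forall i j : 'I_n,
  B (col i e) (col j e) = if i == j then if (i < p)%N then 1 else -1 else 0.

Lemma diag_gram : adj b e *m A *m e = diag_mx (\row_i (sreal k (sgn i))).
Proof.
apply/matrixP => i j; have := gram_colsub b A id id e i j; rewrite (_ : colsub id e = e); last by
  apply/matrixP => u v; rewrite mxE.
move=> ->; rewrite he !mxE eq_sym; case: eqP => // <-; rewrite mulr1n.
by case: ifP; rewrite ?srealN sreal1.
Qed.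

Lemma diag_value u : exists z : 'cV[K]_n, [/\ u = e *m z,
  B u u = sreal k (\sum_(i < n) sgn i * ssq (z i 0)) & forall i, B u (col i e) = 0 -> z i 0 = 0].
Proof.
have [z uz] : exists z, u = e *m z by exists (ei *m u); rewrite mulmxA eie mul1mx.
exists z; split=> //.
  rewrite uz /mform adj_sandwich// diag_gram -mulmxA mxE.
  elim/big_rec2: _ => [|i x y _ ->]; first by rewrite sreal0.
  by rewrite srealD adjE hb mul_diag_mx !mxE srealC mulrA ssqE -srealM mulrC.
move=> i; rewrite uz /mform.
have -> : (adj b (col i e) *m A *m (e *m z)) 0 0 = (adj b e *m A *m e *m z) i 0.
  rewrite -!mulmxA !mxE; apply: eq_bigr => l _; by rewrite !adjE !mxE.
rewrite diag_gram mul_diag_mx !mxE => h.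
rewrite -[z i 0]mul1r -(sreal1 R k) -(_ : sgn i * sgn i = 1) ?srealM -?mulrA ?h ?mulr0//.
by case: ifP; rewrite ?mulrNN mulr1.
Qed.

Lemma ssq0 : ssq (0 : K) = 0.
Proof. by have := ssqE (0 : K); rewrite mulr0 => /(congr1 (@sre R k)); rewrite sre_real -(sreal0 R
  k) sre_real. Qed.

Lemma value_ge0 u : (forall i : 'I_n, (p <= i)%N -> B u (col i e) = 0) -> B u u <> - 1.
Proof.
move=> h; have [z [_ -> hz]] := diag_value u.
have s0 : 0 <= \sum_(i < n) sgn i * ssq (z i 0).
  apply: sumr_ge0 => i _; case: ltnP => ip; first by rewrite mul1r ssq_ge0.
  by rewrite hz ?h// ssq0 mulr0.
by rewrite -sreal1 -srealN => /(congr1 (@sre R k)); rewrite !sre_real => ez; rewrite ez lerNr oppr0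
  ler10 in s0.
Qed.

Lemma value_le0 u : (forall i : 'I_n, (i < p)%N -> B u (col i e) = 0) -> B u u <> 1.
Proof.
move=> h; have [z [_ -> hz]] := diag_value u.
have s0 : 0 <= - \sum_(i < n) sgn i * ssq (z i 0).
  rewrite -sumrN; apply: sumr_ge0 => i _; case: ltnP => ip; last by rewrite mulN1r opprK ssq_ge0.
  by rewrite hz ?h// ssq0 mulr0 oppr0.
by rewrite -sreal1 => /(congr1 (@sre R k)); rewrite !sre_real => ez; rewrite ez lerNr oppr0 ler10 in s0.
Qed.

Lemma diag_pair m (f : 'I_m -> 'I_n) : injective f ->
  exists2 s, pairs_D m B s & s.1 = colspan (colsub f e).
Proof.
move=> fi; set F := colsub f e.
have gF : adj b F *m A *m F = diag_mx (\row_i (sreal k (sgn (f i)))).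
  apply/matrixP => i j; rewrite gram_colsub he !mxE (inj_eq fi) eq_sym; case: eqP => // <-; rewrite mulr1n.
  by case: ifP; rewrite ?srealN sreal1.
have GG : adj b F *m A *m F *m (adj b F *m A *m F) = 1%:M.
  rewrite gF mulmx_diag; apply/matrixP => i j; rewrite !mxE -srealM; congr (_ *+ _).
  by rewrite (_ : sgn (f i) * sgn (f i) = 1) ?sreal1//; case: ifP; rewrite ?mulrNN mulr1.
by have := pairs4_intro hA GG GG; eexists; [exact: H|].
Qed.

Lemma diag_orth m (f : 'I_m -> 'I_n) i u : (forall j, f j != i) -> subsp_set (colspan (colsub f e)) u ->
  B u (col i e) = 0.
Proof.
move=> fi /colspanP[z <-]; rewrite /mform mulmxA (_ : adj b (col i e) *m A *m colsub f e = 0) ?mul0mx ?mxE//.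
apply/matrixP => x j; have := gram_colsub b A (fun=> i) f e x j; rewrite he (negPf (fi j)) => h0.
rewrite [RHS]mxE -h0.
congr (fun_of_matrix (adj b _ *m _ *m _) x j).
Qed.

(** Compare the spans of the first and of the last [m] basis vectors. If m <= p the first is
    positive definite and the second contains a negative vector. Otherwise the complement of the
    first is negative definite and that of the second contains a positive vector. *)
Lemma not_transitive4 m : (0 < p)%N -> (0 < q)%N -> (0 < m)%N -> (m < n)%N ->
  exists s1 s2, [/\ pairs_D m B s1, pairs_D m B s2 & ~ exists2 g, isometries B g & act g s1 = s2].
Proof.
move=> p0 q0 m0 mn; have n0 := ltn_trans m0 mn.
pose f1 := widen_ord (ltnW mn); pose f2 i := rev_ord (f1 i).
have f1i : injective f1 by move=> i j /(congr1 val) /= /val_inj.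
have f2i : injective f2 by move=> i j /rev_ord_inj /f1i.
have [s1 S1 e1] := diag_pair f1i; have [s2 S2 e2] := diag_pair f2i.
exists s1, s2; split=> // -[g [Gg hg] as12].
have B1 i : B (col i e) (col i e) = if (i < p)%N then 1 else -1 by rewrite he eqxx.
have [mp|pm] := leqP m p.
  pose j0 := Ordinal m0; pose i0 := f2 j0.
  have : subsp_set s2.1 (col i0 e).
    rewrite e2; apply/colspanP; exists (delta_mx j0 0).
    by rewrite -colE; apply/matrixP => x y; rewrite !mxE.
  rewrite -as12 /= => -[u us1 gu].
  apply: (@value_ge0 u).
    move=> i pi; rewrite e1 in us1; apply: (diag_orth _ us1) => j; rewrite -(inj_eq val_inj) /=.
    by apply: contraTneq pi => <-; rewrite -ltnNge (leq_trans _ mp).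
  by rewrite -hg gu B1 /= subn1 -pq -(ltn_predK q0) addnS /= ltnNge leq_addr.
have i0P : (0 < n)%N by []; pose i0 := Ordinal i0P.
have : subsp_set s2.2 (col i0 e).
  have [_ _ os] := S2; rewrite -os e2 => v vs; apply: diag_orth vs => j.
  rewrite -(inj_eq val_inj) /= -lt0n subn_gt0; exact: leq_ltn_trans (ltn_ord j) mn.
rewrite -as12 /= => -[u us1 gu].
apply: (@value_le0 u); last by rewrite -hg gu B1 /= p0.
have [_ _ os] := S1; move: us1; rewrite -os e1 => us i ip.
have im : (i < m)%N by apply: ltn_trans ip pm.
have : B (col i e) u = 0.
  apply: us; apply/colspanP; exists (delta_mx (Ordinal im) 0); rewrite -colE.
  by apply/matrixP => x y; rewrite !mxE; congr (e _ _); exact: val_inj.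
have := gram_sym hA u (col i e).
rewrite sg0 /mform /= => h1 h2; apply: (can_inj (twK b)).
by rewrite tw0 -h2 h1 adjE.
Qed.

End NotTransitive.
End List4.

(** * The five lists *)

Section Realization.
Variables (R : realType) (k : scalars) (n : nat) (T : topologicalType).
Variables (G : set 'M[scal R k]_n) (S : set (subsp (scal R k) n * subsp (scal R k) n)).
Variables (Grs : set T) (iota : subsp (scal R k) n * subsp (scal R k) n -> T).
Hypothesis M : open_model G S Grs iota.

Lemma open_realization_of_model d :
  (forall s, S s -> density_claim d Grs (iota @` S) (iota @` Defs.orbit G s)) ->
  open_realization G S Grs iota d.
Proof.
case: M => G1 GM GV GS iS ii ic il hd; split; first exact: (orbit_embedding G1 GM GV GS iS ii ic il).
by move=> s Ss; split; [exact: (orbit_sub GS Ss)|exact: (orbit_open GM GS il Ss)|exact: hd].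
Qed.

Definition act_transitive := forall s s', S s -> S s' -> exists2 g, G g & act g s = s'.

Lemma closure_orbit s : act_transitive -> S s -> closure (iota @` S) `<=` closure (iota @` Defs.orbit G s).
Proof.
move=> tr Ss; apply: closure_subset => _ [s' Ss' <-]; exists s' => //.
by have [g Gg e] := tr _ _ Ss Ss'; exists g.
Qed.

Lemma realization_dense : act_transitive -> (forall s, S s -> Grs `<=` closure (iota @` S)) ->
  open_realization G S Grs iota Dense.
Proof.
move=> tr hd; apply: open_realization_of_model => s Ss q Gq.
exact: (closure_orbit tr Ss) (hd _ Ss _ Gq).
Qed.

Lemma realization_components : act_transitive -> (forall s, S s -> forall q, Grs q ->
    connected_component Grs q `&` (iota @` S) !=set0 -> closure (iota @` S) q) ->
  open_realization G S Grs iota DenseInComponents.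
Proof.
move=> tr hd; apply: open_realization_of_model => s Ss q Gq cq.
exact: (closure_orbit tr Ss) (hd _ Ss _ Gq cq).
Qed.

Lemma realization_not_dense (c : bool) : (c -> forall s, S s -> exists s1 s2,
    [/\ S s1, S s2 & ~ exists2 g, G g & act g s1 = s2]) ->
  open_realization G S Grs iota (NotDense c).
Proof.
move=> hn; apply: open_realization_of_model => s Ss hc hd.
by have [s1 [s2 [S1 S2]]] := hn hc s Ss; apply; exact: (dense_orbit_trans M Ss S1 S2 hd).
Qed.

End Realization.

Definition star_type t := if t is (Defs.Hermitian | Antihermitian) then true else false.
Definition sign_type t := if t is (SkewSymmetric | Antihermitian) then true else false.
Definition star_operator l := if l is Antilinear then true else false.
Definition int_sign (s : bool) : int := if s then -1 else 1.

Section Matrices.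
Variables (R : realType) (k : scalars) (n : nat).
Local Notation K := (scal R k).

(** The uniform shape puts the twisted scalar of the second argument on the left; a bilinear form
    has it on the right, which is the same over a commutative field, and [anti_ok] excludes the
    quaternions there. *)
Lemma is_form_mx t (B : 'cV[K]_n -> 'cV[K]_n -> K) : anti_ok k (star_type t) -> is_form t B ->
  exists A Ai, is_mform (star_type t) (sign_type t) A Ai /\ B = mform (star_type t) A.
Proof.
move=> ok [nd ht].
have [[hB hZ] hs] : (biadditive B /\ forall (v w : 'cV[K]_n) (c : K), B (v *m c%:M) w = B v w * c /\
    B v (w *m c%:M) = tw (star_type t) c * B v w) /\
    forall v w, B v w = (if sign_type t then - tw (star_type t) (B w v) else tw (star_type t) (B w v)).
  move: ok; rewrite /anti_ok; case: t ht => -[[hB hZ] hs] ok; split=> //; split=> // v w c.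
    by have [-> ->] := hZ v w c; split=> //; apply: scomm; exact: ok.
  by have [-> ->] := hZ v w c; split=> //; apply: scomm; exact: ok.
have [A hA] := form_mx hB hZ.
have [|Ai [l r]] := @inj_inv2 _ _ _ A.
  by move=> z Az; apply: nd => w; rewrite hA /mform -mulmxA Az mulmx0 mxE.
exists A, Ai; split; last by apply/funext => v; apply/funext => w.
split=> //; apply: (mform_ext (b := star_type t)) => v w.
have e : adj (star_type t) w *m adj (star_type t) A *m v = adj (star_type t) (adj (star_type t) v *m A *m w).
  by rewrite !adjM// adjK mulmxA.
rewrite e adjE sgm_mulr sgm_mull; have := hs v w; rewrite !hA /mform /sgm.
by case: (sign_type t) => h; [rewrite [RHS]mxE h opprK|rewrite h].
Qed.

Lemma semiinvolution_mx l se (J : 'cV[K]_n -> 'cV[K]_n) : auto_ok k (star_operator l) ->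
  semiinvolution l (int_sign se) J -> exists AJ, is_mop (star_operator l) se AJ /\ J = mop
    (star_operator l) AJ.
Proof.
move=> ok [/operator_mx[A hA] hJ]; exists A; split; last by apply/funext.
split=> //; apply: mulmx_ext => v; rewrite sgm_mull mul1mx.
have := hJ v; rewrite !hA twsM// twsK mulmxA => ->.
by rewrite /sgm /int_sign; case: se {hJ}; rewrite ?mulr1z // mulrNz mulr1z.
Qed.

Lemma consistent_mx l sm b sg (A Ai AJ : 'M[K]_n) : auto_ok k (star_operator l) -> is_mform b sg A Ai ->
  consistent l (int_sign sm) (mform b A) (mop (star_operator l) AJ) -> mconsistent b (star_operator
    l) sm A AJ.
Proof.
move=> okc hA h; have ok := mf_ok hA; apply: (mform_ext (b := b)) => v w.
have := h (tws (star_operator l) v) (tws (star_operator l) w); rewrite /mop !twsK /mform.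
rewrite adjM// !mulmxA => ->.
rewrite sgm_mulr sgm_mull.
have -> : adj b w *m tws (star_operator l) A *m v = tws (star_operator l)
    (adj b (tws (star_operator l) w) *m A *m tws (star_operator l) v).
  by rewrite !twsM// twsK -adj_tws twsK.
set Y := _ *m tws _ v.
have <- : tws (star_operator l) Y 0 0 = if l is Linear then Y 0 0 else sconj (Y 0 0).
  by case: (l); rewrite mxE.
by rewrite /sgm /int_sign; case: (sm); rewrite /= ?mulrNz mulr1z // [RHS]mxE.
Qed.

End Matrices.

Section Units.
Variable R : realType.

(* [y] is the nonzero value that makes a 1 x 1 matrix of the symmetry opposite to
   the form: a shear by such matrices keeps a Lagrangian isotropic. *)
Definition isotropy_unit k b (sg : bool) := exists x y : scal R k, x * y = 1 /\ tw b y = - (if sg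
  then - y else y).

Lemma isotropy_unit_skew k b : isotropy_unit k b true.
Proof. by exists 1, 1; rewrite mulr1 opprK -(sreal1 R k) tw_real. Qed.

Definition ci : scal R Complexes := (0 +i* 1)%C.

Lemma ci2 : ci * ci = - 1.
Proof. by apply/eqP; rewrite eq_complex /= !mulr0 mul0r mulr1 sub0r addr0 oppr0 !eqxx. Qed.

Lemma ci_conj : sconj ci = - ci.
Proof. by apply/eqP; rewrite eq_complex /= oppr0 !eqxx. Qed.

Lemma qi_conj : sconj (qi R) = - qi R.
Proof. by congr (_, _, _, _) => /=; rewrite oppr0. Qed.

Lemma isotropy_unit_hermitian k : k <> Reals -> isotropy_unit k true false.
Proof.
case: k => // _; first by exists (- ci), ci; rewrite mulNr ci2 opprK /tw ci_conj.
by exists (- qi R), (qi R); rewrite mulNr qi2 opprK /tw qi_conj.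
Qed.

(** The types with a single congruence class in each size: skew-symmetric, complex symmetric and
    quaternionic antihermitian forms. *)
Definition rigid k b sg := exists t (N Ni : 'M[scal R k]_t),
  [/\ (0 < t)%N, Ni *m N = 1%:M, N *m Ni = 1%:M & has_normal_block b sg N].

Lemma rigid_skew k : k <> Quaternions -> rigid k false true.
Proof.
move=> hk; exists (1 + 1)%N, (block_mx 0 (- 1%:M) 1%:M 0), (block_mx 0 1%:M (- 1%:M) 0).
split=> //; last exact: normal_skew.
  rewrite mulmx_block !mulmx0 !mul0mx !mulmx1 mulNmx mulmxN mulmx1 opprK !addr0 !add0r.
  by rewrite -scalar_mx_block.
rewrite mulmx_block !mulmx0 !mul0mx !mulmx1 mulNmx mulmxN mulmx1 opprK !addr0 !add0r.
by rewrite -scalar_mx_block.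
Qed.

Lemma rigid_symmetric : rigid Complexes false false.
Proof. by exists 1%N, 1%:M, 1%:M; rewrite mulmx1; split=> //; exact: normal_sym_complex. Qed.

Lemma rigid_antihermitian : rigid Quaternions true true.
Proof.
exists 1%N, (qi R)%:M, (- qi R)%:M; rewrite -!scalar_mxM mulNr mulrN qi2 opprK.
by split=> //; exact: normal_anti_quat.
Qed.

End Units.

Section ListOne.
Variables (R : realType) (k : scalars) (n : nat) (t : form_type) (l : operator_type) (se sm : bool).
Local Notation K := (scal R k).
Local Notation b := (star_type t).
Local Notation sg := (sign_type t).
Local Notation c := (star_operator l).
Hypothesis ok : anti_ok k b.
Hypothesis okc : auto_ok k c.
Variables (B : 'cV[K]_n -> 'cV[K]_n -> K) (J : 'cV[K]_n -> 'cV[K]_n).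
Hypothesis hB : is_form t B.
Hypothesis hJ : semiinvolution l (int_sign se) J.
Hypothesis hc : consistent l (int_sign sm) B J.
Local Notation G := (isometries B `&` centralizer J).
Local Notation S := (pairs_BJ B J).

Lemma list1_mx : exists A Ai AJ, [/\ is_mform b sg A Ai, is_mop c se AJ, mconsistent b c sm A AJ,
  B = mform b A & J = mop c AJ].
Proof.
have [A [Ai [hA eB]]] := is_form_mx ok hB; have [AJ [hAJ eJ]] := semiinvolution_mx okc hJ.
exists A, Ai, AJ; split=> //; move: hc; rewrite eB eJ; exact: consistent_mx okc hA.
Qed.

Lemma transitive_rigid1 : rigid R k (b (+) c) ((sg (+) se) (+) sm) -> act_transitive G S.
Proof.
move=> [r [N [Ni [r0 h1 h2 hn]]]]; have [A [Ai [AJ [hA hAJ hAc -> ->]]]] := list1_mx.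
by move=> s s'; exact: (trans_rigid hA hAJ hAc r0 h1 h2 hn).
Qed.

Lemma transitive_inertia1 p q : (forall x : K, tw (b (+) c) x = sconj x) ->
  (sg (+) se) (+) sm = false -> sm = false ->
  has_inertia (managing B J) (2 * p, 2 * q)%N -> act_transitive G S.
Proof.
move=> hb sD sm0; have [A [Ai [AJ [hA hAJ hAc -> ->]]]] := list1_mx.
rewrite (managing_mformE _ _ hA) => hin s s'; exact: (trans_inertia hA hAJ hAc hb sD sm0 hin).
Qed.

Lemma dense1 : act_transitive G S -> isotropy_unit R k b sg ->
  open_realization G S (max_isotropic B) (fun s => s.1) Dense.
Proof.
have [A [Ai [AJ [hA hAJ hAc -> ->]]]] := list1_mx => tr [x [y [xy hy]]].
apply: (realization_dense (model1 hA hAJ hAc) tr) => s Ss.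
exact: (dense_list1 hA hAJ hAc Ss xy hy).
Qed.

Lemma components1 : act_transitive G S ->
  open_realization G S (max_isotropic B) (fun s => s.1) DenseInComponents.
Proof.
have [A [Ai [AJ [hA hAJ hAc -> ->]]]] := list1_mx => tr.
apply: (realization_components (model1 hA hAJ hAc) tr) => s Ss q mq cq.
exact: (component_list1 hA hAJ hAc Ss mq cq).
Qed.

(** [x] makes the managing form hermitian: it is 1 when the form is already so, and i when it is
    antihermitian over C. The condition on [y] says that J reverses the sign of a definite part, so
    both signatures occur. *)
Lemma not_dense1 n' (x y : K) : n = (2 * n')%N -> (forall x : K, tw (b (+) c) x = sconj x) ->
  (forall z, x * z = z * x) -> x * y = 1 ->
  (if (sg (+) se) (+) sm then - tw (b (+) c) x else tw (b (+) c) x) = x ->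
  (if sm then - tw c y else tw c y) = - y ->
  open_realization G S (max_isotropic B) (fun s => s.1) (NotDense (0 < n')%N).
Proof.
have [A [Ai [AJ [hA hAJ hAc -> ->]]]] := list1_mx => nn hb xC xy xh yh.
apply: (realization_not_dense (model1 hA hAJ hAc)) => n0 s Ss.
by apply: (not_transitive hA hAJ hAc hb xC xy xh yh _ Ss); rewrite nn mul2n double_gt0.
Qed.

End ListOne.

Lemma dense1_symmetric (R : realType) k n l : k <> Quaternions -> forall (B : 'cV[scal R k]_n ->
  'cV[scal R k]_n -> scal R k) J,
  is_form Symmetric B -> semiinvolution l 1 J -> consistent l 1 B J ->
  act_transitive (isometries B `&` centralizer J) (pairs_BJ B J) ->
  open_realization (isometries B `&` centralizer J) (pairs_BJ B J) (max_isotropic B) (fun s => s.1) Dense.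
Proof.
move=> hk B J hB hJ hc.
have [||A [Ai [AJ [hA hAJ hAc -> ->]]]] := @list1_mx R k n Symmetric l false false _ _ B J hB hJ hc.
- by move=> _.
- by move=> _.
move=> tr; apply: (realization_dense (model1 hA hAJ hAc) tr) => s Ss.
(* In dimension 0 there is no vector with B(v, J v) nonzero, but all subspaces coincide. *)
have [n0|n0] := posnP n.
  by move=> q _; apply: subset_closure; exists s => //; exact: subsp_eq0.
have [v vs hv] := managing_value hA hAJ hAc n0 erefl Ss.
exact: (dense_list1_sym hA hAJ hAc Ss vs hv).
Qed.

Section ListTwo.
Variables (R : realType) (k : scalars) (n : nat) (t : form_type).
Local Notation K := (scal R k).
Local Notation b := (star_type t).
Local Notation sg := (sign_type t).
Hypothesis ok : anti_ok k b.
Variable B : 'cV[K]_n -> 'cV[K]_n -> K.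
Hypothesis hB : is_form t B.

Lemma dense2 : isotropy_unit R k b sg ->
  open_realization (isometries B) (pairs_B B) (max_isotropic B `*` max_isotropic B) id Dense.
Proof.
have [A [Ai [hA ->]]] := is_form_mx ok hB => -[x [y [xy hy]]].
apply: (realization_dense (model2 hA)) => [s s'|s Ss]; first exact: (trans_list2 hA).
by rewrite image_id; exact: (dense_list2 hA Ss xy hy).
Qed.

Lemma components2 :
  open_realization (isometries B) (pairs_B B) (max_isotropic B `*` max_isotropic B) id DenseInComponents.
Proof.
have [A [Ai [hA ->]]] := is_form_mx ok hB.
apply: (realization_components (model2 hA)) => [s s'|s Ss q mq]; first exact: (trans_list2 hA).
by rewrite image_id; exact: (component_list2 hA Ss mq).
Qed.

Lemma dense4 m : rigid R k b sg ->
  open_realization (isometries B) (pairs_D m B) (Gr m) (fun s => s.1) Dense.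
Proof.
have [A [Ai [hA ->]]] := is_form_mx ok hB => -[r [N [Ni [r0 h1 h2 hn]]]].
apply: (realization_dense (model4 m hA)); last by move=> s; exact: (dense_list4 hA).
by move=> s s'; exact: (trans_rigid4 hA r0 h1 h2 hn).
Qed.

Lemma not_dense4 p q m : (forall x : K, tw b x = sconj x) -> sg = false -> (p + q)%N = n ->
  has_inertia B (p, q) ->
  open_realization (isometries B) (pairs_D m B) (Gr m) (fun s => s.1)
    (NotDense [&& 0 < p, 0 < q, 0 < m & m < p + q]%N).
Proof.
have [A [Ai [hA ->]]] := is_form_mx ok hB => hb sg0 pq [_ [e [ei [e1 _]] he]].
apply: (realization_not_dense (model4 m hA)) => /and4P[p0 q0 m0 mn] s _.
by rewrite pq in mn; exact: (not_transitive4 hA hb sg0 pq e1 he p0 q0 m0 mn).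
Qed.

End ListTwo.

Lemma dense3 (R : realType) k n l se (J : 'cV[scal R k]_(2 * n) -> 'cV[scal R k]_(2 * n)) :
  auto_ok k (star_operator l) -> semiinvolution l (int_sign se) J ->
  open_realization (centralizer J) (pairs_J J) (Gr n) (fun s => s.1) Dense.
Proof.
move=> okc hJ; have [AJ [hAJ ->]] := semiinvolution_mx okc hJ.
have nn : (2 * n = n + n)%N by rewrite mul2n addnn.
have [M|[s Ss []]] := model3 n hAJ; last exact: (pairs_J_dim hAJ nn Ss).
apply: (realization_dense M) => [s s'|s]; first exact: (trans_list3 hAJ).
exact: (dense_list3 hAJ nn).
Qed.

Lemma dense5 (R : realType) k p q : open_realization (GL (p + q)) (pairs_dim p q)
  (Gr p `*` Gr q : set (subsp (scal R k) (p + q) * _)) id Dense.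
Proof.
apply: (realization_dense (model5 R k (p + q) p q)) => [s s'|s]; first exact: trans_list5.
by rewrite image_id; exact: dense_list5.
Qed.

Theorem mainTheorem2 (R : realType) :
  [/\ (* List 1 *)
      forall k t l eps mu N inertia d, list1 k t l eps mu N inertia d ->
      forall (B : 'cV[scal R k]_N -> 'cV[scal R k]_N -> scal R k)
             (J : 'cV[scal R k]_N -> 'cV[scal R k]_N),
        is_form t B -> semiinvolution l eps J -> consistent l mu B J ->
        split_pair B J ->
        (forall ab, inertia = Some ab -> has_inertia (managing B J) ab) ->
        open_realization (isometries B `&` centralizer J) (pairs_BJ B J)
          (max_isotropic B) (fun s => s.1) d,
      (* List 2 *)
      forall k t d n, list2 k t d ->
      forall B : 'cV[scal R k]_(2 * n) -> 'cV[scal R k]_(2 * n) -> scal R k,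
        is_form t B -> split_form B ->
        open_realization (isometries B) (pairs_B B)
          (max_isotropic B `*` max_isotropic B) id d,
      (* List 3 *)
      forall k l eps n, list3 k l eps ->
      forall J : 'cV[scal R k]_(2 * n) -> 'cV[scal R k]_(2 * n),
        semiinvolution l eps J -> split_semiinvolution J ->
        open_realization (centralizer J) (pairs_J J) (Gr n) (fun s => s.1)
          Dense,
      (* List 4 *)
      forall k t N inertia m d, list4 k t N inertia m d ->
      forall D : 'cV[scal R k]_N -> 'cV[scal R k]_N -> scal R k,
        is_form t D ->
        (forall ab, inertia = Some ab -> has_inertia D ab) ->
        open_realization (isometries D) (pairs_D m D) (Gr m) (fun s => s.1) d
    & (* List 5 *)
      forall k p q,
        open_realization (GL (p + q)) (pairs_dim p q)
          (Gr p `*` Gr q : set (subsp (scal R k) (p + q) * _)) id Dense].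
Proof.
have antiR b : anti_ok Reals b by [].
have antiC b : anti_ok Complexes b by [].
have antiH : anti_ok Quaternions true by [].
have autoR c : auto_ok Reals c by [].
have autoC c : auto_ok Complexes c by [].
have autoH : auto_ok Quaternions false by [].
have neqR : Reals <> Quaternions by [].
have neqC : Complexes <> Quaternions by [].
have skR := rigid_skew R neqR.
have skC := rigid_skew R neqC.
have herC : isotropy_unit R Complexes true false by exact: isotropy_unit_hermitian.
have herH : isotropy_unit R Quaternions true false by exact: isotropy_unit_hermitian.
have oneC k (z : scal R k) : 1 * z = z * 1 by rewrite mul1r mulr1.
have ciC (z : scal R Complexes) : ci R * z = z * ci R by exact: scomm.
have cixy : ci R * - ci R = 1 by rewrite mulrN ci2 opprK.
have cixh : - sconj (ci R) = ci R by rewrite ci_conj opprK.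
have ciyh : sconj (- ci R) = - - ci R by exact: (etrans (twN true (ci R)) (congr1 -%R (ci_conj R))).
split.
(* The type of the managing form decides each row outside the starred ones: [rigid] types give one
   orbit outright, real symmetric and hermitian types through the prescribed inertia. In the
   symmetric rows treated by [components1] the managing form is skew-symmetric, so B(v, J v) is
   always 0 and the reflection argument has no vector to start from. *)
- move=> k t l eps mu N inertia d; case.
  - move=> p q B J hB hJ hc _ hin; exact: (dense1_symmetric neqR hB hJ hc (@transitive_inertia1 R
      Reals _ Symmetric Linear false false (antiR _) (autoR _) B J hB hJ hc _ _ (fun=> erefl) erefl
      erefl (hin _ erefl))).
  - move=> n B J hB hJ hc _ hin; exact: (@dense1 R Reals _ SkewSymmetric Linear false false (antiR
      _) (autoR _) B J hB hJ hc (@transitive_rigid1 R Reals _ SkewSymmetric Linear false false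
      (antiR _) (autoR _) B J hB hJ hc skR) (isotropy_unit_skew R _ _)).
  - move=> n B J hB hJ hc _ hin; exact: (@not_dense1 R Reals _ SkewSymmetric Linear false true
      (antiR _) (autoR _) B J hB hJ hc n 1 1 erefl (fun=> erefl) (oneC _) (mulr1 _) (tw1 _ _ _)
      erefl).
  - move=> n B J hB hJ hc _ hin; exact: (@components1 R Reals _ Symmetric Linear false true (antiR
      _) (autoR _) B J hB hJ hc (@transitive_rigid1 R Reals _ Symmetric Linear false true (antiR _)
      (autoR _) B J hB hJ hc skR)).
  - move=> n B J hB hJ hc _ hin; exact: (@not_dense1 R Reals _ Symmetric Linear true true (antiR _)
      (autoR _) B J hB hJ hc n 1 1 erefl (fun=> erefl) (oneC _) (mulr1 _) (tw1 _ _ _) erefl).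
  - move=> n B J hB hJ hc _ hin; exact: (@dense1 R Reals _ SkewSymmetric Linear true true (antiR _)
      (autoR _) B J hB hJ hc (@transitive_rigid1 R Reals _ SkewSymmetric Linear true true (antiR _)
      (autoR _) B J hB hJ hc skR) (isotropy_unit_skew R _ _)).
  - move=> n B J hB hJ hc _ hin; exact: (@components1 R Reals _ Symmetric Linear true false (antiR
      _) (autoR _) B J hB hJ hc (@transitive_rigid1 R Reals _ Symmetric Linear true false (antiR _)
      (autoR _) B J hB hJ hc skR)).
  - move=> p q B J hB hJ hc _ hin; exact: (@dense1 R Reals _ SkewSymmetric Linear true false (antiR
      _) (autoR _) B J hB hJ hc (@transitive_inertia1 R Reals _ SkewSymmetric Linear true false
      (antiR _) (autoR _) B J hB hJ hc _ _ (fun=> erefl) erefl erefl (hin _ erefl))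
      (isotropy_unit_skew R _ _)).
  - move=> n B J hB hJ hc _ hin; exact: (dense1_symmetric neqC hB hJ hc (@transitive_rigid1 R
      Complexes _ Symmetric Linear false false (antiC _) (autoC _) B J hB hJ hc (rigid_symmetric
      R))).
  - move=> n B J hB hJ hc _ hin; exact: (@dense1 R Complexes _ SkewSymmetric Linear false false
      (antiC _) (autoC _) B J hB hJ hc (@transitive_rigid1 R Complexes _ SkewSymmetric Linear false
      false (antiC _) (autoC _) B J hB hJ hc skC) (isotropy_unit_skew R _ _)).
  - move=> p q B J hB hJ hc _ hin; exact: (@dense1 R Complexes _ Defs.Hermitian Linear false false
      (antiC _) (autoC _) B J hB hJ hc (@transitive_inertia1 R Complexes _ Defs.Hermitian Linear
      false false (antiC _) (autoC _) B J hB hJ hc _ _ (fun=> erefl) erefl erefl (hin _ erefl))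
      herC).
  - move=> n B J hB hJ hc _ hin; exact: (@components1 R Complexes _ Symmetric Linear false true
      (antiC _) (autoC _) B J hB hJ hc (@transitive_rigid1 R Complexes _ Symmetric Linear false
      true (antiC _) (autoC _) B J hB hJ hc skC)).
  - move=> n B J hB hJ hc _ hin; exact: (@dense1 R Complexes _ SkewSymmetric Linear false true
      (antiC _) (autoC _) B J hB hJ hc (@transitive_rigid1 R Complexes _ SkewSymmetric Linear false
      true (antiC _) (autoC _) B J hB hJ hc (rigid_symmetric R)) (isotropy_unit_skew R _ _)).
  - move=> n B J hB hJ hc _ hin; exact: (@not_dense1 R Complexes _ Defs.Hermitian Linear false true
      (antiC _) (autoC _) B J hB hJ hc n (ci R) (- ci R) erefl (fun=> erefl) ciC cixy cixh erefl).
  - move=> n B J hB hJ hc _ hin; exact: (@not_dense1 R Complexes _ SkewSymmetric Antilinear false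
      false (antiC _) (autoC _) B J hB hJ hc n (ci R) (- ci R) erefl (fun=> erefl) ciC cixy cixh
      ciyh).
  - move=> p q B J hB hJ hc _ hin; exact: (dense1_symmetric neqC hB hJ hc (@transitive_inertia1 R
      Complexes _ Symmetric Antilinear false false (antiC _) (autoC _) B J hB hJ hc _ _ (fun=>
      erefl) erefl erefl (hin _ erefl))).
  - move=> n B J hB hJ hc _ hin; exact: (@dense1 R Complexes _ Defs.Hermitian Antilinear false
      false (antiC _) (autoC _) B J hB hJ hc (@transitive_rigid1 R Complexes _ Defs.Hermitian
      Antilinear false false (antiC _) (autoC _) B J hB hJ hc (rigid_symmetric R)) herC).
  - move=> n B J hB hJ hc _ hin; exact: (@dense1 R Complexes _ Defs.Hermitian Antilinear false true
      (antiC _) (autoC _) B J hB hJ hc (@transitive_rigid1 R Complexes _ Defs.Hermitian Antilinear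
      false true (antiC _) (autoC _) B J hB hJ hc skC) herC).
  - move=> p q B J hB hJ hc _ hin; exact: (@dense1 R Complexes _ SkewSymmetric Antilinear true
      false (antiC _) (autoC _) B J hB hJ hc (@transitive_inertia1 R Complexes _ SkewSymmetric
      Antilinear true false (antiC _) (autoC _) B J hB hJ hc _ _ (fun=> erefl) erefl erefl (hin _
      erefl)) (isotropy_unit_skew R _ _)).
  - move=> n B J hB hJ hc _ hin; exact: (@not_dense1 R Complexes _ Symmetric Antilinear true false
      (antiC _) (autoC _) B J hB hJ hc n (ci R) (- ci R) erefl (fun=> erefl) ciC cixy cixh ciyh).
  - move=> n B J hB hJ hc _ hin; exact: (@dense1 R Complexes _ Defs.Hermitian Antilinear true false
      (antiC _) (autoC _) B J hB hJ hc (@transitive_rigid1 R Complexes _ Defs.Hermitian Antilinear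
      true false (antiC _) (autoC _) B J hB hJ hc skC) herC).
  - move=> n B J hB hJ hc _ hin; exact: (@dense1 R Complexes _ Defs.Hermitian Antilinear true true
      (antiC _) (autoC _) B J hB hJ hc (@transitive_rigid1 R Complexes _ Defs.Hermitian Antilinear
      true true (antiC _) (autoC _) B J hB hJ hc (rigid_symmetric R)) herC).
  - move=> p q B J hB hJ hc _ hin; exact: (@dense1 R Quaternions _ Defs.Hermitian Linear false
      false antiH autoH B J hB hJ hc (@transitive_inertia1 R Quaternions _ Defs.Hermitian Linear
      false false antiH autoH B J hB hJ hc _ _ (fun=> erefl) erefl erefl (hin _ erefl)) herH).
  - move=> n B J hB hJ hc _ hin; exact: (@dense1 R Quaternions _ Antihermitian Linear false false
      antiH autoH B J hB hJ hc (@transitive_rigid1 R Quaternions _ Antihermitian Linear false false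
      antiH autoH B J hB hJ hc (rigid_antihermitian R)) (isotropy_unit_skew R _ _)).
  - move=> n B J hB hJ hc _ hin; exact: (@dense1 R Quaternions _ Defs.Hermitian Linear false true
      antiH autoH B J hB hJ hc (@transitive_rigid1 R Quaternions _ Defs.Hermitian Linear false true
      antiH autoH B J hB hJ hc (rigid_antihermitian R)) herH).
  - move=> n B J hB hJ hc _ hin; exact: (@not_dense1 R Quaternions _ Antihermitian Linear false
      true antiH autoH B J hB hJ hc n 1 1 erefl (fun=> erefl) (oneC _) (mulr1 _) (tw1 _ _ _) erefl).
  - move=> p q B J hB hJ hc _ hin; exact: (@dense1 R Quaternions _ Antihermitian Linear true false
      antiH autoH B J hB hJ hc (@transitive_inertia1 R Quaternions _ Antihermitian Linear true
      false antiH autoH B J hB hJ hc _ _ (fun=> erefl) erefl erefl (hin _ erefl))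
      (isotropy_unit_skew R _ _)).
  - move=> n B J hB hJ hc _ hin; exact: (@dense1 R Quaternions _ Defs.Hermitian Linear true false
      antiH autoH B J hB hJ hc (@transitive_rigid1 R Quaternions _ Defs.Hermitian Linear true false
      antiH autoH B J hB hJ hc (rigid_antihermitian R)) herH).
  - move=> n B J hB hJ hc _ hin; exact: (@dense1 R Quaternions _ Antihermitian Linear true true
      antiH autoH B J hB hJ hc (@transitive_rigid1 R Quaternions _ Antihermitian Linear true true
      antiH autoH B J hB hJ hc (rigid_antihermitian R)) (isotropy_unit_skew R _ _)).
  - move=> n B J hB hJ hc _ hin; exact: (@not_dense1 R Quaternions _ Defs.Hermitian Linear true
      true antiH autoH B J hB hJ hc n 1 1 erefl (fun=> erefl) (oneC _) (mulr1 _) (tw1 _ _ _) erefl).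
- move=> k t d n; case=> B hB _.
  + exact: (components2 (antiR _) hB).
  + exact: (dense2 (antiR _) hB (isotropy_unit_skew R _ _)).
  + exact: (components2 (antiC _) hB).
  + exact: (dense2 (antiC _) hB (isotropy_unit_skew R _ _)).
  + exact: (@dense2 R Complexes _ Defs.Hermitian (antiC _) B hB herC).
  + exact: (@dense2 R Quaternions _ Defs.Hermitian antiH B hB herH).
  + exact: (@dense2 R Quaternions _ Antihermitian antiH B hB (isotropy_unit_skew R _ _)).
- move=> k l eps n; case=> J hJ _.
  + exact: (@dense3 R Reals n Linear false J).
  + exact: (@dense3 R Reals n Linear true J).
  + exact: (@dense3 R Complexes n Linear false J).
  + exact: (@dense3 R Complexes n Antilinear false J).
  + exact: (@dense3 R Complexes n Antilinear true J).
  + exact: (@dense3 R Quaternions n Linear false J).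
  + exact: (@dense3 R Quaternions n Linear true J).
- move=> k t N inertia m d; case.
  + by move=> p q m' _ D hD hin; apply: (not_dense4 (antiR _) hD) => //; exact: hin.
  + by move=> k' l D hD _; exact: (dense4 (antiR _) hD _ skR).
  + by move=> n m' D hD _; exact: (dense4 (antiC _) hD _ (rigid_symmetric R)).
  + by move=> k' l D hD _; exact: (dense4 (antiC _) hD _ skC).
  + by move=> p q m' _ D hD hin; apply: (not_dense4 (antiC _) hD) => //; exact: hin.
  + by move=> p q m' _ D hD hin; apply: (@not_dense4 R Quaternions _ Defs.Hermitian antiH D hD) =>
      //; exact: hin.
  + by move=> m' n D hD _; exact: (@dense4 R Quaternions _ Antihermitian antiH D hD _
      (rigid_antihermitian R)).
- exact: dense5.
Qed.
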